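(* Let $\mu\in\mathbb{R}\setminus\{0,1\}$ and let $s\in[1,\frac32]$ be fixed. Then the following hold: (a) For any $z\in\mathbb{C}\setminus\mathrm{spec}(B)$ one has $$\ker(A_{(s)}-z)=P_z\Big(\big\{\psi\in H^{s-\frac12}(\Sigma):\ \psi\in\ker(\Theta-M_z)\big\}\Big).$$ In particular, $\Theta-M_z:H^{s-\frac12}(\Sigma)\to H^{s-\frac32}(\Sigma)$ is injective for all non-real $z$, as $A_{(s)}$ is symmetric. (b) Let $z\in\mathbb{C}\setminus\mathrm{spec}(B)$ be such that $\Theta-M_z:H^{s-\frac12}(\Sigma)\to H^{s-\frac32}(\Sigma)$ is injective, and let $P_{\bar z}^*:L^2(\Omega)\to L^2(\Sigma)$ be the adjoint of $P_{\bar z}:L^2(\Sigma)\to L^2(\Omega)$. If $f\in L^2(\Omega)$ satisfies $P_{\bar z}^*f\in(\Theta-M_z)\big(H^{s-\frac12}(\Sigma)\big)$, then $f\in\mathrm{ran}(A_{(s)}-z)$ and $$(A_{(s)}-z)^{-1}f=(B-z)^{-1}f+P_z(\Theta-M_z)^{-1}P_{\bar z}^*f.$$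
   Context: Geometry. Let $n\ge 2$, let $\Omega\subset\mathbb{R}^n$ be a non-empty bounded open set with Lipschitz boundary, and let $\Omega_-\subset\Omega$ be a non-empty open subset with Lipschitz boundary such that $\overline{\Omega_-}\subset\Omega$. Put $\Omega_+=\Omega\setminus\overline{\Omega_-}$, $\Sigma=\partial\Omega_-$, and assume that $\Sigma$ is connected; thus $\partial\Omega_+=\Sigma\cup\partial\Omega$. Let $\nu$ be the unit normal on $\Sigma$ pointing into $\Omega_+$. Functions $f\in L^2(\Omega)$ are identified with pairs $(f_+,f_-)$ of restrictions to $\Omega_\pm$. Traces. For an open set $U$ let $H^s_\Delta(U)=\{f\in H^s(U):\Delta f\in L^2(U)\}$ with norm $\|f\|^2=\|f\|_{H^s(U)}^2+\|\Delta f\|_{L^2(U)}^2$. For $s\in[\frac12,\frac32]$: $\gamma_D^\pm:H^s_\Delta(\Omega_\pm)\to H^{s-\frac12}(\Sigma)$ and $\gamma_D^\partial:H^s_\Delta(\Omega_+)\to H^{s-\frac12}(\partial\Omega)$ are the (bounded) Dirichlet traces on $\Sigma$, resp. $\partial\Omega$. For $s\in[1,\frac32]$, $\gamma_N^\pm:H^s_\Delta(\Omega_\pm)\to H^{s-\frac32}(\Sigma)$ are the (bounded) Neumann traces, the continuous extensions of $\gamma_N^\pm f_\pm=\mp\langle\nu,(\nabla f_\pm)|_\Sigma\rangle$, $f_\pm\in C^\infty(\overline{\Omega_\pm})$ (outward normal derivative with respect to $\Omega_\pm$). Operators in $L^2(\Omega)$. $A_{(s)}$ acts as $(f_+,f_-)\mapsto(-\Delta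 f_+,-\mu\Delta f_-)$ on the domain of all $(f_+,f_-)\in H^s_\Delta(\Omega_+)\oplus H^s_\Delta(\Omega_-)$ with $\gamma_D^\partial f_+=0$ on $\partial\Omega$, $\gamma_D^-f_-=\gamma_D^+f_+$ on $\Sigma$, and $\mu\gamma_N^-f_-+\gamma_N^+f_+=0$ on $\Sigma$; it is a densely defined symmetric operator. $-\Delta_\pm$ is the Dirichlet Laplacian in $L^2(\Omega_\pm)$, acting as $-\Delta$ on the functions in $H^{3/2}_\Delta(\Omega_\pm)$ with zero Dirichlet trace on $\partial\Omega_\pm$; it is self-adjoint with compact resolvent. $B:=(-\Delta_+)\oplus(-\mu\Delta_-)$. Poisson operators. For $z\in\mathbb{C}\setminus\mathrm{spec}(B)$, $t\in[0,1]$ and $\varphi\in H^t(\Sigma)$, $P_z\varphi=(f_+,f_-)$ is the unique element of $H^{t+\frac12}_\Delta(\Omega_+)\oplus H^{t+\frac12}_\Delta(\Omega_-)$ with $(-\Delta-z)f_+=0$ in $\Omega_+$, $(-\mu\Delta-z)f_-=0$ in $\Omega_-$, $\gamma_D^\partial f_+=0$, $\gamma_D^+f_+=\varphi=\gamma_D^-f_-$. The map $P_z:H^t(\Sigma)\to H^{t+\frac12}_\Delta(\Omega_+)\oplus H^{t+\frac12}_\Delta(\Omega_-)$ is bounded; in particular ($t=0$) $P_z:L^2(\Sigma)\to L^2(\Omega)$ is bounded. Dirichlet-to-Neumann operators. For $\varphi\in H^{s-\frac12}(\Sigma)$, $s\in[1,\frac32]$: $\widetilde N^+_z\varphi=\gamma_N^+f_+$,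 where $f_+\in H^s_\Delta(\Omega_+)$ is the unique solution of $(-\Delta-z)f_+=0$, $\gamma_D^+f_+=\varphi$, $\gamma_D^\partial f_+=0$ ($z\notin\mathrm{spec}(-\Delta_+)$); $N^-_z\varphi=\gamma_N^-f_-$, where $f_-\in H^s_\Delta(\Omega_-)$ is the unique solution of $(-\Delta-z)f_-=0$, $\gamma_D^-f_-=\varphi$ ($z\notin\mathrm{spec}(-\Delta_-)$). Both map $H^{s-\frac12}(\Sigma)\to H^{s-\frac32}(\Sigma)$ boundedly. Set $\Theta:=\widetilde N^+_0+\mu N^-_0$ and, for $z\in\mathbb{C}\setminus\mathrm{spec}(B)$, $M_z:=\Theta-\big(\widetilde N^+_z+\mu N^-_{z/\mu}\big)$, both as operators $H^{s-\frac12}(\Sigma)\to H^{s-\frac32}(\Sigma)$. *)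

(* Defs.v *)
From HB Require Import structures.
From mathcomp Require Import all_boot all_order all_algebra.
From mathcomp Require Import all_classical all_reals all_analysis.
From mathcomp Require Import complex.
Set Implicit Arguments.
Unset Strict Implicit.
Unset Printing Implicit Defensive.
Import Order.TTheory GRing.Theory Num.Theory numFieldNormedType.Exports.
Local Open Scope classical_set_scope.
Local Open Scope ring_scope.

(* [borelT R n] is R^n with its Borel sigma-algebra.  Functions on R^n, on an
   open set U and on a hypersurface are all represented by total functions
   [fn R n]; only the values on U, respectively almost everywhere for the
   surface measure, matter. *)
Definition borelT (R : realType) (n : nat) := g_sigma_algebraType (@open 'rV[R]_n).
Definition fn (R : realType) (n : nat) : Type := 'rV[R]_n -> R[i].

Section FunctionSpaces.
Variables (R : realType) (n : nat).
Notation E := 'rV[R]_n.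
Notation F := (fn R n).
Notation meas := {measure set (borelT R n) -> \bar R}.

Definition dotp (x y : E) : R := \sum_i x 0 i * y 0 i.
(* the library norm on 'rV[R]_n is the sup norm *)
Definition enorm (x : E) : R := Num.sqrt (dotp x x).
Definition csq (z : R[i]) : R := complex.Re z ^+ 2 + complex.Im z ^+ 2.
Definition bdry (U : set E) : set E := closure U `\` interior U.

(* Lebesgue measure on Borel sets: the unique measure with the right value on
   boxes. *)
Definition is_lebesgue (lam : meas) : Prop :=
  forall a b : E, (forall i, a 0 i <= b 0 i) ->
    lam [set x : E | forall i, a 0 i < x 0 i <= b 0 i]
      = (\prod_i (b 0 i - a 0 i))%:E.

(* Near each boundary point, U is the strict subgraph, in some direction e, of
   a Lipschitz function h of the coordinates orthogonal to e. *)
Definition lipschitz_boundary (U : set E) : Prop :=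
  forall p, bdry U p ->
    exists (V : set E) (e : E) (h : E -> R) (L : R),
      [/\ open V /\ V p,
          enorm e = 1,
          forall x t, h (x + t *: e) = h x,
          forall x y, `|h x - h y| <= L * enorm (x - y)
        & forall x, V x -> (U x <-> dotp x e < h x)].

Definition pderiv (i : 'I_n) (f : E -> R) : E -> R :=
  fun x => 'D_(delta_mx 0 i) f x.
Definition smooth_fun (f : E -> R) : Prop :=
  forall r : seq 'I_n,
    continuous (foldr pderiv f r) /\
    forall i x, derivable (foldr pderiv f r) x (delta_mx 0 i).
(* C_c^oo(U) *)
Definition test_fun (U : set E) (f : E -> R) : Prop :=
  smooth_fun f /\
  exists K : set E, [/\ compact K, K `<=` U & forall x, ~ K x -> f x = 0].
(* C^oo of the closure of a bounded open set: restrictions of smooth functions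
   on R^n *)
Definition csmooth (v : F) : Prop :=
  smooth_fun (fun x => complex.Re (v x)) /\ smooth_fun (fun x => complex.Im (v x)).
Definition cpartial (i : 'I_n) (v : F) : F := fun x =>
  Complex (pderiv i (fun y => complex.Re (v y)) x)
          (pderiv i (fun y => complex.Im (v y)) x).

(* A hypersurface, presented by its surface measure and a unit normal field. *)
Record surface := Surface {
  area : {finite_measure set (borelT R n) -> \bar R};
  unormal : E -> E }.

(* S is the boundary of U: the area measure lives on the boundary and, together
   with the outer unit normal, it is the Gauss-Green (perimeter) measure of U.
   By uniqueness in the Riesz representation theorem this determines the
   measure, and the normal up to a null set; if U has Lipschitz boundary, they
   are the (n-1)-dimensional Hausdorff measure on it and its outer normal. *)
Definition is_boundary_of (lam : meas) (U : set E) (S : surface) : Prop :=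
  [/\ area S (~` bdry U) = 0%E,
      (forall i, measurable_fun setT (fun x : borelT R n => unormal S x 0 i)),
      {ae (area S), forall x, enorm (unormal S x) = 1}
    & forall (i : 'I_n) (f : E -> R), test_fun setT f ->
        Rintegral lam U (pderiv i f) =
        Rintegral (area S) setT (fun x => f x * unormal S x 0 i)].

Definition fsub (u v : F) : F := fun x => u x - v x.
Definition cintegral (mu : meas) (D : set E) (u : F) : R[i] :=
  Complex (Rintegral mu D (fun x => complex.Re (u x)))
          (Rintegral mu D (fun x => complex.Im (u x))).
(* inner product of L^2(D), linear in the first argument *)
Definition innerL2 (mu : meas) (D : set E) (u v : F) : R[i] :=
  cintegral mu D (fun x => u x * (v x)^*%C).
Definition ae_eq_on (mu : meas) (D : set E) (u v : F) : Prop :=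
  {ae mu, forall x, D x -> u x = v x}.

(* The squared norms below take the value +oo outside the space at hand, so
   membership is finiteness of the norm. *)
Definition sqL2 (mu : meas) (D : set E) (u : F) : \bar R :=
  if `[< measurable_fun (D : set (borelT R n)) (fun x => complex.Re (u x)) /\
         measurable_fun (D : set (borelT R n)) (fun x => complex.Im (u x)) >]
  then (\int[mu]_(x in D) (csq (u x))%:E)%E else +oo%E.
(* Sobolev-Slobodeckij norm of order 0 <= theta < 1 in dimension d *)
Definition sqSlob (mu : meas) (D : set E) (d theta : R) (u : F) : \bar R :=
  if theta == 0 then sqL2 mu D u else
  (sqL2 mu D u +
   \int[mu]_(x in D) \int[mu]_(y in D)
     (csq (u x - u y) / enorm (x - y) `^ (d + 2 * theta))%:E)%E.

Definition weak_partial (lam : meas) (U : set E) (i : 'I_n) (u g : F) : Prop :=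
  (sqL2 lam U g < +oo)%E /\
  forall f, test_fun U f ->
    cintegral lam U (fun x => u x * ((pderiv i f x)%:C)%C) =
    - cintegral lam U (fun x => g x * ((f x)%:C)%C).
Definition weak_lap (lam : meas) (U : set E) (u l : F) : Prop :=
  (sqL2 lam U l < +oo)%E /\
  forall f, test_fun U f ->
    cintegral lam U (fun x => u x * ((\sum_i pderiv i (pderiv i f) x)%:C)%C) =
    cintegral lam U (fun x => l x * ((f x)%:C)%C).

(* H^s(U), 0 <= s < 2 *)
Definition sqH (lam : meas) (s : R) (U : set E) (u : F) : \bar R :=
  if s < 1 then sqSlob lam U n%:R s u else
  ereal_inf [set (sqL2 lam U u + \sum_(i < n) sqSlob lam U n%:R (s - 1) (g i))%E
            | g in [set g : 'I_n -> F | forall i, weak_partial lam U i u (g i)]].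
(* H^s_Delta(U) *)
Definition sqHDelta (lam : meas) (s : R) (U : set E) (u : F) : \bar R :=
  ereal_inf [set (sqH lam s U u + sqL2 lam U l)%E | l in weak_lap lam U u].
Definition in_HDelta lam s U u : Prop := (sqHDelta lam s U u < +oo)%E.

(* g is the tangential derivative (nu_i d_j - nu_j d_i) phi *)
Definition weak_tangential (S : surface) (i j : 'I_n) (phi g : F) : Prop :=
  (sqL2 (area S) setT g < +oo)%E /\
  forall f, test_fun setT f ->
    cintegral (area S) setT (fun x => phi x *
      ((unormal S x 0 i * pderiv j f x - unormal S x 0 j * pderiv i f x)%:C)%C) =
    - cintegral (area S) setT (fun x => g x * ((f x)%:C)%C).
(* H^t(S), 0 <= t <= 1 *)
Definition sqHb (S : surface) (t : R) (phi : F) : \bar R :=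
  if t < 1 then sqSlob (area S) setT (n.-1)%:R t phi else
  ereal_inf [set (sqL2 (area S) setT phi +
                  \sum_(i < n) \sum_(j < n) sqL2 (area S) setT (g i j))%E
            | g in [set g : 'I_n -> 'I_n -> F |
                    forall i j, weak_tangential S i j phi (g i j)]].
Definition in_Hb S t phi : Prop := (sqHb S t phi < +oo)%E.

(* H^{-t}(S), 0 <= t <= 1/2, is the dual of H^t(S).  Its elements are
   represented by total maps F -> R[i], of which only the values on H^t(S)
   matter; a function g in L^2(S) is identified with the functional [surf_pair S g],
   the bilinear extension of the L^2 pairing. *)
Definition surf_pair (S : surface) (g : F) : F -> R[i] :=
  fun phi => cintegral (area S) setT (fun x => g x * phi x).
Definition dual_eq (S : surface) (t : R) (T1 T2 : F -> R[i]) : Prop :=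
  forall phi, in_Hb S t phi -> T1 phi = T2 phi.

(* The traces on a part S of the boundary of U are the continuous extensions to
   H^s_Delta(U) of their classical counterparts on smooth functions: phi (resp.
   T) is the trace of u if it is the limit of the traces of smooth functions
   approximating u. *)
Definition is_dirichlet_trace lam (s : R) U (S : surface) (u phi : F) : Prop :=
  exists v : nat -> F,
    [/\ forall k, csmooth (v k),
        (sqHDelta lam s U (fsub (v k) u) @[k --> \oo] --> 0)%E
      & (sqHb S (s - 1 / 2) (fsub (v k) phi) @[k --> \oo] --> 0)%E].
(* eps = 1 if [unormal S] is the outer normal of U, and -1 if it is the inner
   one; the limit is taken in H^{s - 3/2}(S). *)
Definition is_neumann_trace lam (s : R) U (S : surface) (eps : R)
    (u : F) (T : F -> R[i]) : Prop :=
  exists v : nat -> F,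
    [/\ forall k, csmooth (v k),
        (sqHDelta lam s U (fsub (v k) u) @[k --> \oo] --> 0)%E
      & forall e : R, 0 < e -> \forall k \near \oo,
          forall phi, in_Hb S (3 / 2 - s) phi ->
            ((csq (surf_pair S (fun x => (eps%:C)%C *
                 \sum_i ((unormal S x 0 i)%:C)%C * cpartial i (v k) x) phi
               - T phi))%:E <= e%:E * sqHb S (3 / 2 - s) phi)%E].
Definition dirichlet_trace lam s U S u : F :=
  xget (fun=> 0) [set phi | is_dirichlet_trace lam s U S u phi].
Definition neumann_trace lam s U S eps u : F -> R[i] :=
  xget (fun=> 0) [set T | is_neumann_trace lam s U S eps u T].

Definition dirichlet_trace_bounded lam s U S : Prop :=
  (forall u, in_HDelta lam s U u -> exists phi, is_dirichlet_trace lam s U S u phi) /\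
  exists C : R, forall u phi, in_HDelta lam s U u ->
    is_dirichlet_trace lam s U S u phi ->
    (sqHb S (s - 1 / 2) phi <= C%:E * sqHDelta lam s U u)%E.
Definition neumann_trace_bounded lam s U S eps : Prop :=
  (forall u, in_HDelta lam s U u -> exists T, is_neumann_trace lam s U S eps u T) /\
  exists C : R, forall u T phi, in_HDelta lam s U u ->
    is_neumann_trace lam s U S eps u T -> in_Hb S (3 / 2 - s) phi ->
    ((csq (T phi))%:E <=
      C%:E * (sqHDelta lam s U u * sqHb S (3 / 2 - s) phi))%E.

(* Unbounded operators in L^2(D) are given by their graphs, which are closed
   under almost everywhere equality. *)
Definition operator := F -> F -> Prop.
Definition op_shift (lam : meas) (D : set E) (T : operator) (z : R[i]) : operator :=
  fun u f => exists2 g, T u g & ae_eq_on lam D f (fun x => g x - z * u x).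
Definition resolvent_set lam D (T : operator) (z : R[i]) : Prop :=
  (forall f, (sqL2 lam D f < +oo)%E -> exists u, op_shift lam D T z u f) /\
  exists C : R, forall u f, op_shift lam D T z u f ->
    (sqL2 lam D u <= C%:E * sqL2 lam D f)%E.
Definition op_spec lam D T : set R[i] := [set z | ~ resolvent_set lam D T z].
Definition op_injective lam D (T : operator) : Prop :=
  forall u1 u2 f, T u1 f -> T u2 f -> ae_eq_on lam D u1 u2.
Definition op_inv (T : operator) (f : F) : F := xget (fun=> 0) [set u | T u f].
Definition op_symmetric lam D (T : operator) : Prop :=
  forall u f v g, T u f -> T v g -> innerL2 lam D f v = innerL2 lam D u g.
Definition densely_defined lam D (T : operator) : Prop :=
  forall f, (sqL2 lam D f < +oo)%E -> forall e : R, 0 < e ->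
    exists u g, T u g /\ (sqL2 lam D (fsub f u) < e%:E)%E.
Definition self_adjoint lam D (T : operator) : Prop :=
  [/\ densely_defined lam D T, op_symmetric lam D T
    & forall v w, (sqL2 lam D v < +oo)%E -> (sqL2 lam D w < +oo)%E ->
        (forall u f, T u f -> innerL2 lam D f v = innerL2 lam D u w) -> T v w].

(* (- kappa Delta - z) u = 0 in U *)
Definition helmholtz lam U (kappa : R) (z : R[i]) (u : F) : Prop :=
  exists2 l, weak_lap lam U u l &
    ae_eq_on lam U (fun x => - (kappa%:C)%C * l x) (fun x => z * u x).

End FunctionSpaces.

(* Sigma carries the normal pointing out of Omega_-, that is, into Omega_+. *)
Record transmission (R : realType) (n : nat) := Transmission {
  Om : set 'rV[R]_n;
  Omm : set 'rV[R]_n;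
  lebn : {measure set (borelT R n) -> \bar R};
  Sig : surface R n;
  dOm : surface R n;
  dim_ge2 : (2 <= n)%N;
  lamP : is_lebesgue lebn;
  Om_open : open Om;
  Om_neq0 : Om !=set0;
  Om_bounded : bounded_set Om;
  Om_lipschitz : lipschitz_boundary Om;
  Omm_open : open Omm;
  Omm_neq0 : Omm !=set0;
  Omm_lipschitz : lipschitz_boundary Omm;
  Omm_sub : closure Omm `<=` Om;
  Sig_connected : connected (bdry Omm);
  SigP : is_boundary_of lebn Omm Sig;
  dOmP : is_boundary_of lebn Om dOm }.

Section Transmission.
Variables (R : realType) (n : nat) (G : transmission R n).
Notation F := (fn R n).
Notation lam := (lebn G).
Notation Sig := (Sig G).
Notation dOm := (dOm G).

Definition Omp : set 'rV[R]_n := Om G `\` closure (Omm G).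
(* Omega without the null set Sigma: L^2(bulk) is L^2(Omega), with functions
   identified with pairs of restrictions *)
Definition bulk : set 'rV[R]_n := Omp `|` Omm G.

Definition gammaD_p s u := dirichlet_trace lam s Omp Sig u.
Definition gammaD_m s u := dirichlet_trace lam s (Omm G) Sig u.
Definition gammaD_bd s u := dirichlet_trace lam s Omp dOm u.
Definition gammaN_p s u := neumann_trace lam s Omp Sig (-1) u.
Definition gammaN_m s u := neumann_trace lam s (Omm G) Sig 1 u.

Definition eq_Sig := ae_eq_on (area Sig) setT.
Definition eq_dOm := ae_eq_on (area dOm) setT.

(* f = (- Delta u_+, - mu Delta u_-) *)
Definition transmission_action (mu : R) (u f : F) : Prop :=
  exists lp lm,
    [/\ weak_lap lam Omp u lp, weak_lap lam (Omm G) u lm,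
        ae_eq_on lam Omp f (fun x => - lp x)
      & ae_eq_on lam (Omm G) f (fun x => - (mu%:C)%C * lm x)].

Definition A_op (mu s : R) : operator R n := fun u f =>
  [/\ in_HDelta lam s Omp u /\ in_HDelta lam s (Omm G) u,
      eq_dOm (gammaD_bd s u) (fun=> 0),
      eq_Sig (gammaD_m s u) (gammaD_p s u),
      dual_eq Sig (3 / 2 - s)
        (fun phi => (mu%:C)%C * gammaN_m s u phi + gammaN_p s u phi) (fun=> 0)
    & transmission_action mu u f].

Definition dirichlet_p : operator R n := fun u f =>
  [/\ in_HDelta lam (3 / 2) Omp u,
      eq_dOm (gammaD_bd (3 / 2) u) (fun=> 0),
      eq_Sig (gammaD_p (3 / 2) u) (fun=> 0)
    & exists2 l, weak_lap lam Omp u l & ae_eq_on lam Omp f (fun x => - l x)].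
Definition dirichlet_m : operator R n := fun u f =>
  [/\ in_HDelta lam (3 / 2) (Omm G) u,
      eq_Sig (gammaD_m (3 / 2) u) (fun=> 0)
    & exists2 l, weak_lap lam (Omm G) u l &
        ae_eq_on lam (Omm G) f (fun x => - l x)].
Definition B_op (mu : R) : operator R n := fun u f =>
  exists2 f' : F, dirichlet_p u f /\ dirichlet_m u f' &
    ae_eq_on lam (Omm G) f (fun x => (mu%:C)%C * f' x).
Definition spec_B mu : set R[i] := op_spec lam bulk (B_op mu).

Definition is_poisson (mu t : R) (z : R[i]) (phi u : F) : Prop :=
  [/\ in_HDelta lam (t + 1 / 2) Omp u /\ in_HDelta lam (t + 1 / 2) (Omm G) u,
      helmholtz lam Omp 1 z u /\ helmholtz lam (Omm G) mu z u,
      eq_dOm (gammaD_bd (t + 1 / 2) u) (fun=> 0),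
      eq_Sig (gammaD_p (t + 1 / 2) u) phi
    & eq_Sig (gammaD_m (t + 1 / 2) u) phi].
(* The operators for t > 0 are restrictions of the one for t = 0. *)
Definition poisson_op mu z phi : F :=
  xget (fun=> 0) [set u | is_poisson mu 0 z phi u].
(* g = P_z^* f, as an operator from L^2(Omega) to L^2(Sigma) *)
Definition is_poisson_adjoint mu z (f g : F) : Prop :=
  (sqL2 (area Sig) setT g < +oo)%E /\
  forall phi, (sqL2 (area Sig) setT phi < +oo)%E ->
    innerL2 lam bulk (poisson_op mu z phi) f = innerL2 (area Sig) setT phi g.

Definition dn_p (s : R) (z : R[i]) (phi : F) : F -> R[i] :=
  gammaN_p s (xget (fun=> 0) [set u |
    [/\ in_HDelta lam s Omp u, helmholtz lam Omp 1 z u,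
        eq_Sig (gammaD_p s u) phi & eq_dOm (gammaD_bd s u) (fun=> 0)]]).
Definition dn_m (s : R) (z : R[i]) (phi : F) : F -> R[i] :=
  gammaN_m s (xget (fun=> 0) [set u |
    [/\ in_HDelta lam s (Omm G) u, helmholtz lam (Omm G) 1 z u
      & eq_Sig (gammaD_m s u) phi]]).
Definition Theta (mu s : R) (phi : F) : F -> R[i] := fun chi =>
  dn_p s 0 phi chi + (mu%:C)%C * dn_m s 0 phi chi.
Definition M_op (mu s : R) (z : R[i]) (phi : F) : F -> R[i] := fun chi =>
  Theta mu s phi chi -
    (dn_p s z phi chi + (mu%:C)%C * dn_m s (z / (mu%:C)%C) phi chi).
Definition ThetaM (mu s : R) (z : R[i]) (phi : F) : F -> R[i] := fun chi =>
  Theta mu s phi chi - M_op mu s z phi chi.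
Definition ThetaM_injective mu s z : Prop :=
  forall psi1 psi2, in_Hb Sig (s - 1 / 2) psi1 -> in_Hb Sig (s - 1 / 2) psi2 ->
    dual_eq Sig (3 / 2 - s) (ThetaM mu s z psi1) (ThetaM mu s z psi2) ->
    eq_Sig psi1 psi2.
Definition ThetaM_inv mu s z (T : F -> R[i]) : F :=
  xget (fun=> 0) [set psi | in_Hb Sig (s - 1 / 2) psi /\
                            dual_eq Sig (3 / 2 - s) (ThetaM mu s z psi) T].

(* Classical facts on Lipschitz domains, which the theory of A_op presupposes:
   existence and boundedness of the traces, self-adjointness of the Dirichlet
   Laplacians, solvability of the Dirichlet problem. *)
Definition traces_bounded : Prop :=
  (forall s, 1 / 2 <= s <= 3 / 2 ->
     [/\ dirichlet_trace_bounded lam s Omp Sig,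
         dirichlet_trace_bounded lam s (Omm G) Sig
       & dirichlet_trace_bounded lam s Omp dOm]) /\
  (forall s, 1 <= s <= 3 / 2 ->
     neumann_trace_bounded lam s Omp Sig (-1) /\
     neumann_trace_bounded lam s (Omm G) Sig 1).

Definition dirichlet_laplacians_self_adjoint : Prop :=
  self_adjoint lam Omp dirichlet_p /\ self_adjoint lam (Omm G) dirichlet_m.

Definition poisson_well_posed (mu : R) : Prop :=
  forall z, ~ spec_B mu z -> forall t, 0 <= t <= 1 ->
    (forall phi, in_Hb Sig t phi ->
       is_poisson mu t z phi (poisson_op mu z phi) /\
       forall u, is_poisson mu t z phi u ->
         ae_eq_on lam bulk u (poisson_op mu z phi)) /\
    exists C : R, forall phi, in_Hb Sig t phi ->
      (sqHDelta lam (t + 1 / 2) Omp (poisson_op mu z phi) +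
       sqHDelta lam (t + 1 / 2) (Omm G) (poisson_op mu z phi)
         <= C%:E * sqHb Sig t phi)%E.

End Transmission.

(* Main.v *)
(** For u in the kernel of A - z the common Dirichlet trace psi on Sigma satisfies
    u = P_z psi, and since M_z subtracts Theta again, Theta - M_z applied to psi is
    the jump J u = mu gamma_N^- u + gamma_N^+ u of the weighted normal derivative;
    this gives (a).  Non-real z lie outside spec(B), because T - z is onto for a
    self-adjoint T, so that a kernel element of Theta - M_z would give an eigenvector
    of the symmetric operator A.

    For (b), put u_B = (B - z)^{-1} f and let h be a test function in Omega.
    The function P_{z^*} h - h vanishes on Sigma, hence lies in the domain of
    the Dirichlet Laplacians; their symmetry and Green's identity against h give
    (J u_B)(h) = - <f, P_{z^*} h>, which is - (P_{z^*}^* f)(h).  Continuity of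
    both sides on H^{3/2-s}(Sigma) extends this to all h.  Hence
    J(u_B + P_z psi) = 0 as soon as (Theta - M_z) psi = P_{z^*}^* f, that is,
    u_B + P_z psi solves (A - z) u = f.

    Two points need an argument because only the abstract facts on traces are
    given: Sigma is a Lebesgue null set, since each small piece
    of it has infinitely many disjoint translates inside a bounded set; and test functions belong to
    H^{3/2}, by a dyadic estimate of the Slobodeckij kernel. *)
Require Import Defs.
From mathcomp Require Import all_boot all_order all_algebra.
From mathcomp Require Import all_classical all_reals all_analysis.
From mathcomp Require Import complex measurable_realfun.
From mathcomp Require Import ring lra.
Import Order.TTheory GRing.Theory Num.Theory numFieldNormedType.Exports.
Local Open Scope classical_set_scope.
Local Open Scope ring_scope.
Set Implicit Arguments.
Unset Strict Implicit.
Unset Printing Implicit Defensive.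

(** * Complex-valued square-integrable functions *)

(** Functions are total maps, and [dirichlet_trace], [neumann_trace], [poisson_op] and [op_inv] are
    choices by [xget]; so each identity holds almost everywhere and rests on an existence and a
    uniqueness statement. As the norms are squared and may be infinite, a single inequality, packed
    in [qnorm], does the work of the norm axioms. The domain of B lives at order 3/2 and that of A
    at order s; traces of one function at two orders are compared through a common sequence of
    smooth approximants. Density of test functions in H^{3/2-s}(Sigma) is derived: a datum of that
    order is the Dirichlet trace of a Poisson solution of order 2-s, and a trace is by definition a
    limit of smooth functions. Uniqueness of the weak Laplacian is likewise derived, from
    self-adjointness of the Dirichlet Laplacians. Since mu is real and non-zero, Im (z / mu)
    vanishes only with Im z; hence non-real z are in the resolvent set of B for either sign of
    mu. *)

Section ComplexNumbers.
Variable R : realType.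
Implicit Types a b : R[i].

Lemma CReD a b : complex.Re (a + b) = complex.Re a + complex.Re b.
Proof. by case: a; case: b. Qed.
Lemma CImD a b : complex.Im (a + b) = complex.Im a + complex.Im b.
Proof. by case: a; case: b. Qed.
Lemma CReN a : complex.Re (- a) = - complex.Re a.
Proof. by case: a. Qed.
Lemma CImN a : complex.Im (- a) = - complex.Im a.
Proof. by case: a. Qed.
Lemma CReM a b : complex.Re (a * b) =
  complex.Re a * complex.Re b - complex.Im a * complex.Im b.
Proof. by case: a; case: b. Qed.
Lemma CImM a b : complex.Im (a * b) =
  complex.Re a * complex.Im b + complex.Im a * complex.Re b.
Proof. by case: a; case: b. Qed.
Lemma CReJ a : complex.Re (a^*)%C = complex.Re a.
Proof. by case: a. Qed.
Lemma CImJ a : complex.Im (a^*)%C = - complex.Im a.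
Proof. by case: a. Qed.
Lemma CReC (x : R) : complex.Re (x%:C)%C = x. Proof. by []. Qed.
Lemma CImC (x : R) : complex.Im (x%:C)%C = 0. Proof. by []. Qed.
Definition CE := (CReD, CImD, CReN, CImN, CReM, CImM, CReJ, CImJ, CReC, CImC).

Lemma eq_CReIm a b : complex.Re a = complex.Re b -> complex.Im a = complex.Im b ->
  a = b.
Proof. by case: a; case: b => /= ? ? ? ? -> ->. Qed.

Lemma csq_ge0 a : 0 <= csq a.
Proof. by rewrite addr_ge0// sqr_ge0. Qed.
Lemma csq0 : csq (0 : R[i]) = 0.
Proof. by rewrite /csq/= expr0n addr0. Qed.
Lemma csqM a b : csq (a * b) = csq a * csq b.
Proof. by rewrite /csq !CE; ring. Qed.
Lemma csqN a : csq (- a) = csq a.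
Proof. by rewrite /csq !CE; ring. Qed.
Lemma csqJ a : csq (a^*)%C = csq a.
Proof. by rewrite /csq !CE; ring. Qed.
Lemma csqC (x : R) : csq (x%:C)%C = x ^+ 2.
Proof. by rewrite /csq !CE; ring. Qed.
(** Stands in for the triangle inequality, all norms below being squared; the defect is
    [csq (a - b)]. *)
Lemma csqD_le a b : csq (a + b) <= 2 * csq a + 2 * csq b.
Proof.
rewrite /csq !CE -subr_ge0.
have -> : 2 * (complex.Re a ^+ 2 + complex.Im a ^+ 2) +
  2 * (complex.Re b ^+ 2 + complex.Im b ^+ 2) -
  ((complex.Re a + complex.Re b) ^+ 2 + (complex.Im a + complex.Im b) ^+ 2)
  = (complex.Re a - complex.Re b) ^+ 2 + (complex.Im a - complex.Im b) ^+ 2 by ring.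
by rewrite addr_ge0// sqr_ge0.
Qed.
Lemma csq_eq0 a : csq a = 0 -> a = 0.
Proof.
case: a => x y /eqP; rewrite /csq/= paddr_eq0 ?sqr_ge0// !sqrf_eq0.
by case/andP => /eqP -> /eqP ->.
Qed.
Lemma mulJ_csq a : a * (a^*)%C = (csq a)%:C%C.
Proof. by apply: eq_CReIm; rewrite !CE /csq; ring. Qed.

End ComplexNumbers.

Section L2.
Variables (R : realType) (n : nat).
Notation E := 'rV[R]_n.
Notation B := (borelT R n).
Notation F := (fn R n).
Notation meas := {measure set (borelT R n) -> \bar R}.

Lemma open_meas (U : set E) : open U -> measurable (U : set B).
Proof. exact: sub_sigma_algebra. Qed.
Lemma closed_meas (U : set E) : closed U -> measurable (U : set B).
Proof.
by move=> cU; rewrite -[U]setCK; apply: measurableC; apply: open_meas; exact: closed_openC.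
Qed.

Lemma continuous_meas (f : E -> R) (D : set B) :
  continuous f -> measurable_fun D (f : B -> R).
Proof.
move=> cf; apply: measurable_funTS.
apply: (measurability _ (RGenOpens.measurableE R)) => _ [_ [a [b ->] <-]].
rewrite setTI; apply: open_meas; exact: open_comp.
Qed.

Lemma aeS (mu : meas) (P Q : E -> Prop) : (forall x, P x -> Q x) ->
  {ae mu, forall x : B, P x} -> {ae mu, forall x : B, Q x}.
Proof. exact: (@filterS _ _ (ae_filter_ringOfSetsType mu)). Qed.
Lemma aeS2 (mu : meas) (P P' Q : E -> Prop) : (forall x, P x -> P' x -> Q x) ->
  {ae mu, forall x : B, P x} -> {ae mu, forall x : B, P' x} ->
  {ae mu, forall x : B, Q x}.
Proof. exact: (@filterS2 _ _ (ae_filter_ringOfSetsType mu)). Qed.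

(** Exactly the test inside [sqL2]: when it fails the squared norm is +oo, so membership in L^2
    carries measurability with it. *)
Definition mfn (D : set E) (u : F) : Prop :=
  measurable_fun (D : set B) (fun x : B => complex.Re (u x)) /\
  measurable_fun (D : set B) (fun x : B => complex.Im (u x)).

Lemma mfn_cst D c : mfn D (fun=> c).
Proof. by split; exact: measurable_cst. Qed.
Lemma mfnD D u v : mfn D u -> mfn D v -> mfn D (fun x => u x + v x).
Proof.
move=> [u1 u2] [v1 v2]; split.
  by under eq_fun do rewrite CReD; exact: measurable_funD.
by under eq_fun do rewrite CImD; exact: measurable_funD.
Qed.
Lemma mfnN D u : mfn D u -> mfn D (fun x => - u x).
Proof.
move=> [u1 u2]; split.
  by under eq_fun do rewrite CReN; exact: measurable_funN.
by under eq_fun do rewrite CImN; exact: measurable_funN.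
Qed.
Lemma mfnM D u v : mfn D u -> mfn D v -> mfn D (fun x => u x * v x).
Proof.
move=> [u1 u2] [v1 v2]; split.
  by under eq_fun do rewrite CReM; apply: measurable_funB; exact: measurable_funM.
by under eq_fun do rewrite CImM; apply: measurable_funD; exact: measurable_funM.
Qed.
Lemma mfnJ D u : mfn D u -> mfn D (fun x => (u x)^*)%C.
Proof.
move=> [u1 u2]; split.
  by under eq_fun do rewrite CReJ.
by under eq_fun do rewrite CImJ; exact: measurable_funN.
Qed.
Lemma mfn_real D (f : E -> R) :
  measurable_fun (D : set B) (f : B -> R) -> mfn D (fun x => (f x)%:C)%C.
Proof. by split => //=; exact: measurable_cst. Qed.
Lemma mfnS (D D' : set E) u : measurable (D : set B) -> D' `<=` D -> mfn D u -> mfn D' u.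
Proof. by move=> mD sD [u1 u2]; split; exact: measurable_funS mD sD _. Qed.
Lemma mfn_csq D u : mfn D u -> measurable_fun (D : set B) (fun x : B => csq (u x)).
Proof. by move=> [u1 u2]; apply: measurable_funD; exact: measurable_funX. Qed.

Definition inL2 (mu : meas) (D : set E) (u : F) : Prop := (sqL2 mu D u < +oo)%E.

Lemma sqL2_ge0 (mu : meas) D u : (0 <= sqL2 mu D u)%E.
Proof.
rewrite /sqL2; case: asboolP => // _.
by apply: integral_ge0 => x _; rewrite lee_fin csq_ge0.
Qed.

Lemma sqL2E (mu : meas) D u : mfn D u ->
  sqL2 mu D u = (\int[mu]_(x in (D : set B)) (csq (u x))%:E)%E.
Proof. by move=> m; rewrite /sqL2 asboolT. Qed.

Lemma inL2_mfn (mu : meas) D u : inL2 mu D u -> mfn D u.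
Proof. by rewrite /inL2 /sqL2; case: asboolP. Qed.

Section Fixed.
Variables (mu : meas) (D : set E).
Hypothesis mD : measurable (D : set B).
Local Notation L2 := (inL2 mu D).

Definition cintegrable (u : F) : Prop :=
  mu.-integrable (D : set B) (EFin \o (fun x : B => complex.Re (u x))) /\
  mu.-integrable (D : set B) (EFin \o (fun x : B => complex.Im (u x))).

Lemma L2_csq_integrable u : L2 u ->
  mu.-integrable (D : set B) (EFin \o (fun x : B => csq (u x))).
Proof.
move=> Lu; have mu_ := inL2_mfn Lu.
apply/integrableP; split; first by apply/measurable_EFinP; exact: mfn_csq.
under eq_integral do rewrite /= ger0_norm ?csq_ge0//.
by move: Lu; rewrite /inL2 sqL2E.
Qed.

Lemma L2_domination u (h : E -> R) : mfn D u ->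
  mu.-integrable (D : set B) (EFin \o (h : B -> R)) ->
  (forall x, D x -> csq (u x) <= h x) -> L2 u.
Proof.
move=> mu_ ih le; rewrite /inL2 sqL2E//.
apply: (@le_lt_trans _ _ (\int[mu]_(x in (D : set B)) (h x)%:E)%E).
  apply: ge0_le_integral => //.
  - by move=> x _; rewrite lee_fin csq_ge0.
  - by apply/measurable_EFinP; exact: mfn_csq.
  - by case/integrableP: ih.
by apply: integrable_lty ih.
Qed.

Lemma L2_mul_integrable u v : L2 u -> L2 v -> cintegrable (fun x => u x * v x).
Proof.
move=> Lu Lv; have [m1 m2] := mfnM (inL2_mfn Lu) (inL2_mfn Lv).
have ih : mu.-integrable (D : set B)
    ((EFin \o (fun x : B => csq (u x))) \+ (EFin \o (fun x : B => csq (v x))))%E.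
  by apply: integrableD => //; exact: L2_csq_integrable.
(* For x and y the two components of a product, x^2 <= csq a * csq b <= (csq a + csq b)^2. The
   imaginary part reuses the claim with x and y exchanged. *)
have le (x y : R) (a b : R[i]) : x ^+ 2 + y ^+ 2 = csq a * csq b ->
    `|x| <= csq a + csq b.
  move=> e; have e2 : x ^+ 2 <= csq a * csq b by rewrite -e lerDl sqr_ge0.
  have a0 := csq_ge0 a; have b0 := csq_ge0 b.
  have s0 : 0 <= csq a + csq b by rewrite addr_ge0.
  rewrite -(ger0_norm s0) -ler_sqr ?nnegrE// !real_normK ?num_real//.
  apply: le_trans e2 _; nra.
split.
  apply: le_integrable (ih) => //; first exact/measurable_EFinP.
  move=> x Dx /=; rewrite lee_fin (ger0_norm (addr_ge0 (csq_ge0 _) (csq_ge0 _))).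
  by apply: le; exact: csqM.
apply: le_integrable (ih) => //; first exact/measurable_EFinP.
move=> x Dx /=; rewrite lee_fin (ger0_norm (addr_ge0 (csq_ge0 _) (csq_ge0 _))).
by apply: le; rewrite -csqM /csq addrC.
Qed.

Lemma L2_0 : L2 (fun=> 0).
Proof.
rewrite /inL2 sqL2E; last exact: mfn_cst.
by under eq_integral do rewrite csq0; rewrite integral0.
Qed.
Lemma sqL2_0 : sqL2 mu D (fun=> 0) = 0%E.
Proof.
rewrite sqL2E; last exact: mfn_cst.
by under eq_integral do rewrite csq0; rewrite integral0.
Qed.

Lemma sqL2_comb u v c : L2 u -> L2 v ->
  (sqL2 mu D (fun x => u x + c * v x)%R <=
   2%:E * sqL2 mu D u + (2 * csq c)%:E * sqL2 mu D v)%E.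
Proof.
move=> Lu Lv; have mu_ := inL2_mfn Lu; have mv := inL2_mfn Lv.
rewrite !sqL2E//; last by apply: mfnD => //; apply: mfnM => //; exact: mfn_cst.
have i0 (w : F) : mfn D w -> forall k, 0 <= k ->
   (k%:E * (\int[mu]_(x in (D : set B)) (csq (w x))%:E) =
    \int[mu]_(x in (D : set B)) (k * csq (w x))%:E)%E.
  move=> mw k k0; rewrite -ge0_integralZl//.
  - by apply/measurable_EFinP; exact: mfn_csq.
  - by move=> x _; rewrite lee_fin csq_ge0.
rewrite !i0//; last by rewrite mulr_ge0// csq_ge0.
rewrite -ge0_integralD//=; first last.
- by apply/measurable_EFinP; apply: measurable_funM; [exact: measurable_cst|exact: mfn_csq].
- by move=> x _; rewrite lee_fin !mulr_ge0// csq_ge0.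
- by apply/measurable_EFinP; apply: measurable_funM; [exact: measurable_cst|exact: mfn_csq].
- by move=> x _; rewrite lee_fin !mulr_ge0// csq_ge0.
apply: ge0_le_integral => //.
- by move=> x _; rewrite lee_fin csq_ge0.
- apply/measurable_EFinP; apply: mfn_csq.
  by apply: mfnD => //; apply: mfnM => //; exact: mfn_cst.
- apply/measurable_EFinP; apply: measurable_funD; apply: measurable_funM;
  by [exact: measurable_cst|exact: mfn_csq].
- move=> x _; rewrite lee_fin; apply: le_trans (csqD_le _ _) _.
  by rewrite csqM mulrA.
Qed.

Lemma L2_comb u v c : L2 u -> L2 v -> L2 (fun x => u x + c * v x).
Proof.
move=> Lu Lv; apply: le_lt_trans (sqL2_comb c Lu Lv) _.
by rewrite lte_add_pinfty// lte_mul_pinfty// lee_fin mulr_ge0// csq_ge0.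
Qed.
Lemma L2D u v : L2 u -> L2 v -> L2 (fun x => u x + v x).
Proof. by move=> Lu Lv; under eq_fun do rewrite -[X in _ + X]mul1r; exact: L2_comb. Qed.
Lemma L2Z c u : L2 u -> L2 (fun x => c * u x).
Proof.
move=> Lu; rewrite (_ : (fun _ => _) = (fun x => 0 + c * u x)).
  by apply: L2_comb => //; exact: L2_0.
by apply/funext => x; rewrite add0r.
Qed.
Lemma L2N u : L2 u -> L2 (fun x => - u x).
Proof. by move=> Lu; under eq_fun do rewrite -mulN1r; exact: L2Z. Qed.
Lemma L2B u v : L2 u -> L2 v -> L2 (fun x => u x - v x).
Proof. by move=> Lu Lv; apply: L2D => //; exact: L2N. Qed.
Lemma sqL2J u : sqL2 mu D (fun x => (u x)^*)%C = sqL2 mu D u.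
Proof.
rewrite /sqL2; case: asboolP => [m|m]; case: asboolP => [m'|m'] //.
- by under eq_integral do rewrite csqJ.
- case: m'; have := mfnJ m; rewrite (_ : (fun x => ((u x)^*)^*)%C = u)//.
  by apply/funext => x; rewrite conjcK.
- by case: m; apply: mfnJ.
Qed.
Lemma L2J u : L2 u -> L2 (fun x => (u x)^*)%C.
Proof. by rewrite /inL2 sqL2J. Qed.

Lemma Re_cint u : complex.Re (cintegral mu D u) =
  Rintegral mu (D : set B) (fun x : B => complex.Re (u x)).
Proof. by []. Qed.
Lemma Im_cint u : complex.Im (cintegral mu D u) =
  Rintegral mu (D : set B) (fun x : B => complex.Im (u x)).
Proof. by []. Qed.

Lemma cintegralD u v : cintegrable u -> cintegrable v ->
  cintegral mu D (fun x => u x + v x) = cintegral mu D u + cintegral mu D v.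
Proof.
move=> [u1 u2] [v1 v2]; apply: eq_CReIm; [rewrite CReD !Re_cint|rewrite CImD !Im_cint].
  under eq_Rintegral do rewrite CReD.
  exact: RintegralD.
under eq_Rintegral do rewrite CImD.
exact: RintegralD.
Qed.

Lemma integrable_scale k (f : B -> R) : mu.-integrable (D : set B) (EFin \o f) ->
  mu.-integrable (D : set B) (EFin \o (fun x => k * f x)).
Proof. by move=> /(integrableZl mD k). Qed.

Lemma cintegralZ c u : cintegrable u ->
  cintegral mu D (fun x => c * u x) = c * cintegral mu D u.
Proof.
move=> [u1 u2]; apply: eq_CReIm; [rewrite CReM !Re_cint Im_cint|rewrite CImM !Im_cint Re_cint].
  under eq_Rintegral do rewrite CReM.
  rewrite RintegralB ?RintegralZl//; exact: integrable_scale.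
under eq_Rintegral do rewrite CImM.
rewrite RintegralD ?RintegralZl//; exact: integrable_scale.
Qed.

Lemma cintegrableZ c u : cintegrable u -> cintegrable (fun x => c * u x).
Proof.
move=> [u1 u2]; split.
  rewrite (_ : _ \o _ = (fun x => (complex.Re c)%:E * (complex.Re (u x))%:E) \-
    (fun x => (complex.Im c)%:E * (complex.Im (u x))%:E))%E; last first.
    by apply/funext => x /=; rewrite CReM EFinB !EFinM.
  by apply: integrableB => //; exact: integrableZl.
rewrite (_ : _ \o _ = (fun x => (complex.Re c)%:E * (complex.Im (u x))%:E) \+
    (fun x => (complex.Im c)%:E * (complex.Re (u x))%:E))%E; last first.
  by apply/funext => x /=; rewrite CImM EFinD !EFinM.
by apply: integrableD => //; exact: integrableZl.
Qed.

Lemma cintegralJ u : cintegrable u ->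
  cintegral mu D (fun x => (u x)^*)%C = (cintegral mu D u)^*%C.
Proof.
move=> [u1 u2]; apply: eq_CReIm; [rewrite CReJ !Re_cint|rewrite CImJ !Im_cint].
  by under eq_Rintegral do rewrite CReJ.
under eq_Rintegral do rewrite CImJ -mulN1r.
by rewrite RintegralZl// mulN1r.
Qed.

(** The bilinear pairing is the basic object because weak derivatives and [surf_pair] are bilinear;
    [innerL2] comes back by conjugating the second argument. *)
Definition bil (u v : F) : R[i] := cintegral mu D (fun x => u x * v x).

Lemma innerE u v : innerL2 mu D u v = bil u (fun x => (v x)^*)%C.
Proof. by []. Qed.

Lemma bilC u v : bil u v = bil v u.
Proof. by rewrite /bil; congr cintegral; apply/funext => x; rewrite mulrC. Qed.

Lemma bil_combl u v w c : L2 u -> L2 v -> L2 w ->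
  bil (fun x => u x + c * v x) w = bil u w + c * bil v w.
Proof.
move=> Lu Lv Lw; rewrite /bil.
rewrite (_ : (fun x => _) = (fun x => (u x * w x) + c * (v x * w x))).
  rewrite cintegralD ?cintegralZ//; try exact: L2_mul_integrable.
  by apply: cintegrableZ; exact: L2_mul_integrable.
by apply/funext => x; rewrite mulrDl mulrA.
Qed.
Lemma bil_combr u v w c : L2 u -> L2 v -> L2 w ->
  bil u (fun x => v x + c * w x) = bil u v + c * bil u w.
Proof. by move=> *; rewrite bilC bil_combl// bilC [bil w u]bilC. Qed.
Lemma bilZl c u w : L2 u -> L2 w -> bil (fun x => c * u x) w = c * bil u w.
Proof.
move=> Lu Lw; rewrite /bil -cintegralZ; last exact: L2_mul_integrable.
by congr cintegral; apply/funext => x; rewrite mulrA.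
Qed.
Lemma bilZr c u w : L2 u -> L2 w -> bil u (fun x => c * w x) = c * bil u w.
Proof. by move=> *; rewrite bilC bilZl// bilC. Qed.
Lemma bilBl u v w : L2 u -> L2 v -> L2 w ->
  bil (fun x => u x - v x) w = bil u w - bil v w.
Proof.
move=> *; rewrite -[- bil v w]mulN1r -bil_combl//; congr bil.
by apply/funext => x; rewrite mulN1r.
Qed.
Lemma bilBr u v w : L2 u -> L2 v -> L2 w ->
  bil w (fun x => u x - v x) = bil w u - bil w v.
Proof. by move=> *; rewrite bilC bilBl// bilC [bil v w]bilC. Qed.
Lemma bilNl u w : L2 u -> L2 w -> bil (fun x => - u x) w = - bil u w.
Proof.
move=> *; rewrite -mulN1r -bilZl//; congr bil.
by apply/funext => x; rewrite mulN1r.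
Qed.
Lemma bilJ u v : L2 u -> L2 v ->
  bil (fun x => (u x)^*)%C (fun x => (v x)^*)%C = (bil u v)^*%C.
Proof.
move=> Lu Lv; rewrite /bil -cintegralJ; last exact: L2_mul_integrable.
by congr cintegral; apply/funext => x; rewrite -rmorphM.
Qed.
Lemma bil0l w : bil (fun=> 0) w = 0.
Proof.
rewrite /bil (_ : (fun x => _) = (fun=> 0)).
  by apply: eq_CReIm; rewrite /= Rintegral_cst// mul0r.
by apply/funext => x; rewrite mul0r.
Qed.

(** Since [fine] sends +oo to 0, this measures u only once u is known to lie in L^2. *)
Definition N2 (u : F) : R := fine (sqL2 mu D u).

Lemma N2_def u : N2 u = fine (sqL2 mu D u).
Proof. by []. Qed.

Lemma N2_ge0 u : 0 <= N2 u.
Proof. by rewrite fine_ge0// sqL2_ge0. Qed.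
Lemma N2E u : L2 u -> sqL2 mu D u = (N2 u)%:E.
Proof. by move=> Lu; rewrite fineK// ge0_fin_numE ?sqL2_ge0. Qed.
Lemma bil_self u : L2 u -> bil u (fun x => (u x)^*)%C = ((N2 u)%:C)%C.
Proof.
move=> Lu; have m := inL2_mfn Lu.
rewrite /bil /N2 sqL2E//; apply: eq_CReIm => /=.
  by rewrite /Rintegral; congr fine; apply: eq_integral => x _; rewrite mulJ_csq.
under eq_Rintegral do rewrite mulJ_csq/=.
by rewrite Rintegral_cst// mul0r.
Qed.
Lemma N2J u : N2 (fun x => (u x)^*)%C = N2 u.
Proof. by rewrite /N2 sqL2J. Qed.

Lemma N2_comb_expand u v c : L2 u -> L2 v ->
  N2 (fun x => u x + c * v x) =
  N2 u + csq c * N2 v + 2 * complex.Re ((c^*)%C * bil u (fun x => (v x)^*)%C).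
Proof.
move=> Lu Lv; have Luv := L2_comb c Lu Lv.
have Ju := L2J Lu; have Jv := L2J Lv.
apply: complexI; rewrite -bil_self//.
have -> : (fun x => ((u x + c * v x)^*)%C) = (fun x => ((u x)^* + c^* * (v x)^*)%C).
  by apply/funext => x; rewrite rmorphD rmorphM.
rewrite bil_combl//; last exact: L2_comb.
rewrite !bil_combr// !bil_self//.
have -> : bil v (fun x => (u x)^*)%C = ((bil u (fun x => (v x)^*)%C)^*)%C.
  rewrite -bilJ// bilC; congr bil; apply/funext => x; by rewrite conjcK.
by apply: eq_CReIm; rewrite !CE /csq; ring.
Qed.

Lemma N2_comb_le u v c : L2 u -> L2 v ->
  N2 (fun x => u x + c * v x) <= 2 * N2 u + 2 * csq c * N2 v.
Proof.
move=> Lu Lv; have := sqL2_comb c Lu Lv.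
by rewrite N2E ?(N2E Lu) ?(N2E Lv) -?EFinM -?EFinD ?lee_fin//; exact: L2_comb.
Qed.

Lemma cauchy_schwarz u v : L2 u -> L2 v -> csq (bil u v) <= N2 u * N2 v.
Proof.
move=> Lu Lv; set I := bil u v.
(* Non-negativity of the squared norm of u - t I conj v, for every real t, with I the pairing of u
   and v. *)
have H t : 0 <= N2 u + t ^+ 2 * csq I * N2 v - 2 * t * csq I.
  have := N2_ge0 (fun x => u x + (- (t%:C)%C * I) * (v x)^*%C).
  rewrite N2_comb_expand//; last exact: L2J.
  rewrite N2J (_ : (fun x => ((v x)^*)^*%C)%C = v); last by apply/funext => x; rewrite conjcK.
  rewrite -/I csqM csqN csqC => h; apply: le_trans h _.
  by rewrite le_eqVlt; apply/orP; left; apply/eqP; rewrite /csq !CE; ring.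
have [I0|I0] := eqVneq (csq I) 0; first by rewrite I0 mulr_ge0 ?N2_ge0.
have Ip : 0 < csq I by rewrite lt0r I0 csq_ge0.
have [v0|v0] := eqVneq (N2 v) 0.
  (* If v has norm 0 the inequality is affine in t, and this t would make its right side equal to -
     N2 u - 2. *)
  have := H ((N2 u + 1) / csq I); rewrite v0 mulr0 addr0.
  rewrite -mulrA divfK//; have := N2_ge0 u; lra.
have vp : 0 < N2 v by rewrite lt0r v0 N2_ge0.
have := H (N2 v)^-1; rewrite (_ : _ - _ = N2 u - csq I / N2 v); last by field.
by rewrite subr_ge0 ler_pdivrMr.
Qed.

Lemma sqL2_ae u v : mfn D u -> mfn D v -> ae_eq_on mu D u v ->
  sqL2 mu D u = sqL2 mu D v.
Proof.
move=> mu_ mv uv; rewrite !sqL2E//; apply: ae_eq_integral => //.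
- by apply/measurable_EFinP; exact: mfn_csq.
- by apply/measurable_EFinP; exact: mfn_csq.
- by apply: aeS uv => x + Dx => ->.
Qed.
Lemma sqL2_eq0_ae u : sqL2 mu D u = 0%E -> ae_eq_on mu D u (fun=> 0).
Proof.
move=> u0; have m : mfn D u by apply: (@inL2_mfn mu); rewrite /inL2 u0.
move: u0; rewrite sqL2E// => u0.
have : (\int[mu]_(x in (D : set B)) `|(csq (u x))%:E| = 0)%E.
  by rewrite -u0; apply: eq_integral => x _; rewrite /= ger0_norm ?csq_ge0.
move/ae_eq_integral_abs => /(_ mD) h.
apply: aeS (h _); last by apply/measurable_EFinP; exact: mfn_csq.
by move=> x + Dx => /(_ Dx) [] /csq_eq0.
Qed.
Lemma ae_sqL2_eq0 u : mfn D u -> ae_eq_on mu D u (fun=> 0) -> sqL2 mu D u = 0%E.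
Proof. by move=> m /(sqL2_ae m) ->; [exact: sqL2_0|exact: mfn_cst]. Qed.

End Fixed.
End L2.

(** * Comparison of integrals of possibly non-measurable functions *)

Section NonMeasurable.
Context d (T : measurableType d) (R : realType).
Variable mu : {measure set T -> \bar R}.
Import HBNNSimple.

(* The integral is a supremum over simple functions, which may be cut off on a
   null set; hence no measurability is needed. *)
Lemma ge0_ae_le_integral (f g : T -> \bar R) :
  (forall x, 0 <= f x)%E -> (forall x, 0 <= g x)%E ->
  {ae mu, forall x, (f x <= g x)%E} ->
  (\int[mu]_x f x <= \int[mu]_x g x)%E.
Proof.
move=> f0 g0 [N [mN N0 fgN]]; rewrite ge0_integralTE// ge0_integralTE//.
apply/ge_ereal_sup => /= _ [h hf <-].
have mNC := measurableC mN.
apply: (@le_trans _ _ (sintegral mu (proj_nnsfun h mNC))).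
  rewrite -!integralT_nnsfun le_eqVlt; apply/orP; left; apply/eqP.
  apply: ae_eq_integral => //.
  - by apply/measurable_EFinP.
  - by apply/measurable_EFinP.
  exists N; split => // x; apply: contra_notP => Nx _ /=.
  by rewrite /mindic/= indicE mem_set// mulr1.
apply: ereal_sup_ubound; exists (proj_nnsfun h mNC) => // x /=.
rewrite /mindic/= indicE; case: (boolP (x \in ~` N)) => [|_].
  rewrite inE/= => Nx; rewrite mulr1; apply: le_trans (hf x) _.
  by apply: contrapT => H; apply: Nx; apply: fgN.
by rewrite mulr0 g0.
Qed.

(** Positive and negative parts are compared in both directions. Pairings can then be changed on
    null sets even where the representatives are not measurable. *)
Lemma integral_ae D (f g : T -> \bar R) :
  {ae mu, forall x, D x -> f x = g x} ->
  (\int[mu]_(x in D) f x = \int[mu]_(x in D) g x)%E.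
Proof.
move=> fg; rewrite [LHS]integral_mkcond [RHS]integral_mkcond.
rewrite [LHS]integralE [RHS]integralE.
have H : {ae mu, forall x, (f \_ D) x = (g \_ D) x}.
  apply: filterS fg => x; rewrite /patch; case: ifPn => //.
  by rewrite inE => Dx /(_ Dx).
congr (_ - _)%E; apply/eqP; rewrite eq_le; apply/andP; split;
  apply: ge0_ae_le_integral => //;
  by apply: filterS H => x e; rewrite ?funeposE ?funenegE e.
Qed.

Lemma ge0_le_integral_nm D (f g : T -> \bar R) :
  (forall x, D x -> 0 <= f x)%E -> (forall x, D x -> f x <= g x)%E ->
  (\int[mu]_(x in D) f x <= \int[mu]_(x in D) g x)%E.
Proof.
move=> f0 fg; rewrite [leLHS]integral_mkcond [leRHS]integral_mkcond.
apply: ge0_ae_le_integral.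
- by move=> x; apply: erestrict_ge0.
- by move=> x; apply: erestrict_ge0 => y Dy; apply: le_trans (fg _ Dy); exact: f0.
- apply: aeW => x; rewrite /patch; case: ifPn => //.
  by rewrite inE => /fg.
Qed.
End NonMeasurable.

Section GeometricCauchy.
Variable R : realType.

(** Nested intervals: the tail of the geometric series from k on is 2 s / 2^k, so the upper ends b
    decrease, the lower ends c increase, and the limit is the supremum of the latter. *)
Lemma geometric_cvg (a : nat -> R) s : 0 <= s ->
  (forall k, `|a k.+1 - a k| <= s / 2 ^+ k) ->
  exists2 l, a k @[k --> \oo] --> l & forall k, `|a k - l| <= 2 * s / 2 ^+ k.
Proof.
move=> s0 H.
pose b k := a k + 2 * s / 2 ^+ k; pose c k := a k - 2 * s / 2 ^+ k.
have half k : 2 * s / 2 ^+ k.+1 = s / 2 ^+ k.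
  by rewrite exprS -mulf_div divff ?mul1r// pnatr_eq0.
have two k : 2 * s / 2 ^+ k = s / 2 ^+ k + s / 2 ^+ k.
  by rewrite -mulrA mulrDl !mul1r.
have bS k : b k.+1 <= b k.
  rewrite /b half two; have := H k; rewrite ler_norml => /andP[_].
  lra.
have cS k : c k <= c k.+1.
  rewrite /c half two; have := H k; rewrite ler_norml => /andP[+ _].
  lra.
have bd k m : (k <= m)%N -> b m <= b k.
  elim: m => [|m IH]; first by rewrite leqn0 => /eqP ->.
  rewrite leq_eqVlt => /orP[/eqP ->//|]; rewrite ltnS => /IH; exact: le_trans.
have cd k m : (k <= m)%N -> c k <= c m.
  elim: m => [|m IH]; first by rewrite leqn0 => /eqP ->.
  rewrite leq_eqVlt => /orP[/eqP ->//|]; rewrite ltnS => /IH h; exact: le_trans h _.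
have cb j k : c j <= b k.
  apply: (@le_trans _ _ (c (maxn j k))); first by apply: cd; exact: leq_maxl.
  apply: (@le_trans _ _ (b (maxn j k))); last by apply: bd; exact: leq_maxr.
  rewrite /b /c; set t := _ / _; have : 0 <= t by rewrite divr_ge0// ?mulr_ge0// exprn_ge0.
  lra.
pose l := sup (range c).
have cl k : c k <= l.
  by apply: ub_le_sup; [exists (b 0%N) => _ [j _ <-]; exact: cb|exists k].
have lb k : l <= b k.
  by apply: ge_sup; [exists (c 0%N); exists 0%N|move=> _ [j _ <-]; exact: cb].
have al k : `|a k - l| <= 2 * s / 2 ^+ k.
  rewrite ler_norml; have := cl k; have := lb k; rewrite /b /c.
  set t := _ / _; move=> h1 h2; apply/andP; split; lra.
exists l => //.
apply/cvgrPdist_lt => e e0.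
have p : 0 < e / (2 * s + 1) by rewrite divr_gt0//; lra.
near=> k; rewrite distrC; apply: le_lt_trans (al k) _.
have : 1 / 2 ^+ k < e / (2 * s + 1).
  by near: k; exact: (near_infty_natSinv_expn_lt (PosNum p)).
rewrite ltr_pdivlMr; last by lra.
move=> h; apply: le_lt_trans h.
rewrite div1r mulrC ler_wpM2l ?invr_ge0 ?exprn_ge0//; lra.
Unshelve. all: by end_near. Qed.

Lemma le0_of_geometric (a K : R) : (forall k, a <= K / 4 ^+ k) -> a <= 0.
Proof.
move=> H; rewrite leNgt; apply/negP => a0.
have K0 : 0 < K by have := H 0%N; rewrite expr0 divr1; exact: lt_le_trans.
have p : 0 < a / K by rewrite divr_gt0.
have [k _ /(_ k (leqnn k)) /=] := near_infty_natSinv_expn_lt (PosNum p).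
rewrite ltr_pdivlMr// => h.
have : a < a; last by rewrite ltxx.
apply: le_lt_trans (H k) _; apply: le_lt_trans h.
rewrite mulrC; apply: ler_wpM2r; first exact: ltW.
rewrite div1r lef_pV2 ?posrE ?exprn_gt0//.
by apply: lerXn2r; rewrite ?nnegrE; lra.
Qed.
End GeometricCauchy.

(** * Completeness of L^2, with a rate *)

Section Completeness.
Variables (R : realType) (n : nat).
Notation E := 'rV[R]_n.
Notation B := (borelT R n).
Notation F := (fn R n).
Notation meas := {measure set (borelT R n) -> \bar R}.
Variables (mu : meas) (D : set E).
Hypothesis mD : measurable (D : set B).
Local Notation L2 := (inL2 mu D).
Local Notation N2 := (N2 mu D).

Lemma bil_ae u v w w' : ae_eq_on mu D u v -> ae_eq_on mu D w w' ->
  bil mu D u w = bil mu D v w'.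
Proof.
move=> uv ww; have H : {ae mu, forall x : B, D x -> u x * w x = v x * w' x}.
  by apply: aeS2 uv ww => x h1 h2 Dx; rewrite h1// h2.
by rewrite /bil; apply: eq_CReIm; rewrite /= /Rintegral; congr fine;
  apply: integral_ae; apply: aeS H => x h Dx; rewrite h.
Qed.

Lemma real_norm_csq (t : R) (a : R[i]) s : 0 <= s -> csq a <= s ^+ 2 ->
  t = complex.Re a \/ t = complex.Im a -> `|t| <= s.
Proof.
move=> s0 h te; rewrite -(ger0_norm s0) -ler_sqr ?nnegrE// !real_normK ?num_real//.
apply: le_trans h; rewrite /csq; case: te => ->; by rewrite (lerDl,lerDr) sqr_ge0.
Qed.

(** Riesz-Fischer argument. The increments decay like 8^-k, so weighting them by 4^k leaves
    integrals of size C / 2^k and an integrable sum H; where H is finite, consecutive terms differ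
    by at most sqrt H / 2^k, which gives pointwise limits together with the rate 4^-k. *)
Lemma L2_complete (u : nat -> F) C : (forall k, L2 (u k)) ->
  (forall k, N2 (fun x => u k.+1 x - u k x) <= C / 8 ^+ k) ->
  exists2 v, L2 v & exists K, forall k, N2 (fun x => u k x - v x) <= K / 4 ^+ k.
Proof.
move=> Lu HC.
pose h k x : \bar R := (4 ^+ k * csq (u k.+1 x - u k x))%:E.
have h0 k x : (0 <= h k x)%E by rewrite lee_fin mulr_ge0// ?exprn_ge0// csq_ge0.
have mh k : measurable_fun (D : set B) (h k : B -> \bar R).
  apply/measurable_EFinP; apply: measurable_funM; first exact: measurable_cst.
  by apply: mfn_csq; apply: (@inL2_mfn _ _ mu); exact: L2B.
pose H x : \bar R := (\sum_(k <oo) h k x)%E.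
have mH : measurable_fun (D : set B) (H : B -> \bar R).
  by apply: ge0_emeasurable_sum => //.
have H0 x : (0 <= H x)%E by apply: nneseries_ge0.
have C0 : 0 <= C.
  by have := HC 0%N; rewrite expr0 divr1; apply: le_trans; exact: N2_ge0.
have ih k : (\int[mu]_(x in (D : set B)) h k x <= (C / 2 ^+ k)%:E)%E.
  have Lk := L2B mD (Lu k.+1) (Lu k).
  rewrite (_ : (\int[mu]_(x in _) _)%E = ((4 ^+ k)%:E * sqL2 mu D (fun x => u k.+1 x - u k x)%R)%E).
    rewrite N2E// -EFinM lee_fin.
    apply: (@le_trans _ _ (4 ^+ k * (C / 8 ^+ k))).
      by rewrite ler_wpM2l// exprn_ge0.
    rewrite (_ : 8 = 4 * 2 :> R); last by rewrite -natrM.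
    rewrite exprMn invfM le_eqVlt; apply/orP; left; apply/eqP.
    have p4 : 4 ^+ k != 0 :> R by rewrite expf_neq0.
    have p2 : 2 ^+ k != 0 :> R by rewrite expf_neq0.
    by field; apply/andP.
  rewrite sqL2E; last exact: inL2_mfn Lk.
  rewrite -ge0_integralZl//; try by rewrite lee_fin exprn_ge0.
  - by apply/measurable_EFinP; apply: mfn_csq; exact: inL2_mfn Lk.
  - by move=> x _; rewrite lee_fin csq_ge0.
have iH : (\int[mu]_(x in (D : set B)) H x < +oo)%E.
  rewrite integral_nneseries//.
  apply: (@le_lt_trans _ _ (\sum_(k <oo) (C / 2 ^+ k)%:E)%E).
    by apply: lee_nneseries => k _; [move=> _; exact: integral_ge0|exact: ih].
  have hs : (series (fun k => C / 2 ^+ k) : nat -> R) @ \oo --> C / (1 - 2^-1).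
    have := @cvg_geometric_series R C (2^-1) _.
    rewrite /geometric/= (_ : (fun k => C * 2^-1 ^+ k) = (fun k => C / 2 ^+ k)).
      by apply; rewrite ger0_norm ?invr_ge0// invf_lt1//; lra.
    by apply/funext => k; rewrite exprVn.
  rewrite (_ : (\sum_(k <oo) _)%E = (C / (1 - 2^-1))%:E) ?ltry//.
  apply/cvg_lim => //; apply: cvg_EFin.
    by near=> k; rewrite sumEFin.
  rewrite (_ : _ \o _ = series (fun k => C / 2 ^+ k))//.
  by apply/funext => k /=; rewrite sumEFin.
have intH : mu.-integrable (D : set B) (H : B -> \bar R).
  apply/integrableP; split => //.
  by under eq_integral do rewrite gee0_abs//.
pose G x := D x /\ (H x < +oo)%E.
have mG : measurable (G : set B).
  rewrite (_ : G = D `&` [set x : B | (H x < +oo)%E]); last by [].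
  exact: emeasurable_fun_infty_o.
(* Cutting off outside the set where H is finite changes [u k] on a null set only and makes the
   pointwise estimates hold everywhere. *)
pose w k x := if `[< G x >] then u k x else 0.
have wD k x : G x -> (H x = (fine (H x))%:E) /\ csq (w k.+1 x - w k x) <= fine (H x) / 4 ^+ k.
  move=> Gx; have e : H x = (fine (H x))%:E.
    by rewrite fineK// ge0_fin_numE//; case: Gx.
  split => //; rewrite /w asboolT//.
  rewrite ler_pdivlMr ?exprn_gt0// mulrC -lee_fin -e.
  have := @nneseries_lim_ge _ (h ^~ x) xpredT 0 k.+1.
  rewrite -/(H x) big_mkord big_ord_recr/= => /(_ (fun i _ _ => h0 i x)).
  apply: le_trans; rewrite /h leeDr//.
  by elim/big_ind : _ => // [a b|i _]; [exact: adde_ge0|exact: h0].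
have mw k : mfn D (w k).
  have [m1 m2] := inL2_mfn (Lu k).
  have mi : measurable_fun (D : set B) (\1_G : B -> R) by exact: measurable_indic.
  split.
    rewrite (_ : (fun x => _) = (fun x => complex.Re (u k x)) \* (\1_G : B -> R)).
      exact: measurable_funM.
    apply/funext => x; rewrite /w /= indicE; case: asboolP => Gx.
      by rewrite mem_set// mulr1.
    by rewrite memNset// mulr0.
  rewrite (_ : (fun x => _) = (fun x => complex.Im (u k x)) \* (\1_G : B -> R)).
    exact: measurable_funM.
  apply/funext => x; rewrite /w /= indicE; case: asboolP => Gx.
    by rewrite mem_set// mulr1.
  by rewrite memNset// mulr0.
pose s x := Num.sqrt (fine (H x)).
have s0 x : 0 <= s x by rewrite sqrtr_ge0.
have fH x : 0 <= fine (H x) by rewrite fine_ge0.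
have sk x k : (s x / 2 ^+ k) ^+ 2 = fine (H x) / 4 ^+ k.
  rewrite expr_div_n sqr_sqrtr// -exprM mulnC exprM; congr (_ / _ ^+ _).
  by rewrite -natrX.
have ab x k : `|complex.Re (w k.+1 x) - complex.Re (w k x)| <= s x / 2 ^+ k /\
              `|complex.Im (w k.+1 x) - complex.Im (w k x)| <= s x / 2 ^+ k.
  have p : 0 <= s x / 2 ^+ k by rewrite divr_ge0// exprn_ge0.
  have [Gx|nG] := pselect (G x); last first.
    by rewrite /w asboolF// subrr normr0.
  have [_ le] := wD k x Gx.
  split; apply: (@real_norm_csq _ (w k.+1 x - w k x)) => //; rewrite ?sk//.
    by left; rewrite CReD CReN.
  by right; rewrite CImD CImN.
have /choice[v1 Hv1] : forall x, exists l : R, complex.Re (w k x) @[k --> \oo] --> l /\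
    forall k, `|complex.Re (w k x) - l| <= 2 * s x / 2 ^+ k.
  move=> x; have [l ? ?] := geometric_cvg (s0 x) (fun k => (ab x k).1).
  by exists l.
have /choice[v2 Hv2] : forall x, exists l : R, complex.Im (w k x) @[k --> \oo] --> l /\
    forall k, `|complex.Im (w k x) - l| <= 2 * s x / 2 ^+ k.
  move=> x; have [l ? ?] := geometric_cvg (s0 x) (fun k => (ab x k).2).
  by exists l.
pose v x : R[i] := Complex (v1 x) (v2 x).
have mv : mfn D v.
  split => /=.
    apply: (@measurable_fun_cvg _ B R (D : set B) (fun k (x : B) => complex.Re (w k x)) v1).
      by move=> k; case: (mw k).
    by move=> x _; case: (Hv1 x).
  apply: (@measurable_fun_cvg _ B R (D : set B) (fun k (x : B) => complex.Im (w k x)) v2).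
    by move=> k; case: (mw k).
  by move=> x _; case: (Hv2 x).
(* Each of the two components is off by at most 2 sqrt H / 2^k, and 8 = 2 * 2^2. *)
have wv k x : csq (w k x - v x) <= (8 / 4 ^+ k) * fine (H x).
  have [_ /(_ k) h1] := Hv1 x; have [_ /(_ k) h2] := Hv2 x.
  have e : (2 * s x / 2 ^+ k) ^+ 2 = 4 * (fine (H x) / 4 ^+ k).
    by rewrite -mulrA exprMn sk; congr (_ * _); rewrite -natrX.
  have sq (a b : R) : `|a| <= b -> a ^+ 2 <= b ^+ 2.
    move=> ab'; rewrite -[a ^+ 2]real_normK ?num_real//.
    by apply: lerXn2r; rewrite ?nnegrE// (le_trans _ ab').
  rewrite /csq CReD CImD CReN CImN /=.
  have := sq _ _ h1; have := sq _ _ h2; rewrite !e.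
  move: (fine (H x)) ((4 ^+ k)^-1) ((complex.Re _ - _) ^+ 2) ((complex.Im _ - _) ^+ 2).
  move=> a q b c; lra.
have uw k : ae_eq_on mu D (u k) (w k).
  have := integrable_ae mD intH; apply: aeS => x Hx Dx.
  rewrite /w asboolT//; split=> //; have := Hx Dx.
  by rewrite ge0_fin_numE.
have intfH : mu.-integrable (D : set B) (EFin \o (fun x : B => fine (H x))).
  apply: (le_integrable mD _ _ intH).
    apply/measurable_EFinP; exact: measurableT_comp.
  move=> x _; rewrite /= gee0_abs//; have := H0 x; case: (H x) => [r| |]//=.
    by rewrite lee_fin => r0; rewrite lee_fin ger0_norm.
  by move=> _; exact: leey.
have Lwv k : L2 (fun x => w k x - v x).
  apply: (@L2_domination _ _ _ _ mD _ (fun x => (8 / 4 ^+ k) * fine (H x))).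
  - by apply: mfnD => //; exact: mfnN.
  - exact: integrable_scale.
  - by move=> x _; exact: wv.
have Lw k : L2 (w k).
  rewrite /inL2 -(sqL2_ae mD _ _ (uw k))//; first exact: Lu.
  exact: inL2_mfn (Lu k).
have Lv : L2 v.
  rewrite (_ : v = (fun x => w 0%N x - (w 0%N x - v x))); last first.
    by apply/funext => x; rewrite opprB addrC subrK.
  exact: L2B.
exists v => //.
exists (8 * Rintegral mu (D : set B) (fun x : B => fine (H x))) => k.
rewrite !N2_def.
rewrite (@sqL2_ae _ _ _ _ mD _ (fun x => w k x - v x)); first last.
- by apply: aeS (uw k) => x e Dx; rewrite e.
- exact: inL2_mfn (Lwv k).
- by apply: (@inL2_mfn _ _ mu); exact: L2B.
rewrite -lee_fin fineK; last by rewrite ge0_fin_numE ?sqL2_ge0//; exact: Lwv.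
rewrite sqL2E; last exact: inL2_mfn (Lwv k).
rewrite mulrAC.
rewrite -RintegralZl// fineK; last first.
  exact: integrable_fin_num (integrable_scale _ _ _).
apply: ge0_le_integral_nm => x Dx; rewrite lee_fin; [exact: csq_ge0|exact: wv].
Unshelve. all: by end_near. Qed.

End Completeness.

(** * Self-adjoint graphs *)

Section Resolvent.
Variables (R : realType) (n : nat).
Notation E := 'rV[R]_n.
Notation B := (borelT R n).
Notation F := (fn R n).
Notation meas := {measure set (borelT R n) -> \bar R}.
Variables (mu : meas) (D : set E).
Hypothesis mD : measurable (D : set B).
Local Notation L2 := (inL2 mu D).
Local Notation N2 := (N2 mu D).
Local Notation bil := (bil mu D).
Local Notation "u ^~J" := (fun x => (u x)^*%C) (at level 2, format "u ^~J").

Lemma sub_comb (u v : F) : (fun x => u x - v x) = (fun x => u x + (-1) * v x).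
Proof. by apply/funext => x; rewrite mulN1r. Qed.

Lemma conjcM (a b : R[i]) : ((a * b)^*)%C = (a^*)%C * (b^*)%C.
Proof. exact: rmorphM. Qed.
Lemma conjcB (a b : R[i]) : ((a - b)^*)%C = (a^*)%C - (b^*)%C.
Proof. exact: rmorphB. Qed.
Lemma csq1 : csq (1 : R[i]) = 1.
Proof. by rewrite /csq/= expr1n expr0n addr0. Qed.
Lemma N2Z c u : L2 u -> N2 (fun x => c * u x) = csq c * N2 u.
Proof.
move=> Lu; have -> : (fun x => c * u x) = (fun x => 0 + c * u x).
  by apply/funext => x; rewrite add0r.
rewrite N2_comb_expand//; last exact: L2_0.
by rewrite bil0l// mulr0 /= mulr0 addr0 !N2_def sqL2_0//= add0r.
Qed.
Lemma parallelogram u v : L2 u -> L2 v ->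
  N2 (fun x => u x + v x) + N2 (fun x => u x - v x) = 2 * N2 u + 2 * N2 v.
Proof.
move=> Lu Lv; rewrite sub_comb.
have -> : (fun x => u x + v x) = (fun x => u x + 1 * v x).
  by apply/funext => x; rewrite mul1r.
rewrite !N2_comb_expand// csqN csq1 !CReM !CReJ !CImJ CReN CImN /=; ring.
Qed.
Lemma N2_eq0_ae u : L2 u -> N2 u = 0 -> ae_eq_on mu D u (fun=> 0).
Proof. by move=> Lu u0; apply: sqL2_eq0_ae => //; rewrite N2E// u0. Qed.

(** Quantitative orthogonality of an almost minimizer: shifting q by the optimal multiple of p
    lowers its squared norm by [csq (bil q p^~J) / N2 p], and at most e can be gained. *)
Lemma near_projection q p d e : L2 q -> L2 p -> 0 <= e -> N2 q <= d + e ->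
  (forall c, d <= N2 (fun x => q x + c * p x)) ->
  csq (bil q p^~J) <= e * N2 p.
Proof.
move=> Lq Lp e0 qd H; set I := bil q p^~J.
have [p0|p0] := eqVneq (N2 p) 0.
  have := cauchy_schwarz mD Lq (L2J Lp).
  by rewrite N2J p0 !mulr0.
have pp : 0 < N2 p by rewrite lt0r p0 N2_ge0.
have := H (- (((N2 p)^-1)%:C)%C * I); rewrite N2_comb_expand// -/I csqM csqN csqC.
set r := complex.Re _; have -> : r = - (N2 p)^-1 * csq I.
  by rewrite /r /csq !CE; ring.
move=> h; rewrite -ler_pdivrMr//.
have : (N2 p)^-1 ^+ 2 * csq I * N2 p = csq I / N2 p by field.
move: h qd; set t := _ / _; rewrite mulNr [_^-1 * csq I]mulrC -/t => h qd e1.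
rewrite e1 in h; lra.
Qed.

Variable T : operator R n.
Hypothesis T_comb : forall u f v g c, T u f -> T v g ->
  T (fun x => u x + c * v x) (fun x => f x + c * g x).
Hypothesis T_L2 : forall u f, T u f -> L2 u.
(** Graphs are closed under almost-everywhere changes of f, so f itself need not be measurable;
    pairings and limits use the representative [f0]. *)
Hypothesis T_rep : forall u f, T u f ->
  exists f0, [/\ L2 f0, ae_eq_on mu D f f0 & T u f0].

(** Symmetry makes the pairing of T u with u real, so the pairing of (T - z) u with u has imaginary
    part - Im z |u|^2; Cauchy-Schwarz does the rest. *)
Lemma symmetric_im_bound u g z : op_symmetric mu D T -> T u g -> L2 g ->
  complex.Im z ^+ 2 * N2 u <= N2 (fun x => g x - z * u x).
Proof.
move=> sy Tu Lg; have Lu := T_L2 Tu.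
have := sy _ _ _ _ Tu Tu; rewrite !innerE => e.
have Lzu := L2Z mD z Lu.
have e1 : bil (fun x => g x - z * u x) u^~J = bil g u^~J - z * ((N2 u)%:C)%C.
  by rewrite bilBl// ?bilZl// ?bil_self//; exact: L2J.
have e2 : complex.Im (bil g u^~J) = 0.
  have : bil u g^~J = ((bil g u^~J)^*)%C.
    rewrite -bilJ//; last exact: L2J.
    by rewrite bilC; congr (bil _ _); apply/funext => x; rewrite conjcK.
  rewrite -e => /(congr1 (@complex.Im R)); rewrite CImJ; lra.
have h : (complex.Im z * N2 u) ^+ 2 <= N2 (fun x => g x - z * u x) * N2 u.
  apply: le_trans (_ : csq (bil (fun x => g x - z * u x) u^~J) <= _).
    rewrite e1 /csq !CE e2; set a := (X in _ <= X + _).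
    rewrite (_ : (_ - _) ^+ 2 = (complex.Im z * N2 u) ^+ 2); last by ring.
    by rewrite lerDr sqr_ge0.
  rewrite -(N2J mu D u); apply: cauchy_schwarz => //; [exact: L2B|exact: L2J].
have [u0|u0] := eqVneq (N2 u) 0; first by rewrite u0 mulr0 N2_ge0.
have up : 0 < N2 u by rewrite lt0r u0 N2_ge0.
by rewrite -(ler_pM2r up); apply: le_trans h; rewrite exprMn -mulrA -expr2.
Qed.

(* A minimizing sequence for the residual f - (T - z) u converges together with
   its images, by the parallelogram law; the limiting residual is orthogonal to
   the range of T - z, hence an eigenvector of T for z^*. *)
Lemma self_adjoint_surjective z f : self_adjoint mu D T -> complex.Im z != 0 ->
  L2 f -> exists u g, [/\ T u g, L2 g & ae_eq_on mu D f (fun x => g x - z * u x)].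
Proof.
move=> [dn sy sa] z0 Lf.
have [u0 [g0 [Tu0 _]]] := dn _ (L2_0 mu D) 1 ltr01.
have [h0 [Lh0 _ {g0}Tu0]] := T_rep Tu0.
have zz : 0 < complex.Im z ^+ 2 by rewrite lt0r sqrf_eq0 z0 sqr_ge0.
pose res (p : F * F) : F := fun x => f x - (p.2 x - z * p.1 x).
pose S := [set N2 (res p) | p in [set p : F * F | T p.1 p.2 /\ L2 p.2]].
have Lres p : T p.1 p.2 -> L2 p.2 -> L2 (res p).
  by move=> Tp Lp; do ! apply: L2B => //; apply: L2Z => //; exact: T_L2 Tp.
have infS : has_inf S.
  split; first by exists (N2 (res (u0, h0))); exists (u0, h0).
  by exists 0 => _ [p _ <-]; exact: N2_ge0.
pose d := inf S.
have dS u g : T u g -> L2 g -> d <= N2 (res (u, g)).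
  by move=> Tu Lg; apply: ge_inf; [case: infS|exists (u, g)].
(* The slack 8^-k is the rate that [L2_complete] requires of the increments. *)
have /choice[p Hp] : forall k : nat, exists p : F * F,
    [/\ T p.1 p.2, L2 p.2 & N2 (res p) <= d + 1 / 8 ^+ k].
  move=> k; have e0 : 0 < 1 / 8 ^+ k :> R by rewrite divr_gt0// exprn_gt0.
  have [_ [p [Tp Lp] <-] /ltW lt] := inf_adherent e0 infS.
  by exists p.
pose q k := res (p k).
have Tp k : T (p k).1 (p k).2 by case: (Hp k).
have Lp2 k : L2 (p k).2 by case: (Hp k).
have Lp1 k : L2 (p k).1 by exact: T_L2 (Tp k).
have Lq k : L2 (q k) by exact: Lres.
have T0 : T (fun=> 0) (fun=> 0).
  have := T_comb (-1) Tu0 Tu0.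
  have e (w : F) : (fun x => w x + -1 * w x) = (fun=> 0).
    by apply/funext => x; rewrite mulN1r subrr.
  by rewrite !e.
have TZ c u g : T u g -> T (fun x => c * u x) (fun x => c * g x).
  move=> /(T_comb c T0).
  have e (w : F) : (fun x => 0 + c * w x) = (fun x => c * w x).
    by apply/funext => x; rewrite add0r.
  by rewrite !e.
(* The midpoint of two pairs is again in the graph, so its residual has squared norm at least d; the
   parallelogram law turns the two slacks into a bound on the difference. *)
have qq k : N2 (fun x => q k x - q k.+1 x) <= 4 / 8 ^+ k.
  have := parallelogram (Lq k) (Lq k.+1).
  have TD := TZ (2^-1) _ _ (T_comb 1 (Tp k) (Tp k.+1)).
  have LD : L2 (fun x => 2^-1 * ((p k).2 x + 1 * (p k.+1).2 x)).
    by apply: L2Z => //; exact: L2_comb.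
  have := dS _ _ TD LD.
  have -> : (fun x => q k x + q k.+1 x) =
     (fun x => 2 * res ((fun x => 2^-1 * ((p k).1 x + 1 * (p k.+1).1 x)),
                        (fun x => 2^-1 * ((p k).2 x + 1 * (p k.+1).2 x))) x).
    apply/funext => x; rewrite /q /res /=.
    have two : (2 : R[i]) != 0 by rewrite pnatr_eq0.
    by field.
  rewrite N2Z; last exact: Lres.
  rewrite (_ : csq 2 = 4); last by rewrite (_ : 2 = (2%:C)%C) ?csqC -?natrX// rmorph_nat.
  have [_ _ h1] := Hp k; have [_ _ h2] := Hp k.+1.
  have h3 : 1 / 8 ^+ k.+1 <= 1 / 8 ^+ k :> R.
    rewrite !div1r lef_pV2 ?posrE ?exprn_gt0// exprS ler_peMl ?exprn_ge0//.
    by rewrite (ler_nat _ 1 8).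
  rewrite (_ : 4 / 8 ^+ k = 4 * (1 / 8 ^+ k)); last by rewrite mul1r.
  move: h1 h2; rewrite -/(q k) -/(q k.+1).
  set a := N2 _; set b := N2 _; set c := N2 _; set e := N2 _.
  move: h3; set e1 := 1 / _; set e2 := 1 / _; lra.
have Lp1B k m : L2 (fun x => (p k).1 x - (p m).1 x) by exact: L2B.
have Lp2B k m : L2 (fun x => (p k).2 x - (p m).2 x) by exact: L2B.
(* T - z maps the increment of the arguments to the difference of consecutive residuals, so
   [symmetric_im_bound] makes the arguments Cauchy as well. *)
have uu k : N2 (fun x => (p k.+1).1 x - (p k).1 x) <= 4 / complex.Im z ^+ 2 / 8 ^+ k.
  have TB : T (fun x => (p k.+1).1 x - (p k).1 x) (fun x => (p k.+1).2 x - (p k).2 x).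
    by rewrite !sub_comb; exact: T_comb.
  have := symmetric_im_bound z sy TB (Lp2B _ _).
  rewrite (_ : (fun x => _ - z * _) = (fun x => q k x - q k.+1 x)); last first.
    by apply/funext => x; rewrite /q /res; ring.
  move=> h; rewrite mulrAC ler_pdivlMr// mulrC; exact: le_trans h (qq k).
have gg k : N2 (fun x => (p k.+1).2 x - (p k).2 x) <=
    (8 + 2 * csq z * (4 / complex.Im z ^+ 2)) / 8 ^+ k.
  rewrite (_ : (fun x => (p k.+1).2 x - (p k).2 x) =
    (fun x => (q k x - q k.+1 x) + z * ((p k.+1).1 x - (p k).1 x))); last first.
    by apply/funext => x; rewrite /q /res; ring.
  apply: le_trans (N2_comb_le mD z (L2B mD (Lq _) (Lq _)) (Lp1B _ _)) _.
  rewrite [leRHS]mulrDl; apply: lerD.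
    by rewrite (_ : 8 / 8 ^+ k = 2 * (4 / 8 ^+ k)) ?ler_wpM2l ?qq// mulrA -natrM.
  by rewrite -[leRHS]mulrA ler_wpM2l// ?mulr_ge0 ?csq_ge0.
have [u Lu [Ku HKu]] := L2_complete mD Lp1 uu.
have [g Lg [Kg HKg]] := L2_complete mD Lp2 gg.
have zero (a : R[i]) (K : R) : (forall k, csq a <= K / 4 ^+ k) -> a = 0.
  move=> h; apply: csq_eq0; apply/eqP; rewrite eq_le csq_ge0 andbT.
  exact: le0_of_geometric h.
(* A self-adjoint graph is closed: the symmetry relation of (p k) with any pair of the graph passes
   to the limit, and membership is tested by that relation. *)
have Tug : T u g.
  apply: sa => // v h Tvh; have [h1 [Lh hh1 Tvh1]] := T_rep Tvh.
  have Lv := T_L2 Tvh.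
  rewrite !innerE (bil_ae (w' := u^~J) hh1); last exact: ae_eq_refl.
  apply/eqP; rewrite -subr_eq0; apply/eqP.
  apply: (zero _ (2 * (N2 h1 * Ku) + 2 * (N2 v * Kg))) => k.
  have := sy _ _ _ _ Tvh1 (Tp k); rewrite !innerE => e.
  have Jk1 := L2J (Lp1 k); have Jk2 := L2J (Lp2 k).
  have Ju := L2J Lu; have Jg := L2J Lg.
  have -> : bil h1 u^~J - bil v g^~J =
     - bil h1 (fun x => ((p k).1 x - u x)^*)%C + bil v (fun x => ((p k).2 x - g x)^*)%C.
    have cB (w w' : F) : (fun x => ((w x - w' x)^*)%C) = (fun x => (w x)^*%C - (w' x)^*%C).
      by apply/funext => x; rewrite rmorphB.
    rewrite !cB.
    by rewrite !bilBr// e; ring.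
  apply: le_trans (csqD_le _ _) _; rewrite csqN [leRHS]mulrDl -!mulrA; apply: lerD.
    rewrite ler_wpM2l//; apply: le_trans (cauchy_schwarz mD Lh (L2J (L2B mD (Lp1 k) Lu))) _.
    by rewrite N2J ler_wpM2l// N2_ge0.
  rewrite ler_wpM2l//; apply: le_trans (cauchy_schwarz mD Lv (L2J (L2B mD (Lp2 k) Lg))) _.
  by rewrite N2J ler_wpM2l// N2_ge0.
pose r := res (u, g).
have Lr : L2 r by exact: Lres.
have orth v h : T v h -> L2 h -> bil r (fun x => (h x - z * v x)^*)%C = 0.
  move=> Tvh Lh; have Lv := T_L2 Tvh.
  pose w x := h x - z * v x; have Lw : L2 w by apply: L2B => //; exact: L2Z.
  pose K := 2 * N2 w + 2 * ((2 * Kg + 2 * csq z * Ku) * N2 w).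
  apply: (zero _ K) => k.
  pose s x := ((p k).2 x - g x) + (- z) * ((p k).1 x - u x).
  have Ls : L2 s by apply: L2_comb => //; exact: L2B.
  have -> : bil r (fun x => (h x - z * v x)^*)%C = bil (q k) w^~J + 1 * bil s w^~J.
    rewrite -bil_combl//; last exact: L2J.
    by congr (bil _ _); apply/funext => x; rewrite /q /s /r /res /=; ring.
  rewrite mul1r; apply: le_trans (csqD_le _ _) _.
  rewrite /K [leRHS]mulrDl; apply: lerD.
    rewrite -[leRHS]mulrA ler_wpM2l//; have [_ _ hk] := Hp k.
    apply: le_trans (@near_projection _ w d (1 / 8 ^+ k) (Lq k) Lw _ hk _) _.
    - by rewrite divr_ge0// exprn_ge0.
    - move=> c; have := dS _ _ (T_comb (- c) (Tp k) Tvh) (L2_comb mD (- c) (Lp2 k) Lh).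
      rewrite (_ : res _ = (fun x => q k x + c * w x))//.
      by apply/funext => x; rewrite /q /w /res /=; ring.
    - rewrite mulrC ler_wpM2l ?N2_ge0// div1r lef_pV2 ?posrE ?exprn_gt0//.
      by apply: lerXn2r; rewrite ?nnegrE ?ler_nat.
  rewrite -[leRHS]mulrA ler_wpM2l//.
  apply: le_trans (cauchy_schwarz mD Ls (L2J Lw)) _.
  rewrite N2J mulrAC ler_wpM2r ?N2_ge0//.
  apply: le_trans (N2_comb_le mD _ (L2B mD (Lp2 k) Lg) (L2B mD (Lp1 k) Lu)) _.
  rewrite csqN [leRHS]mulrDl -!mulrA; apply: lerD; rewrite ler_wpM2l//.
  by rewrite ler_wpM2l// csq_ge0.
(* Orthogonality of r to the range of T - z is the relation by which self-adjointness puts r in the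
   domain, with eigenvalue conj z. As Im z is non-zero, r must vanish. *)
have Tr : T r (fun x => (z^*)%C * r x).
  apply: sa => //; first exact: L2Z.
  move=> v h Tvh; have [h1 [Lh hh1 Tvh1]] := T_rep Tvh.
  have Lv := T_L2 Tvh.
  rewrite !innerE (bil_ae (w' := r^~J) hh1); last exact: ae_eq_refl.
  have := orth _ _ Tvh1 Lh => /(congr1 (fun a => a^*%C)); rewrite -bilJ//; last first.
    by apply: L2J; apply: L2B => //; exact: L2Z.
  rewrite conjc0 bilC (_ : (fun x => _) = (fun x => h1 x - z * v x)); last first.
    by apply/funext => x; rewrite conjcK.
  rewrite bilBl//; [|exact: L2Z|exact: L2J].
  rewrite bilZl//; last exact: L2J.
  move/eqP; rewrite subr_eq0 => /eqP ->.
  rewrite (_ : (fun x => ((z^*)%C * r x)^*%C) = (fun x => z * (r x)^*%C)); last first.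
    by apply/funext => x; rewrite conjcM conjcK.
  by rewrite bilZr//; exact: L2J.
have Nr : N2 r = 0.
  have := symmetric_im_bound (z^*)%C sy Tr (L2Z mD _ Lr).
  rewrite (_ : (fun x => _ - _) = (fun=> 0)); last by apply/funext => x; rewrite subrr.
  rewrite !N2_def sqL2_0//= CImJ sqrrN -N2_def => h.
  have := N2_ge0 mu D r; apply/contraTeq => r0.
  rewrite -ltNge lt_neqAle r0/= -(pmulr_rle0 _ zz)//.
exists u, g; split => //.
have := N2_eq0_ae Lr Nr; apply: aeS => x h Dx; have := h Dx.
by rewrite /r /res /= => /eqP; rewrite subr_eq0 => /eqP.
Qed.
End Resolvent.

(** * Smooth functions and cutoffs *)

Section FlatFunction.
Variable R : realType.

(** The family t^-k exp(-1/t), and not just exp(-1/t), because it is closed under differentiation: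
    the derivative of [flat k] combines [flat k.+1] and [flat k.+2]. *)
Definition flat (k : nat) (t : R) : R :=
  if 0 < t then (t^-1) ^+ k * expR (- t^-1) else 0.

Lemma flat_ge0 k t : 0 <= flat k t.
Proof.
rewrite /flat; case: ifPn => // t0.
by rewrite mulr_ge0 ?expR_ge0// exprn_ge0// invr_ge0 ltW.
Qed.
Lemma flat_gt0 k t : 0 < t -> 0 < flat k t.
Proof. by move=> t0; rewrite /flat t0 mulr_gt0 ?expR_gt0// exprn_gt0// invr_gt0. Qed.
Lemma flat_le0 k t : t <= 0 -> flat k t = 0.
Proof. by rewrite /flat leNgt => /negbTE ->. Qed.

(** One term of the exponential series, exp x >= x^(k+1) / (k+1)!, taken at x = 1/t. *)
Lemma flat_bound k t : `|flat k t| <= (k.+1)`!%:R * `|t|.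
Proof.
have [t0|t0] := ltP 0 t; last by rewrite flat_le0// normr0 mulr_ge0.
rewrite ger0_norm ?flat_ge0// /flat t0 (gtr0_norm t0).
have ti : 0 <= t^-1 by rewrite invr_ge0 ltW.
have h : (t^-1) ^+ k.+1 / (k.+1)`!%:R <= expR (t^-1).
  by apply: le_trans (expR_ge1Dxn k ti); rewrite lerDr.
have f0 : 0 < (k.+1)`!%:R :> R by rewrite ltr0n fact_gt0.
rewrite expRN ler_pdivrMr ?expR_gt0//.
move: h; rewrite ler_pdivrMr// => h.
rewrite (_ : (t^-1) ^+ k = t^-1 ^+ k.+1 * t); last first.
  by rewrite exprSr -mulrA mulVf ?mulr1// gt_eqF.
by rewrite mulrAC ler_pM2r// [leRHS]mulrC.
Qed.

Lemma flat_is_derive (k : nat) (t : R) :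
  is_derive t (1 : R) (flat k) (- k%:R * flat k.+1 t + flat k.+2 t).
Proof.
have [t0|t0|<-] := ltgtP 0 t.
- have tn : t != 0 by rewrite gt_eqF.
  apply: (@near_eq_is_derive R R R (fun s : R => (s^-1) ^+ k * expR (- s^-1))).
    near=> s; rewrite /flat ifT//; near: s; exact: lt_nbhsr.
  rewrite /flat t0.
  have dI : is_derive t 1 (fun s : R => s^-1) (- t ^- 2).
    have h := derivableP (derivableV tn (@derivable_id R R t 1)).
    apply: is_derive_eq h _.
    by rewrite deriveV//= derive_id [LHS]mulr1.
  have dE : is_derive t 1 (fun s : R => expR (- s^-1)) (expR (- t^-1) * t ^- 2).
    have dN : is_derive t 1 (fun s : R => - s^-1) (t ^- 2).
      by apply: is_derive_eq; rewrite opprK.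
    have := @is_derive1_comp _ expR (fun s : R => - s^-1) t _ _ (is_derive_expR _) dN.
    by apply.
  have dX : is_derive t 1 (fun s : R => s^-1 ^+ k) (k%:R * t^-1 ^+ k.-1 * - t ^- 2).
    rewrite (_ : (fun s : R => s^-1 ^+ k) = (fun s : R => s^-1) ^+ k); last first.
      by apply/funext => s; rewrite exprfctE.
    exact: is_deriveX.
  have h : is_derive t (1 : R) (fun s : R => s^-1 ^+ k * expR (- s^-1)) _ := is_deriveM dX dE.
  apply: (is_derive_eq h).
  rewrite /GRing.scale /= !exprVn.
  case: k {dX h} => [|k]; first by rewrite expr0 !mul0r !mulr0 invr1; field.
  rewrite /= !exprS expr0; have tk : t ^+ k != 0 by rewrite expf_neq0.
  by field; apply/andP.
- apply: (@near_eq_is_derive R R R (cst (0 : R))).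
    near=> s; rewrite /= flat_le0// ltW//; near: s; exact: lt_nbhsl.
  rewrite !flat_le0 ?ltW// mulr0 addr0; exact: is_derive_cst.
- rewrite !flat_le0// mulr0 addr0.
  (* For h > 0 the difference quotient at 0 is [flat k.+1 h], which [flat_bound] sends to 0. *)
  have H : h^-1 *: ((flat k \o shift 0) (h *: 1) - flat k 0) @[h --> 0^'] --> (0 : R).
    rewrite (flat_le0 k (lexx 0)).
    apply/cvgrPdist_lt => e e0; near=> h; rewrite sub0r normrN subr0 /= addr0.
    rewrite /GRing.scale /= mulr1.
    have hn : h != 0 by near: h; exact: nbhs_dnbhs_neq.
    apply: (@le_lt_trans _ _ ((k.+2)`!%:R * `|h|)).
      have [h0|h0] := ltP 0 h; last by rewrite flat_le0// mulr0 normr0 mulr_ge0.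
      rewrite (_ : h^-1 * flat k h = flat k.+1 h) ?flat_bound//.
      by rewrite /flat h0 exprS mulrA.
    have f0 : 0 < (k.+2)`!%:R :> R by rewrite ltr0n fact_gt0.
    rewrite mulrC -ltr_pdivlMr//; near: h.
    apply: dnbhs0_lt; exact: divr_gt0.
  by apply: DeriveDef; [apply/cvg_ex; exists 0|exact: cvg_lim H].
Unshelve. all: by end_near. Qed.

Lemma flat_continuous k : continuous (flat k).
Proof.
move=> t; apply: differentiable_continuous; apply/derivable1_diffP.
by case: (flat_is_derive k t).
Qed.
End FlatFunction.

Section Smooth.
Variables (R : realType) (n : nat).
Notation E := 'rV[R]_n.
Notation e_ i := (delta_mx 0 i : E).

(** Restricting f to the line through x along v reduces the claim to the chain rule on R;
    [smooth_fun] speaks of partial derivatives only, so a directional form is what is wanted. *)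
Lemma is_derive_along (f : E -> R) (g : R -> R) (x v : E) df dg :
  is_derive x v f df -> is_derive (f x) 1 g dg -> is_derive x v (g \o f) (dg * df).
Proof.
move=> [fd fe] hg.
pose F (h : R) := f (h *: v + x).
have DF : is_derive (0 : R) 1 F df.
  have dF : derivable F 0 1 by exact: (derivable1P f x v).1.
  apply: DeriveDef => //; rewrite -fe /derive.
  rewrite (_ : (fun h => _) = (fun h : R => h^-1 *: ((f \o shift x) (h *: v) - f x)))//.
  by apply/funext => h; rewrite /F /= !addr0 scale0r add0r [h *: 1]mulr1.
have DF0 : F 0 = f x by rewrite /F scale0r add0r.
rewrite -DF0 in hg.
have [h1 h2] := @is_derive1_comp _ g F 0 _ _ hg DF.
split; first exact: (derivable1P (g \o f) x v).2.
rewrite -h2 /derive.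
rewrite [in RHS](_ : (fun h => _) =
  (fun h : R => h^-1 *: (((g \o f) \o shift x) (h *: v) - (g \o f) x)))//.
by apply/funext => h; rewrite /F /= !addr0 scale0r add0r [h *: 1]mulr1.
Qed.

Lemma smooth_continuous (f : E -> R) : smooth_fun f -> continuous f.
Proof. by move=> /(_ [::]) []. Qed.
Lemma smooth_derivable (f : E -> R) i x : smooth_fun f -> derivable f x (e_ i).
Proof. by move=> /(_ [::]) []. Qed.
Lemma smooth_pderiv (f : E -> R) i : smooth_fun f -> smooth_fun (pderiv i f).
Proof. by move=> sf r; have := sf (rcons r i); rewrite foldr_rcons. Qed.

(* This class is visibly stable under partial derivatives, whereas [smooth_fun]
   gives no direct induction for products. *)
Inductive smooth_closure : (E -> R) -> Prop :=
| SC_smooth f : smooth_fun f -> smooth_closure f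
| SC_cst c : smooth_closure (fun=> c)
| SC_coord j : smooth_closure (fun x => x 0 j)
| SC_add f g : smooth_closure f -> smooth_closure g ->
    smooth_closure (fun x => f x + g x)
| SC_mul f g : smooth_closure f -> smooth_closure g ->
    smooth_closure (fun x => f x * g x)
| SC_inv f : (forall x, f x != 0) -> smooth_closure f ->
    smooth_closure (fun x => (f x)^-1)
| SC_flat k f : smooth_closure f -> smooth_closure (fun x => flat k (f x)).

Lemma smooth_closure_continuous f : smooth_closure f -> continuous f.
Proof.
elim=> {f} [f sf|c|j|f g _ cf _ cg|f g _ cf _ cg|f f0 _ cf|k f _ cf] x.
- exact: smooth_continuous.
- exact: cst_continuous.
- exact: coord_continuous.
- exact: (cvgD (cf x) (cg x)).
- exact: (cvgM (cf x) (cg x)).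
- exact: (cvgV (f0 x) (cf x)).
- by apply: continuous_comp; [exact: cf|exact: flat_continuous].
Qed.

Lemma smooth_closure_derive f i : smooth_closure f ->
  exists2 g, smooth_closure g & forall x, is_derive x (e_ i) f (g x).
Proof.
elim=> {f} [f sf|c|j|f g sf [f' sf' Hf] sg [g' sg' Hg]|
  f g sf [f' sf' Hf] sg [g' sg' Hg]|f f0 sf [f' sf' Hf]|k f sf [f' sf' Hf]].
- exists (pderiv i f); first by apply: SC_smooth; exact: smooth_pderiv.
  by move=> x; apply: derivableP; exact: smooth_derivable.
- by exists (fun=> 0); [exact: SC_cst|move=> x; exact: is_derive_cst].
- exists (fun=> e_ i 0 j); first exact: SC_cst.
  move=> x.
  have df := @differentiable_coord R 1 n x 0 j.
  apply: DeriveDef; first exact: diff_derivable.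
  rewrite /derive (_ : (fun h => _) = fun h : R => h^-1 *: (h * e_ i 0 j)); last first.
    by apply/funext => h /=; rewrite !mxE addrK.
  apply: lim_near_cst => //.
  near=> h; have hn : h != 0 by near: h; exact: nbhs_dnbhs_neq.
  by rewrite /GRing.scale /= mulKf.
- exists (fun x => f' x + g' x); first exact: SC_add.
  by move=> x; exact: is_deriveD.
- exists (fun x => f x * g' x + g x * f' x); first by apply: SC_add; exact: SC_mul.
  by move=> x; exact: is_deriveM.
- exists (fun x => (-1) * ((f x)^-1 * (f x)^-1) * f' x).
    apply: SC_mul => //; apply: SC_mul; first exact: SC_cst.
    by apply: SC_mul; exact: SC_inv.
  move=> x; have [d1 d2] := Hf x.
  apply: DeriveDef; first exact: derivableV.
  by rewrite deriveV// d2 /GRing.scale /= expr2 invfM mulN1r.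
- exists (fun x => ((- k%:R) * flat k.+1 (f x) + flat k.+2 (f x)) * f' x).
    apply: SC_mul => //; apply: SC_add; last exact: SC_flat.
    by apply: SC_mul; [exact: SC_cst|exact: SC_flat].
  by move=> x; apply: (@is_derive_along f (flat k)); last exact: flat_is_derive.
Unshelve. all: by end_near. Qed.

Lemma smooth_closure_smooth f : smooth_closure f -> smooth_fun f.
Proof.
move=> sf r.
have H : smooth_closure (foldr (@pderiv R n) f r).
  elim: r => //= i r IH; have [g sg Hg] := smooth_closure_derive i IH.
  rewrite (_ : pderiv i _ = g)//; apply/funext => x.
  by have [_] := Hg x.
split; first exact: smooth_closure_continuous.
by move=> i x; have [g _ Hg] := smooth_closure_derive i H; case: (Hg x).
Qed.

Lemma smoothD (f g : E -> R) : smooth_fun f -> smooth_fun g -> smooth_fun (fun x => f x + g x).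
Proof. by move=> *; apply: smooth_closure_smooth; apply: SC_add; exact: SC_smooth. Qed.
Lemma smoothM (f g : E -> R) : smooth_fun f -> smooth_fun g -> smooth_fun (fun x => f x * g x).
Proof. by move=> *; apply: smooth_closure_smooth; apply: SC_mul; exact: SC_smooth. Qed.
Lemma smooth_cst c : smooth_fun (fun _ : E => c).
Proof. by apply: smooth_closure_smooth; exact: SC_cst. Qed.
Lemma smoothZ c (f : E -> R) : smooth_fun f -> smooth_fun (fun x => c * f x).
Proof. by move=> sf; apply: smoothM => //; exact: smooth_cst. Qed.
Lemma pderivD i (f g : E -> R) x : smooth_fun f -> smooth_fun g ->
  pderiv i (fun x => f x + g x) x = pderiv i f x + pderiv i g x.
Proof.
by move=> sf sg; rewrite /pderiv (@deriveD _ _ _ f g)//; exact: smooth_derivable.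
Qed.
Lemma pderivM i (f g : E -> R) x : smooth_fun f -> smooth_fun g ->
  pderiv i (fun x => f x * g x) x = f x * pderiv i g x + g x * pderiv i f x.
Proof.
by move=> sf sg; rewrite /pderiv (@deriveM _ _ f g)//; exact: smooth_derivable.
Qed.
Lemma pderiv_cst i c x : pderiv i (fun _ : E => c) x = 0.
Proof. exact: derive_cst. Qed.
Lemma pderivZ i c (f : E -> R) x : smooth_fun f ->
  pderiv i (fun x => c * f x) x = c * pderiv i f x.
Proof.
by move=> sf; rewrite pderivM ?pderiv_cst ?mulr0 ?addr0//; exact: smooth_cst.
Qed.
Lemma compact_closedE (K : set E) : compact K -> closed K.
Proof. by apply: compact_closed; exact: norm_hausdorff. Qed.

Lemma pderiv_off (K : set E) i (f : E -> R) : closed K ->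
  (forall x, ~ K x -> f x = 0) -> forall x, ~ K x -> pderiv i f x = 0.
Proof.
move=> cK f0 x Kx; rewrite /pderiv -(@derive_cst R E R 0 x (e_ i)).
apply: near_eq_derive; near=> y; apply: f0.
by near: y; apply: open_nbhs_nbhs; split => //; exact: closed_openC.
Unshelve. all: by end_near. Qed.

Lemma test_pderiv U i (f : E -> R) : test_fun U f -> test_fun U (pderiv i f).
Proof.
move=> [sf [K [cK KU f0]]]; split; first exact: smooth_pderiv.
by exists K; split => //; apply: pderiv_off => //; exact: compact_closedE.
Qed.
Lemma test_mull U (f g : E -> R) : test_fun U f -> smooth_fun g ->
  test_fun U (fun x => f x * g x).
Proof.
move=> [sf [K [cK KU f0]]] sg; split; first exact: smoothM.
by exists K; split => // x /f0 ->; rewrite mul0r.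
Qed.
Lemma testD U (f g : E -> R) : test_fun U f -> test_fun U g ->
  test_fun U (fun x => f x + g x).
Proof.
move=> [sf [K [cK KU f0]]] [sg [K' [cK' KU' g0]]]; split; first exact: smoothD.
exists (K `|` K'); split; first exact: compactU.
  by move=> x [/KU|/KU'].
by move=> x /not_orP[/f0 -> /g0 ->]; rewrite addr0.
Qed.
Lemma testZ U c (f : E -> R) : test_fun U f -> test_fun U (fun x => c * f x).
Proof.
move=> [sf [K [cK KU f0]]]; split; first exact: smoothZ.
by exists K; split => // x /f0 ->; rewrite mulr0.
Qed.
Lemma testS U V (f : E -> R) : U `<=` V -> test_fun U f -> test_fun V f.
Proof.
by move=> UV [sf [K [cK KU f0]]]; split => //; exists K; split => // x /KU /UV.
Qed.

Lemma compact_bound (K : set E) (f : E -> R) : compact K -> continuous f ->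
  exists M, forall x, K x -> `|f x| <= M.
Proof.
move=> cK cf.
have /compact_bounded[M [_ HM]] : compact (f @` K).
  by apply: continuous_compact => //; exact: continuous_subspaceT.
by exists (M + 1) => x Kx; apply: HM; [rewrite ltrDl|exists x].
Qed.

Lemma test_bound U (f : E -> R) : test_fun U f -> exists M, forall x, `|f x| <= M.
Proof.
move=> [sf [K [cK KU f0]]].
have [M HM] := compact_bound cK (smooth_continuous sf).
exists (Num.max 0 M) => x; have [Kx|Kx] := pselect (K x).
  by rewrite le_max HM// orbT.
by rewrite f0// normr0 le_max lexx.
Qed.

(** The pair p is a centre and a radius. Each factor is positive exactly when the coordinate is
    closer than the radius, so the product is positive exactly on the open ball of the sup norm. *)
Definition cube_bump (p : E * R) (x : E) : R :=
  \prod_(j < n) (flat 0 (p.2 + (x 0 j - p.1 0 j)) * flat 0 (p.2 - (x 0 j - p.1 0 j))).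

Lemma SC_prod (s : seq 'I_n) (F : 'I_n -> E -> R) : (forall j, smooth_closure (F j)) ->
  smooth_closure (fun x => \prod_(j <- s) F j x).
Proof.
move=> HF; elim: s => [|j s IH].
  by under eq_fun do rewrite big_nil; exact: SC_cst.
by under eq_fun do rewrite big_cons; exact: SC_mul.
Qed.

Lemma SC_cube_bump p : smooth_closure (cube_bump p).
Proof.
apply: SC_prod => j.
have sc : smooth_closure (fun x : E => x 0 j - p.1 0 j).
  by apply: SC_add; [exact: SC_coord|exact: SC_cst].
apply: SC_mul; apply: SC_flat; apply: SC_add; try exact: SC_cst; first exact: sc.
have : smooth_closure (fun x : E => -1 * (x 0 j - p.1 0 j)) by apply: SC_mul => //; exact: SC_cst.
by under eq_fun do rewrite mulN1r.
Qed.

Lemma cube_bump_ge0 p x : 0 <= cube_bump p x.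
Proof. by apply: prodr_ge0 => j _; rewrite mulr_ge0// flat_ge0. Qed.

Lemma cube_bump_gt0 p x : ball p.1 p.2 x -> 0 < cube_bump p x.
Proof.
move=> [p0 bx]; apply: prodr_gt0 => j _.
have := bx 0 j; rewrite /ball /= ltr_norml => /andP[h1 h2].
by rewrite mulr_gt0// flat_gt0//; lra.
Qed.

Lemma cube_bump_eq0 p x : 0 < p.2 -> ~ ball p.1 p.2 x -> cube_bump p x = 0.
Proof.
move=> p0 nb; apply/eqP; rewrite prodf_seq_eq0; apply: contra_notT nb => /hasPn h.
split => // i j; rewrite (ord1 i) /ball /= ltr_norml.
have := h j (mem_index_enum _); rewrite /= mulf_eq0 negb_or => /andP[h1 h2].
apply/andP; split; rewrite ltNge; apply/negP => h3.
  by move/eqP : h2; apply; apply: flat_le0; lra.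
by move/eqP : h1; apply; apply: flat_le0; lra.
Qed.

Lemma compact_closed_ball (a : E) r : 0 < r -> compact (closed_ball a r).
Proof.
move=> r0; apply: bounded_closed_compact; last exact: closed_ball_closed.
exists (`|a| + r); split; first exact: num_real.
move=> M hM x /=; rewrite closed_ballE// /closed_ball_/= => h.
apply: le_trans (ltW hM).
rewrite (_ : x = a - (a - x)); last by rewrite opprB addrC subrK.
by apply: le_trans (ler_normB _ _) _; rewrite lerD2l.
Qed.

(** A finite sum sigma of bumps is positive on K, hence at least some e > 0 there. With F =
    [flat 0], the quotient F(sigma) / (F(sigma) + F(e - sigma)) is 1 where sigma >= e and 0 where
    sigma = 0. *)
Lemma cutoff (K O : set E) : compact K -> open O -> K `<=` O ->
  exists chi, test_fun O chi /\ forall x, K x -> chi x = 1.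
Proof.
move=> cK oO KO.
(* Radii are chosen for all points so that [choice] yields a total function; off K the value 1 is a
   dummy. *)
have rad : forall a, exists r : R, 0 < r /\ (K a -> closed_ball a r `<=` O).
  move=> a; have [Ka|Ka] := pselect (K a); last by exists 1.
  have : nbhs a O by apply: open_nbhs_nbhs; split => //; exact: KO.
  by move/nbhs_closedballP => [r rO]; exists r%:num.
have /choice[r Hr] := rad.
have := cK; rewrite compact_cover => /(_ E K (fun a => ball a (r a))) [].
- by move=> a _; exact: ball_open.
- by move=> a Ka; exists a => //; apply: ballxx; case: (Hr a).
move=> D' D'K Kcov.
pose s := [seq (a, r a) | a <- (finmap.enum_fset D')].
pose sigma x := \sum_(p <- s) cube_bump p x.
have sP p : p \in s -> 0 < p.2 /\ closed_ball p.1 p.2 `<=` O.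
  move=> /mapP[a aD ->] /=; have [r0 ro] := Hr a; split => //.
  by apply: ro; have := D'K a aD; rewrite inE.
have ssig : smooth_closure sigma.
  rewrite /sigma; elim: (s) => [|p t IH].
    by under eq_fun do rewrite big_nil; exact: SC_cst.
  by under eq_fun do rewrite big_cons; apply: SC_add => //; exact: SC_cube_bump.
have sig0 x : 0 <= sigma x by apply: sumr_ge0 => p _; exact: cube_bump_ge0.
have sigp x : K x -> 0 < sigma x.
  move=> Kx; have [a aD bax] := Kcov x Kx.
  have ps : (a, r a) \in s by apply/mapP; exists a.
  rewrite /sigma (big_rem _ ps) /=.
  rewrite ltr_pwDl ?cube_bump_gt0//; apply: sumr_ge0 => p _; exact: cube_bump_ge0.
pose K' := [set x | exists2 p, p \in s & closed_ball p.1 p.2 x].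
have cK' : compact K'.
  rewrite /K'; elim: (s) sP => [|p t IH] sP.
    rewrite (_ : [set x | _] = set0); first exact: compact0.
    by rewrite -subset0 => x [].
  rewrite (_ : [set x | _] = closed_ball p.1 p.2 `|` [set x | exists2 p0, p0 \in t & closed_ball p0.1 p0.2 x]).
    apply: compactU; last by apply: IH => q qt; apply: sP; rewrite inE qt orbT.
    by apply: compact_closed_ball; have [] := sP p (mem_head _ _).
  apply/seteqP; split => x /=.
    move=> [q]; rewrite inE => /orP[/eqP -> ?|qt qx]; [by left|right].
    by exists q.
  move=> [px|[q qt qx]]; first by exists p => //; exact: mem_head.
  by exists q => //; rewrite inE qt orbT.
have sigK' x : ~ K' x -> sigma x = 0.
  move=> nK; rewrite /sigma big_seq big1// => p ps; have [p0 _] := sP p ps.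
  apply: cube_bump_eq0 => // /(@subset_closure _ (ball p.1 p.2)) px; apply: nK.
  by exists p.
have [e e0 He] : exists2 e : R, 0 < e & forall x, K x -> e <= sigma x.
  have [K0|/set0P K0] := eqVneq K set0; first by exists 1 => // x; rewrite K0.
  have cs : {within K, continuous sigma}.
    by apply: continuous_subspaceT; exact: smooth_closure_continuous.
  have [c + Hc] := compact_EVT_min K0 cK cs.
  rewrite inE => Kc; exists (sigma c); first exact: sigp.
  by move=> x Kx; apply: Hc; rewrite inE.
pose den x := flat 0 (sigma x) + flat 0 (e - sigma x).
(* Either sigma is positive, or e - sigma is at least e. *)
have den0 x : den x != 0.
  rewrite gt_eqF// /den; have [h|h] := ltP 0 (sigma x).
    by rewrite ltr_pwDl ?flat_gt0// flat_ge0.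
  by rewrite ltr_wpDl ?flat_ge0// flat_gt0//; lra.
have sden : smooth_closure den.
  apply: SC_add; first exact: SC_flat.
  apply: SC_flat; apply: SC_add; first exact: SC_cst.
  have : smooth_closure (fun x : E => -1 * sigma x) by apply: SC_mul => //; exact: SC_cst.
  by under eq_fun do rewrite mulN1r.
exists (fun x => flat 0 (sigma x) * (den x)^-1); split.
  split.
    apply: smooth_closure_smooth; apply: SC_mul; first exact: SC_flat.
    exact: SC_inv.
  exists K'; split => //; first by move=> x [p ps px]; have [_] := sP p ps; exact.
  by move=> x /sigK' ->; rewrite flat_le0// mul0r.
move=> x Kx; rewrite /den [flat 0 (e - _)]flat_le0 ?addr0 ?divff//.
  by rewrite gt_eqF// flat_gt0// sigp.
by rewrite subr_le0 He.
Qed.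

End Smooth.

(** * Sobolev norms *)

Section QuadraticNorms.
Variables (R : realType) (n : nat).
Notation E := 'rV[R]_n.
Notation B := (borelT R n).
Notation F := (fn R n).
Notation meas := {measure set (borelT R n) -> \bar R}.

(** What [sqL2], [sqSlob], [sqH], [sqHDelta] and [sqHb] have in common as squared norms with value
    +oo outside their space; convergence arguments are then done once for all of them. *)
Definition qnorm (N : F -> \bar R) : Prop :=
  [/\ forall u, (0 <= N u)%E, N (fun=> 0) = 0%E &
      forall u v c, (N u < +oo)%E -> (N v < +oo)%E ->
        (N (fun x => u x + c * v x)%R <= 2%:E * N u + (2 * csq c)%:E * N v)%E].

Lemma qnorm_sqL2 (mu : meas) D : measurable (D : set B) -> qnorm (sqL2 mu D).
Proof.
move=> mD; split; [exact: sqL2_ge0|exact: sqL2_0|].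
by move=> u v c; exact: sqL2_comb.
Qed.

Lemma qnorm_lt_pinfty N u v c : qnorm N -> (N u < +oo)%E -> (N v < +oo)%E ->
  (N (fun x => u x + c * v x)%R < +oo)%E.
Proof.
move=> [_ _ h] Nu Nv; apply: le_lt_trans (h _ _ _ Nu Nv) _.
by rewrite lte_add_pinfty// lte_mul_pinfty// lee_fin mulr_ge0// csq_ge0.
Qed.

Lemma qnormB N u v : qnorm N -> (N u < +oo)%E -> (N v < +oo)%E ->
  (N (fsub u v) <= 2%:E * N u + 2%:E * N v)%E.
Proof.
move=> [_ _ h] Nu Nv; have := h u v (-1) Nu Nv.
rewrite csqN csq1 mulr1; apply: le_trans; rewrite le_eqVlt; apply/orP; left; apply/eqP.
by congr N; apply/funext => x; rewrite mulN1r.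
Qed.

(** The Sobolev norms are infima over auxiliary data p, such as weak derivatives or a weak
    Laplacian. Nearly optimal data for u and v combine to admissible data for u + c v. *)
Lemma qnorm_inf (P : Type) (cmb : R[i] -> P -> P -> P) (p0 : P) (N : F -> \bar R)
    (Q : P -> \bar R) (W : F -> P -> Prop) :
  qnorm N -> (forall p, (0 <= Q p)%E) -> Q p0 = 0%E -> W (fun=> 0) p0 ->
  (forall p q c, (Q p < +oo)%E -> (Q q < +oo)%E ->
     (Q (cmb c p q) <= 2%:E * Q p + (2 * csq c)%:E * Q q)%E) ->
  (forall u v p q c, (N u < +oo)%E -> (N v < +oo)%E -> W u p -> W v q ->
     W (fun x => u x + c * v x) (cmb c p q)) ->
  qnorm (fun u => ereal_inf [set (N u + Q p)%E | p in W u]).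
Proof.
move=> [N0 N00 Nc] Q0 Q00 W0 Qc Wc.
have pos u : (0 <= ereal_inf [set (N u + Q p)%E | p in W u])%E.
  by apply: le_ereal_inf_tmp => _ [p _ <-]; rewrite adde_ge0.
split => //.
  apply/eqP; rewrite eq_le pos andbT; apply: ereal_inf_lbound.
  by exists p0 => //; rewrite N00 Q00 adde0.
move=> u v c; set I := ereal_inf _; set J := ereal_inf _ => Ioo Joo.
have IE : I = (fine I)%:E by rewrite fineK// ge0_fin_numE// pos.
have JE : J = (fine J)%:E by rewrite fineK// ge0_fin_numE// pos.
apply/lee_addgt0Pr => e e0.
(* The slack e / k in each infimum is multiplied by 2 and by 2 csq c, which adds up to e. *)
pose k := 2 + 2 * csq c; have k0 : 0 < k by rewrite ltr_pwDl// mulr_ge0// csq_ge0.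
have d0 : 0 < e / k by rewrite divr_gt0.
have fI : I \is a fin_num by rewrite IE.
have fJ : J \is a fin_num by rewrite JE.
have [_ [p Wp <-] hp] := lb_ereal_inf_adherent d0 fI.
have [_ [q Wq <-] hq] := lb_ereal_inf_adherent d0 fJ.
have fin1 (x y : \bar R) (z : R) : (0 <= x)%E -> (0 <= y)%E -> (x + y < z%:E)%E ->
    x \is a fin_num /\ y \is a fin_num.
  move=> x0 y0 h.
  have xy : (x + y < +oo)%E by apply: lt_trans h (ltry _).
  by rewrite !ge0_fin_numE//; split; apply: le_lt_trans xy; rewrite ?leeDl ?leeDr.
rewrite -/I -/J IE JE in hp hq *.
rewrite -EFinD in hp; rewrite -EFinD in hq.
have [Nu Qp] := fin1 _ _ _ (N0 u) (Q0 p) hp.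
have [Nv Qq] := fin1 _ _ _ (N0 v) (Q0 q) hq.
have lt1 (x : \bar R) : x \is a fin_num -> (x < +oo)%E.
  by rewrite fin_numElt => /andP[].
apply: (@le_trans _ _ (N (fun x => u x + c * v x)%R + Q (cmb c p q))%E).
  by apply: ereal_inf_lbound; exists (cmb c p q) => //; apply: Wc => //; exact: lt1.
apply: le_trans (leeD (Nc _ _ _ (lt1 _ Nu) (lt1 _ Nv)) (Qc _ _ c (lt1 _ Qp) (lt1 _ Qq))) _.
move: hp hq.
rewrite -(fineK Nu) -(fineK Nv) -(fineK Qp) -(fineK Qq).
move: (fine (N u)) (fine (N v)) (fine (Q p)) (fine (Q q)) (fine I) (fine J) => a b x y i j.
rewrite -!EFinM -!EFinD !lte_fin lee_fin => h1 h2.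
have h3 := csq_ge0 c; set s := csq c in k k0 d0 h1 h2 h3 *.
have -> : e = k * (e / k) by rewrite mulrC divfK// gt_eqF.
set d := e / k in h1 h2 *; rewrite /k.
have : 2 * s * (b + y) <= 2 * s * (j + d) by rewrite ler_wpM2l ?mulr_ge0// ltW.
lra.
Qed.

End QuadraticNorms.

(** * Slobodeckij seminorms on a set of finite measure *)

Section Slobodeckij.
Variables (R : realType) (n : nat).
Notation E := 'rV[R]_n.
Notation B := (borelT R n).
Notation F := (fn R n).
Notation meas := {measure set (borelT R n) -> \bar R}.
Variables (mu : meas) (D : set E).
Hypothesis mD : measurable (D : set B).
Hypothesis finD : (mu D < +oo)%E.

Definition slob_kernel (p : R) (u : F) (x y : E) : R :=
  csq (u x - u y) / enorm (x - y) `^ p.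

Lemma slob_kernel_ge0 p u x y : 0 <= slob_kernel p u x y.
Proof. by rewrite divr_ge0 ?csq_ge0// powR_ge0. Qed.

Lemma coord_meas (i : 'I_n) : measurable_fun setT (fun x : B => (x : E) 0 i).
Proof. by apply: continuous_meas => x; exact: coord_continuous. Qed.

Lemma enorm_meas : measurable_fun setT (fun z : B * B => enorm ((z.1 : E) - z.2)).
Proof.
have mc : continuous (@Num.sqrt R) by exact: sqrt_continuous.
apply: (@measurableT_comp _ _ _ _ _ _ (@Num.sqrt R)).
  by apply: continuous_measurable_fun.
rewrite /dotp; apply: measurable_sum => i.
have mi : measurable_fun setT (fun z : B * B => ((z.1 : E) - z.2) 0 i).
  under eq_fun do rewrite !mxE.
  apply: measurable_funB.
    exact: (measurableT_comp (coord_meas i) measurable_fst).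
  exact: (measurableT_comp (coord_meas i) measurable_snd).
exact: measurable_funM.
Qed.

Definition zero_ext (u : F) : F := fun x => if `[< D x >] then u x else 0.

Lemma zero_ext_mfn u : mfn D u -> mfn setT (zero_ext u).
Proof.
move=> [m1 m2]; split.
  rewrite (_ : (fun x : B => _) = (fun x : B => complex.Re (u x)) \_ D).
    exact: (measurable_restrictT _ mD).1.
  apply/funext => x; rewrite /zero_ext /patch; case: asboolP => Dx.
    by rewrite mem_set.
  by rewrite memNset.
rewrite (_ : (fun x : B => _) = (fun x : B => complex.Im (u x)) \_ D).
  exact: (measurable_restrictT _ mD).1.
apply/funext => x; rewrite /zero_ext /patch; case: asboolP => Dx.
  by rewrite mem_set.
by rewrite memNset.
Qed.

Lemma slob_kernel_meas p u : mfn setT u ->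
  measurable_fun setT (fun z : B * B => slob_kernel p u z.1 z.2).
Proof.
move=> [m1 m2]; rewrite /slob_kernel.
apply: measurable_funM.
  apply: measurable_funD; apply: measurable_funX.
    under eq_fun do rewrite CReD CReN.
    by apply: measurable_funB;
      [exact: (measurableT_comp m1 measurable_fst)|exact: (measurableT_comp m1 measurable_snd)].
  under eq_fun do rewrite CImD CImN.
  by apply: measurable_funB;
    [exact: (measurableT_comp m2 measurable_fst)|exact: (measurableT_comp m2 measurable_snd)].
under eq_fun do rewrite -powRN.
exact: (measurableT_comp (measurable_powR (- p)) enorm_meas).
Qed.

(** Tonelli asks for a function measurable on the whole product and for a measure under control: u
    is extended by zero and the measure is restricted to D, where it is finite. *)
Lemma slob_inner_meas p u : mfn D u ->
  measurable_fun (D : set B)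
    (fun x : B => \int[mu]_(y in (D : set B)) (slob_kernel p u x y)%:E)%E.
Proof.
move=> mu_; have mz := zero_ext_mfn mu_.
pose m := mfrestr mD finD.
pose k (z : B * B) : \bar R :=
  ((slob_kernel p (zero_ext u) z.1 z.2)%:E * (\1_(D : set B) z.2)%:E)%E.
have mk : measurable_fun setT k.
  apply: emeasurable_funM.
    by apply/measurable_EFinP; exact: slob_kernel_meas.
  apply/measurable_EFinP.
  by apply: (measurableT_comp _ measurable_snd); exact: measurable_indic.
have k0 z : (0 <= k z)%E.
  by rewrite mule_ge0// lee_fin ?slob_kernel_ge0// indicE.
have := @measurable_fun_fubini_tonelli_F _ _ B B R m k mk k0.
move=> /(measurable_funS measurableT (@subsetT _ (D : set B))).
apply: eq_measurable_fun => x; rewrite inE => Dx.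
rewrite /fubini_F.
transitivity (\int[m]_(y in (D : set B)) (slob_kernel p u x y)%:E)%E.
  rewrite [RHS]integral_mkcond; apply: eq_integral => y _.
  rewrite /k /patch indicE; case: ifPn => Dy.
    rewrite mule1; congr EFin; rewrite /slob_kernel /zero_ext asboolT//.
    by rewrite asboolT// -inE.
  by rewrite mule0.
apply: eq_measure_integral => A mA AD.
transitivity (mu (A `&` D)); [by []|by rewrite setIidl].
Qed.

Lemma slob_section_meas p u x : mfn D u -> D x ->
  measurable_fun (D : set B) (fun y : B => slob_kernel p u x y).
Proof.
move=> mu_ Dx; have mz := zero_ext_mfn mu_.
have := measurableT_comp (slob_kernel_meas p mz) (measurable_pair1 (x : B)).
move=> /(measurable_funS measurableT (@subsetT _ (D : set B))).
apply: eq_measurable_fun => y; rewrite inE => Dy /=.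
by rewrite /slob_kernel /zero_ext !asboolT.
Qed.

Definition slob_int p u : \bar R :=
  (\int[mu]_(x in (D : set B)) \int[mu]_(y in (D : set B)) (slob_kernel p u x y)%:E)%E.

Lemma slob_int_ge0 p u : (0 <= slob_int p u)%E.
Proof.
by apply: integral_ge0 => x _; apply: integral_ge0 => y _; rewrite lee_fin slob_kernel_ge0.
Qed.

Lemma slob_int_comb p u v c : mfn D u -> mfn D v ->
  (slob_int p (fun x => u x + c * v x)%R <=
   2%:E * slob_int p u + (2 * csq c)%:E * slob_int p v)%E.
Proof.
move=> mu_ mv.
have c0 : 0 <= 2 * csq c by rewrite mulr_ge0// csq_ge0.
have inn0 w x : (0 <= \int[mu]_(y in (D : set B)) (slob_kernel p w x y)%:E)%E.
  by apply: integral_ge0 => y _; rewrite lee_fin slob_kernel_ge0.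
rewrite /slob_int -ge0_integralZl//; [|exact: slob_inner_meas].
rewrite -ge0_integralZl//; [|exact: slob_inner_meas].
rewrite -ge0_integralD//; first last.
- by apply: measurable_funeM; exact: slob_inner_meas.
- by move=> x _; rewrite mule_ge0.
- by apply: measurable_funeM; exact: slob_inner_meas.
- by move=> x _; rewrite mule_ge0.
apply: ge0_le_integral_nm => // x Dx.
have ms w : mfn D w -> measurable_fun (D : set B) (fun y : B => (slob_kernel p w x y)%:E).
  by move=> mw; apply/measurable_EFinP; exact: slob_section_meas.
have k0 w (y : B) : D y -> (0 <= (slob_kernel p w x y)%:E)%E.
  by move=> _; rewrite lee_fin slob_kernel_ge0.
rewrite -ge0_integralZl//; [|exact: ms|exact: k0].
rewrite -ge0_integralZl//; [|exact: ms|exact: k0].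
rewrite -ge0_integralD//; first last.
- by apply: measurable_funeM; exact: ms.
- by move=> y Dy; rewrite mule_ge0// k0.
- by apply: measurable_funeM; exact: ms.
- by move=> y Dy; rewrite mule_ge0// k0.
apply: ge0_le_integral_nm => y Dy; first exact: k0.
rewrite -!EFinM -EFinD lee_fin /slob_kernel.
rewrite !mulrA -mulrDl ler_wpM2r ?invr_ge0 ?powR_ge0//.
rewrite (_ : _ - _ = (u x - u y) + c * (v x - v y)); last by ring.
by apply: le_trans (csqD_le _ _) _; rewrite csqM mulrA.
Qed.

Lemma sqSlob0E d theta u : theta = 0 -> sqSlob mu D d theta u = sqL2 mu D u.
Proof. by move=> ->; rewrite /sqSlob eqxx. Qed.
Lemma sqSlobnE d theta u : theta != 0 ->
  sqSlob mu D d theta u = (sqL2 mu D u + slob_int (d + 2 * theta) u)%E.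
Proof. by move=> t0; rewrite /sqSlob (negbTE t0). Qed.

Lemma sqL2_le_sqSlob d theta u : (sqL2 mu D u <= sqSlob mu D d theta u)%E.
Proof.
have [t0|t0] := eqVneq theta 0; first by rewrite sqSlob0E.
by rewrite sqSlobnE// leeDl// slob_int_ge0.
Qed.

Lemma sqSlob_ge0 d theta u : (0 <= sqSlob mu D d theta u)%E.
Proof. apply: le_trans (sqL2_le_sqSlob _ _ _); exact: sqL2_ge0. Qed.

Lemma sqSlob_L2 d theta u : (sqSlob mu D d theta u < +oo)%E -> inL2 mu D u.
Proof. by apply: le_lt_trans; exact: sqL2_le_sqSlob. Qed.

Lemma slob_int_ae0 p u : ae_eq_on mu D u (fun=> 0) -> slob_int p u = 0%E.
Proof.
move=> u0; rewrite /slob_int -(@integral0 _ _ _ mu (D : set B)).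
apply: integral_ae; apply: aeS (u0) => x + Dx => /(_ Dx) ux.
rewrite -(@integral0 _ _ _ mu (D : set B)).
apply: integral_ae; apply: aeS u0 => y + Dy => /(_ Dy) uy.
by rewrite /slob_kernel ux uy subrr csq0 mul0r.
Qed.

Lemma sqSlob_ae0 d theta u : mfn D u -> ae_eq_on mu D u (fun=> 0) ->
  sqSlob mu D d theta u = 0%E.
Proof.
move=> mu_ u0; have [t0|t0] := eqVneq theta 0.
  by rewrite sqSlob0E// (ae_sqL2_eq0 mD mu_ u0).
by rewrite sqSlobnE// slob_int_ae0// (ae_sqL2_eq0 mD mu_ u0) adde0.
Qed.

Lemma qnorm_sqSlob d theta : qnorm (sqSlob mu D d theta).
Proof.
split; first by move=> u; exact: sqSlob_ge0.
  by apply: sqSlob_ae0; [exact: mfn_cst|exact: ae_eq_refl].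
move=> u v c Nu Nv; have Lu := sqSlob_L2 Nu; have Lv := sqSlob_L2 Nv.
have mu_ := inL2_mfn Lu; have mv := inL2_mfn Lv.
have [t0|t0] := eqVneq theta 0.
  by rewrite !(sqSlob0E _ _ t0); exact: (sqL2_comb mD c Lu Lv).
rewrite !(sqSlobnE _ _ t0).
pose p := d + 2 * theta.
rewrite -/p (ge0_muleDr _ (sqL2_ge0 mu D u) (slob_int_ge0 p u)).
rewrite (ge0_muleDr _ (sqL2_ge0 mu D v) (slob_int_ge0 p v)).
rewrite addeACA; apply: leeD; first exact: (sqL2_comb mD c Lu Lv).
exact: (slob_int_comb p c mu_ mv).
Qed.

(** Passing to a component contracts values and differences. This serves because test functions are
    real while data on Sigma are complex. *)
Lemma sqSlob_Re d theta u : (sqSlob mu D d theta u < +oo)%E ->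
  (sqSlob mu D d theta (fun x => (complex.Re (u x))%:C%C) < +oo)%E /\
  (sqSlob mu D d theta (fun x => (complex.Im (u x))%:C%C) < +oo)%E.
Proof.
move=> Nu; have [m1 m2] := inL2_mfn (sqSlob_L2 Nu).
have le w : mfn D w -> (forall x y, csq (w x - w y) <= csq (u x - u y)) ->
    (forall x, csq (w x) <= csq (u x)) -> (sqSlob mu D d theta w < +oo)%E.
  move=> mw h1 h2; apply: le_lt_trans Nu.
  have h3 : (sqL2 mu D w <= sqL2 mu D u)%E.
    rewrite !sqL2E//; apply: ge0_le_integral_nm => x Dx; rewrite lee_fin ?csq_ge0//.
  have [t0|t0] := eqVneq theta 0; first by rewrite !(sqSlob0E _ _ t0).
  rewrite !(sqSlobnE _ _ t0); apply: leeD => //.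
  apply: ge0_le_integral_nm => x Dx.
    by apply: integral_ge0 => y _; rewrite lee_fin slob_kernel_ge0.
  apply: ge0_le_integral_nm => y Dy; rewrite lee_fin ?slob_kernel_ge0//.
  by rewrite /slob_kernel ler_wpM2r ?invr_ge0 ?powR_ge0.
split; apply: le.
- exact: mfn_real.
- by move=> x y; rewrite -rmorphB csqC /csq CReD CReN lerDl sqr_ge0.
- by move=> x; rewrite csqC /csq lerDl sqr_ge0.
- exact: mfn_real.
- by move=> x y; rewrite -rmorphB csqC /csq CImD CImN lerDr sqr_ge0.
- by move=> x; rewrite csqC /csq lerDr sqr_ge0.
Qed.

(** On a set of diameter at most diam the kernels differ by the factor |x - y|^(2 (theta - theta')),
    which is at most the same power of diam. *)
Lemma sqSlob_mono d theta theta' (diam : R) : 0 < d -> 0 <= theta' <= theta ->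
  (forall x y, D x -> D y -> enorm (x - y) <= diam) -> 1 <= diam ->
  exists2 C : R, 1 <= C & forall u,
    (sqSlob mu D d theta' u <= C%:E * sqSlob mu D d theta u)%E.
Proof.
move=> d0 /andP[t0 tt] hd d1; pose C := diam `^ (2 * (theta - theta')).
have C1 : 1 <= C by rewrite -(powRr0 diam) ler_powR// mulr_ge0// subr_ge0.
exists C => // u.
have C1u (x : \bar R) : (0 <= x)%E -> (x <= C%:E * x)%E.
  by move=> x0; rewrite -[leLHS]mul1e lee_wpmul2r// lee_fin.
have [t0'|t0'] := eqVneq theta' 0.
  rewrite [sqSlob mu D d theta' u]sqSlob0E//.
  apply: le_trans (sqL2_le_sqSlob d theta u) _; apply: C1u; exact: sqSlob_ge0.
have thp : theta != 0.
  by rewrite gt_eqF//; apply: lt_le_trans tt; rewrite lt0r t0' t0.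
(* For non-measurable u the right side is +oo. *)
have [m|nm] := pselect (mfn D u); last first.
  rewrite (_ : sqSlob mu D d theta u = +oo%E).
    by rewrite gt0_muley ?leey// lte_fin (lt_le_trans ltr01).
  rewrite sqSlobnE// /sqL2 asboolF//.
  by rewrite addye// gt_eqF// (lt_le_trans _ (slob_int_ge0 _ _)) ?ltNy0.
rewrite (sqSlobnE _ _ t0') (sqSlobnE _ _ thp).
have C0 : 0 <= C by apply: le_trans C1.
rewrite ge0_muleDr ?sqL2_ge0 ?slob_int_ge0//; apply: leeD.
  by apply: C1u; exact: sqL2_ge0.
have inn0 w p x : (0 <= \int[mu]_(y in (D : set B)) (slob_kernel p w x y)%:E)%E.
  by apply: integral_ge0 => y _; rewrite lee_fin slob_kernel_ge0.
rewrite /slob_int -ge0_integralZl//; [|exact: slob_inner_meas].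
apply: ge0_le_integral_nm => x Dx; first exact: inn0.
rewrite -ge0_integralZl//; first last.
- by move=> y Dy; rewrite lee_fin slob_kernel_ge0.
- by apply/measurable_EFinP; exact: slob_section_meas.
apply: ge0_le_integral_nm => y Dy; first by rewrite lee_fin slob_kernel_ge0.
rewrite -EFinM lee_fin /slob_kernel mulrCA ler_wpM2l ?csq_ge0//.
(* On the diagonal both kernels are 0, a positive power of 0 being 0 and its inverse 0 by
   convention. *)
have [r0|r0] := eqVneq (enorm (x - y)) 0.
  rewrite r0 !powR0 ?invr0 ?mulr0//.
    by rewrite gt_eqF// ltr_pwDl// mulr_ge0// (le_trans t0).
  by rewrite gt_eqF// ltr_pwDl// mulr_ge0.
have rp : 0 < enorm (x - y) by rewrite lt0r r0 sqrtr_ge0.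
rewrite -!powRN.
rewrite (_ : - (d + 2 * theta') = 2 * (theta - theta') + - (d + 2 * theta)); last by ring.
rewrite powRD; last by rewrite r0 implybT.
rewrite ler_wpM2r ?powR_ge0// /C.
apply: ge0_ler_powR => //; rewrite ?nnegrE ?mulr_ge0 ?subr_ge0 ?sqrtr_ge0//.
  exact: le_trans d1.
exact: hd.
Qed.

End Slobodeckij.

(** * Sobolev spaces on open sets and on surfaces *)

Section Sobolev.
Variables (R : realType) (n : nat).
Notation E := 'rV[R]_n.
Notation B := (borelT R n).
Notation F := (fn R n).
Notation meas := {measure set (borelT R n) -> \bar R}.

Lemma L2_bounded_ae (mu : meas) (D : set E) u M : measurable (D : set B) ->
  (mu D < +oo)%E -> mfn D u -> {ae mu, forall x : B, D x -> csq (u x) <= M} ->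
  inL2 mu D u.
Proof.
move=> mD fD mu_ ub; rewrite /inL2 sqL2E//.
pose h x := if csq (u x) <= M then csq (u x) else 0.
rewrite (_ : (\int[mu]_(x in _) _)%E = (\int[mu]_(x in (D : set B)) (h x)%:E)%E); last first.
  by apply: integral_ae; apply: aeS ub => x ux Dx; rewrite /h ux.
apply: (@le_lt_trans _ _ (\int[mu]_(x in (D : set B)) (cst (Num.max 0 M)%:E) x)%E).
  apply: ge0_le_integral_nm => x Dx; rewrite lee_fin /h; case: ifPn => // uM.
  - exact: csq_ge0.
  - by rewrite le_max uM orbT.
  - by rewrite le_max lexx.
by rewrite integral_cst// lte_mul_pinfty// lee_fin le_max lexx.
Qed.

Lemma test_mfn (U D : set E) (f : E -> R) : test_fun U f -> mfn D (fun x => (f x)%:C%C).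
Proof. by move=> [sf _]; apply: mfn_real; apply: continuous_meas; exact: smooth_continuous. Qed.

Lemma L2_test (mu : meas) (U D : set E) (f : E -> R) : measurable (D : set B) ->
  (mu D < +oo)%E -> test_fun U f -> inL2 mu D (fun x => (f x)%:C%C).
Proof.
move=> mD fD tf; have [M HM] := test_bound tf.
apply: (@L2_bounded_ae _ _ _ (M ^+ 2)) => //; first exact: test_mfn tf.
apply: aeW => x _; rewrite csqC -[f x ^+ 2]real_normK ?num_real//.
by rewrite lerXn2r// nnegrE// (le_trans _ (HM x)).
Qed.

Lemma test0 (U : set E) : test_fun U (fun=> 0 : R).
Proof.
split; first exact: smooth_cst.
by exists set0; split => //; exact: compact0.
Qed.

Lemma test_sum (U : set E) (f : 'I_n -> E -> R) : (forall i, test_fun U (f i)) ->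
  test_fun U (fun x => \sum_i f i x).
Proof.
move=> tf; elim: (index_enum _) => [|i s IH].
  by under eq_fun do rewrite big_nil; exact: test0.
by under eq_fun do rewrite big_cons; exact: testD.
Qed.

Definition lapl (f : E -> R) (x : E) : R := \sum_i pderiv i (pderiv i f) x.

Lemma test_lapl U f : test_fun U f -> test_fun U (lapl f).
Proof. by move=> tf; apply: test_sum => i; do 2 apply: test_pderiv. Qed.

Section Weak.
Variables (lam : meas) (U : set E).
Hypothesis oU : open U.
Hypothesis fU : (lam U < +oo)%E.
Let mU : measurable (U : set B) := open_meas oU.

Lemma weak_partial_comb i u g v h c : inL2 lam U u -> inL2 lam U v ->
  weak_partial lam U i u g -> weak_partial lam U i v h ->
  weak_partial lam U i (fun x => u x + c * v x) (fun x => g x + c * h x).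
Proof.
move=> Lu Lv [Lg Hg] [Lh Hh]; split; first exact: (L2_comb mU c Lg Lh).
move=> f tf; rewrite -!/(bil _ _ _ _).
have Ld := L2_test mU fU (test_pderiv i tf); have Lf := L2_test mU fU tf.
rewrite !bil_combl//; move: (Hg f tf) (Hh f tf); rewrite -!/(bil _ _ _ _) => -> ->.
ring.
Qed.

Lemma weak_lap_comb u l v m c : inL2 lam U u -> inL2 lam U v ->
  weak_lap lam U u l -> weak_lap lam U v m ->
  weak_lap lam U (fun x => u x + c * v x) (fun x => l x + c * m x).
Proof.
move=> Lu Lv [Lg Hg] [Lh Hh]; split; first exact: (L2_comb mU c Lg Lh).
move=> f tf; rewrite -!/(bil _ _ _ _).
have Ld := L2_test mU fU (test_lapl tf); have Lf := L2_test mU fU tf.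
rewrite !bil_combl//; move: (Hg f tf) (Hh f tf); rewrite -!/(bil _ _ _ _) => -> ->.
by [].
Qed.

Lemma weak_partial0 i u : ae_eq_on lam U u (fun=> 0) ->
  weak_partial lam U i u (fun=> 0).
Proof.
move=> u0; split; first by rewrite sqL2_0.
move=> f tf; rewrite -!/(bil _ _ _ _).
by rewrite (bil_ae u0 (ae_eq_refl lam U _)) !bil0l// oppr0.
Qed.

Lemma weak_lap0 u : ae_eq_on lam U u (fun=> 0) -> weak_lap lam U u (fun=> 0).
Proof.
move=> u0; split; first by rewrite sqL2_0.
move=> f tf; rewrite -!/(bil _ _ _ _).
by rewrite (bil_ae u0 (ae_eq_refl lam U _)) !bil0l.
Qed.

Lemma sum_qnorm_comb (I : finType) (N : F -> \bar R) (p q : I -> F) c : qnorm N ->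
  (\sum_i N (p i) < +oo)%E -> (\sum_i N (q i) < +oo)%E ->
  (\sum_i N (fun x => p i x + c * q i x)%R <=
   2%:E * (\sum_i N (p i)) + (2 * csq c)%:E * (\sum_i N (q i)))%E.
Proof.
move=> [N0 _ Nc] Hp Hq.
have one (r : I -> F) i : (\sum_i N (r i) < +oo)%E -> (N (r i) < +oo)%E.
  apply: le_lt_trans; rewrite (bigD1 i)//= leeDl//.
  by apply: sume_ge0.
rewrite !ge0_sume_distrr// -big_split/=; apply: lee_sum => i _.
by apply: Nc; exact: one.
Qed.

Lemma qnorm_sqH s : qnorm (sqH lam s U).
Proof.
have qS := qnorm_sqSlob mU fU.
have [s1|s1] := ltP s 1.
  rewrite (_ : sqH lam s U = sqSlob lam U n%:R s); first exact: qS.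
  by apply/funext => u; rewrite /sqH s1.
pose Q (g : 'I_n -> F) := (\sum_(i < n) sqSlob lam U n%:R (s - 1) (g i))%E.
pose W (u : F) (g : 'I_n -> F) := forall i, weak_partial lam U i u (g i).
rewrite (_ : sqH lam s U = fun u => ereal_inf [set (sqL2 lam U u + Q g)%E | g in W u]).
  have [S0 S00 _] := qS n%:R (s - 1).
  apply: (@qnorm_inf _ _ _ (fun c p q i x => p i x + c * q i x) (fun i x => 0)).
  - exact: qnorm_sqL2.
  - by move=> p; apply: sume_ge0.
  - by rewrite /Q big1.
  - by move=> i; apply: weak_partial0; exact: ae_eq_refl.
  - by move=> p q c; exact: sum_qnorm_comb.
  - by move=> u v p q c Lu Lv Wp Wq i; exact: weak_partial_comb.
by apply/funext => u; rewrite /sqH ltNge s1.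
Qed.

Lemma sqL2_le_sqH s u : (sqL2 lam U u <= sqH lam s U u)%E.
Proof.
rewrite /sqH; case: ifP => _; first exact: sqL2_le_sqSlob.
apply: le_ereal_inf_tmp => _ [g _ <-]; rewrite leeDl//.
by apply: sume_ge0 => i _; exact: sqSlob_ge0.
Qed.

Lemma qnorm_sqHDelta s : qnorm (sqHDelta lam s U).
Proof.
apply: (@qnorm_inf _ _ _ (fun c p q x => p x + c * q x) (fun=> 0) _ (sqL2 lam U)
  (fun u => weak_lap lam U u)).
- exact: qnorm_sqH.
- exact: sqL2_ge0.
- exact: sqL2_0.
- by apply: weak_lap0; exact: ae_eq_refl.
- by move=> p q c Lp Lq; exact: sqL2_comb.
- move=> u v p q c Nu Nv; apply: weak_lap_comb.
    by apply: le_lt_trans Nu; exact: sqL2_le_sqH.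
  by apply: le_lt_trans Nv; exact: sqL2_le_sqH.
Qed.

Lemma sqH_le_sqHDelta s u : (sqH lam s U u <= sqHDelta lam s U u)%E.
Proof.
by apply: le_ereal_inf_tmp => _ [l _ <-]; rewrite leeDl// sqL2_ge0.
Qed.

Lemma sqL2_le_sqHDelta s u : (sqL2 lam U u <= sqHDelta lam s U u)%E.
Proof. exact: le_trans (sqL2_le_sqH s u) (sqH_le_sqHDelta s u). Qed.

Lemma in_HDelta_L2 s u : in_HDelta lam s U u -> inL2 lam U u.
Proof. by apply: le_lt_trans; exact: sqL2_le_sqHDelta. Qed.

(** Zero is admissible as weak gradient and as weak Laplacian. Traces being defined by approximation
    in [sqHDelta], this is what makes them independent of the representative. *)
Lemma sqHDelta_ae0 s u : 1 <= s -> mfn U u -> ae_eq_on lam U u (fun=> 0) ->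
  sqHDelta lam s U u = 0%E.
Proof.
move=> s1 mu_ u0; apply/eqP; rewrite eq_le; apply/andP; split; last first.
  by have [h _ _] := qnorm_sqHDelta s; exact: h.
have u00 : sqL2 lam U u = 0%E by exact: ae_sqL2_eq0.
apply: (@le_trans _ _ (sqH lam s U u + sqL2 lam U (fun=> 0%R))%E).
  by apply: ereal_inf_lbound; exists (fun=> 0) => //; exact: weak_lap0.
rewrite sqL2_0 adde0 /sqH ltNge s1/=.
apply: ereal_inf_lbound; exists (fun _ _ => 0).
  by move=> i; exact: weak_partial0.
rewrite u00 add0e big1// => i _.
by have [_ h _] := qnorm_sqSlob mU fU n%:R (s - 1).
Qed.

(* Boundedness of U enters through the comparison of the Slobodeckij kernels. *)
Lemma sqHDelta_mono (s s' diam : R) : (0 < n)%N -> 1 <= s' <= s -> 1 <= diam ->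
  (forall x y, U x -> U y -> enorm (x - y) <= diam) ->
  exists2 C : R, 1 <= C &
    forall u, (sqHDelta lam s' U u <= C%:E * sqHDelta lam s U u)%E.
Proof.
move=> n0 /andP[s1 ss] d1 hd.
have [C C1 HC] : exists2 C : R, 1 <= C & forall u,
    (sqSlob lam U n%:R (s' - 1) u <= C%:E * sqSlob lam U n%:R (s - 1) u)%E.
  apply: (sqSlob_mono mU fU _ _ hd) => //; first by rewrite ltr0n.
  by rewrite subr_ge0 s1 lerD2r.
have C0 : 0 < C by apply: lt_le_trans C1.
have C1u (x : \bar R) : (0 <= x)%E -> (x <= C%:E * x)%E.
  by move=> x0; rewrite -[leLHS]mul1e lee_wpmul2r// lee_fin.
have infs (I : Type) (W : set I) (a b : I -> \bar R) :
    (forall i, W i -> (0 <= b i)%E) -> (forall i, W i -> (a i <= C%:E * b i)%E) ->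
    (ereal_inf [set a i | i in W] <= C%:E * ereal_inf [set b i | i in W])%E.
  move=> b0 ab; rewrite -lee_pdivrMl//; apply: le_ereal_inf_tmp => _ [i Wi <-].
  by rewrite lee_pdivrMl//; apply: le_trans (ab i Wi); apply: ereal_inf_lbound; exists i.
have s1' : 1 <= s by exact: le_trans ss.
have HH u : (sqH lam s' U u <= C%:E * sqH lam s U u)%E.
  rewrite /sqH !ltNge s1 s1'/=; apply: infs => g _.
    by rewrite adde_ge0 ?sqL2_ge0// sume_ge0// => i _; exact: sqSlob_ge0.
  rewrite ge0_muleDr ?sqL2_ge0//; last by apply: sume_ge0 => i _; exact: sqSlob_ge0.
  apply: leeD; first by apply: C1u; exact: sqL2_ge0.
  rewrite ge0_sume_distrr; last by move=> i _; exact: sqSlob_ge0.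
  by apply: lee_sum => i _; exact: HC.
have H0 u : (0 <= sqH lam s U u)%E by have [h _ _] := qnorm_sqH s.
exists C => // u; apply: infs => l _; first by rewrite adde_ge0 ?sqL2_ge0.
rewrite ge0_muleDr ?sqL2_ge0//; apply: leeD; first exact: HH.
by apply: C1u; exact: sqL2_ge0.
Qed.

End Weak.

Section Surface.
Variable S : surface R n.

(** What trace theory takes from a boundary: a compact carrier, which makes continuous functions
    square-integrable, and a measurable unit normal, which makes fluxes square-integrable. *)
Definition regular_surface : Prop := exists K : set E,
  [/\ compact K, area S (~` K) = 0%E,
      forall i, measurable_fun setT (fun x : B => unormal S x 0 i)
    & {ae (area S), forall x, enorm (unormal S x) = 1}].

Hypothesis regS : regular_surface.
Local Notation L2S := (inL2 (area S) setT).

Lemma area_fin : (area S setT < +oo)%E.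
Proof. by rewrite ltey_eq fin_num_measure. Qed.

Lemma coord_le_enorm (x : E) i : (x 0 i) ^+ 2 <= enorm x ^+ 2.
Proof.
have p : 0 <= dotp x x by apply: sumr_ge0 => j _; rewrite -expr2 sqr_ge0.
rewrite /enorm sqr_sqrtr// /dotp (bigD1 i)//= -expr2 lerDl.
by apply: sumr_ge0 => j _; rewrite -expr2 sqr_ge0.
Qed.

Lemma L2S_continuous (f : E -> R) : continuous f -> L2S (fun x => (f x)%:C%C).
Proof.
have [K [cK K0 _ _]] := regS => cf; have [M HM] := compact_bound cK cf.
apply: (@L2_bounded_ae _ _ _ (M ^+ 2)) => //.
- exact: area_fin.
- by apply: mfn_real; exact: continuous_meas.
exists (~` K); split => //.
  by apply: measurableC; apply: closed_meas; exact: compact_closedE.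
move=> x /= Hx Kx; apply: Hx => _; rewrite csqC -[f x ^+ 2]real_normK ?num_real//.
by rewrite lerXn2r// ?nnegrE ?(le_trans _ (HM x Kx))// HM.
Qed.

Lemma L2S_normal i u : L2S u -> L2S (fun x => (unormal S x 0 i)%:C%C * u x).
Proof.
have [K [_ _ mn un]] := regS => Lu.
have m := mfnM (mfn_real (mn i)) (inL2_mfn Lu).
apply: (@le_lt_trans _ _ (sqL2 (area S) setT u)) => //.
rewrite !sqL2E//; last exact: inL2_mfn Lu.
apply: ge0_ae_le_integral => [x|x|]; rewrite ?lee_fin ?csq_ge0//.
apply: aeS un => x h; rewrite lee_fin csqM csqC.
rewrite -[leRHS]mul1r ler_wpM2r ?csq_ge0//.
by apply: le_trans (coord_le_enorm _ i) _; rewrite h expr1n.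
Qed.

Lemma weak_tangential_comb i j u g v h c : L2S u -> L2S v ->
  weak_tangential S i j u g -> weak_tangential S i j v h ->
  weak_tangential S i j (fun x => u x + c * v x) (fun x => g x + c * h x).
Proof.
move=> Lu Lv [Lg Hg] [Lh Hh].
split; first exact: (L2_comb (@measurableT _ B) c Lg Lh).
move=> f tf; rewrite -!/(bil _ _ _ _).
have Lf : L2S (fun x => (f x)%:C%C) by apply: L2S_continuous; apply: smooth_continuous; case: tf.
have Ln k l : L2S (fun x => (unormal S x 0 k)%:C%C * (pderiv l f x)%:C%C).
  apply: L2S_normal; apply: L2S_continuous; apply: smooth_continuous.
  by apply: smooth_pderiv; case: tf.
have Ld : L2S (fun x => (unormal S x 0 i * pderiv j f x - unormal S x 0 j * pderiv i f x)%:C%C).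
  have := L2B (@measurableT _ B) (Ln i j) (Ln j i).
  by under eq_fun do rewrite -!rmorphM -rmorphB.
rewrite !bil_combl//; move: (Hg f tf) (Hh f tf); rewrite -!/(bil _ _ _ _) => -> ->.
ring.
Qed.

Lemma weak_tangential0 i j : weak_tangential S i j (fun=> 0) (fun=> 0).
Proof.
split; first by rewrite sqL2_0.
by move=> f tf; rewrite -!/(bil _ _ _ _) !bil0l// oppr0.
Qed.

Lemma qnorm_sqHb t : qnorm (sqHb S t).
Proof.
have qS := qnorm_sqSlob (@measurableT _ B) area_fin.
have qL := qnorm_sqL2 (area S) (@measurableT _ B).
have [t1|t1] := ltP t 1.
  rewrite (_ : sqHb S t = sqSlob (area S) setT n.-1%:R t); first exact: qS.
  by apply/funext => u; rewrite /sqHb t1.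
pose Q (g : 'I_n -> 'I_n -> F) := (\sum_(i < n) \sum_(j < n) sqL2 (area S) setT (g i j))%E.
pose W (u : F) (g : 'I_n -> 'I_n -> F) := forall i j, weak_tangential S i j u (g i j).
rewrite (_ : sqHb S t = fun u => ereal_inf [set (sqL2 (area S) setT u + Q g)%E | g in W u]).
  apply: (@qnorm_inf _ _ _ (fun c p q i j x => p i j x + c * q i j x) (fun i j x => 0)).
  - exact: qL.
  - by move=> p; apply: sume_ge0 => i _; apply: sume_ge0 => j _; exact: sqL2_ge0.
  - by rewrite /Q big1// => i _; rewrite big1// => j _; exact: sqL2_0.
  - by move=> i j; exact: weak_tangential0.
  - move=> p q c; rewrite /Q !pair_big/= => Hp Hq.
    exact: (@sum_qnorm_comb _ _ (fun z => p z.1 z.2) (fun z => q z.1 z.2) c qL).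
  - by move=> u v p q c Lu Lv Wp Wq i j; exact: weak_tangential_comb.
by apply/funext => u; rewrite /sqHb ltNge t1.
Qed.

Lemma sqL2_le_sqHb t u : (sqL2 (area S) setT u <= sqHb S t u)%E.
Proof.
rewrite /sqHb; case: ifP => _; first exact: sqL2_le_sqSlob.
apply: le_ereal_inf_tmp => _ [g _ <-]; rewrite leeDl//.
by apply: sume_ge0 => i _; apply: sume_ge0 => j _; exact: sqL2_ge0.
Qed.

Lemma in_Hb_L2 t u : in_Hb S t u -> L2S u.
Proof. by apply: le_lt_trans; exact: sqL2_le_sqHb. Qed.

Lemma in_Hb_comb t u v c : in_Hb S t u -> in_Hb S t v ->
  in_Hb S t (fun x => u x + c * v x).
Proof. by move=> hu hv; apply: qnorm_lt_pinfty => //; exact: qnorm_sqHb. Qed.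

Lemma in_Hb0 t : in_Hb S t (fun=> 0).
Proof. by have [_ h _] := qnorm_sqHb t; rewrite /in_Hb h. Qed.

Lemma csmooth_cont v : csmooth v -> L2S v.
Proof.
move=> [sr si]; have Lr := L2S_continuous (smooth_continuous sr).
have Li := L2S_continuous (smooth_continuous si).
have := L2_comb (@measurableT _ B) ('i)%C Lr Li.
by under eq_fun do rewrite -complexE.
Qed.

Definition flux (eps : R) (v : F) : F := fun x =>
  (eps%:C)%C * \sum_i ((unormal S x 0 i)%:C)%C * cpartial i v x.

Lemma L2S_flux eps v : csmooth v -> L2S (flux eps v).
Proof.
move=> [sr si]; apply: L2Z => //.
elim: (index_enum _) => [|i s IH].
  by under eq_fun do rewrite big_nil; exact: L2_0.
under eq_fun do rewrite big_cons; apply: L2D => //; apply: L2S_normal.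
by apply: csmooth_cont; split; exact: smooth_pderiv.
Qed.

End Surface.
End Sobolev.

Local Opaque sqHDelta sqHb sqH sqL2 sqSlob cintegral.
(** * Traces *)

Section Traces.
Variables (R : realType) (n : nat).
Notation E := 'rV[R]_n.
Notation B := (borelT R n).
Notation F := (fn R n).
Notation meas := {measure set (borelT R n) -> \bar R}.

Lemma ecvg0P (N : nat -> \bar R) : (forall k, (0 <= N k)%E) ->
  ((N k @[k --> \oo] --> 0)%E <->
   forall e : R, 0 < e -> \forall k \near \oo, (N k <= e%:E)%E).
Proof.
move=> N0; split.
  move=> /fine_cvgP[fN cN] e e0.
  move/cvgrPdist_lt : cN => /(_ e e0); apply: filterS2 fN => k fk.
  rewrite sub0r normrN => h.
  by rewrite -(fineK fk) lee_fin; apply: le_trans (ltW h); exact: ler_norm.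
move=> H; apply/fine_cvgP; split.
  have := H 1 ltr01; apply: filterS => k h.
  by rewrite ge0_fin_numE//; apply: le_lt_trans h (ltry _).
apply/cvgrPdist_le => e e0; have := H e e0; apply: filterS => k h.
have fk : N k \is a fin_num by rewrite ge0_fin_numE//; apply: le_lt_trans h (ltry _).
rewrite sub0r normrN ger0_norm ?fine_ge0//.
by rewrite -lee_fin fineK.
Qed.

Definition null_seq (N : F -> \bar R) (u : nat -> F) : Prop :=
  (N (u k) @[k --> \oo] --> 0)%E.

Lemma null_seqP N u : qnorm N -> null_seq N u <->
  forall e : R, 0 < e -> \forall k \near \oo, (N (u k) <= e%:E)%E.
Proof. by move=> [N0 _ _]; exact: ecvg0P. Qed.

Lemma null_seq_comb N u v c : qnorm N -> null_seq N u -> null_seq N v ->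
  null_seq N (fun k x => u k x + c * v k x).
Proof.
move=> qN /(null_seqP _ qN) Hu /(null_seqP _ qN) Hv; apply/(null_seqP _ qN) => e e0.
have [N0 _ Nc] := qN.
have c0 := csq_ge0 c; have p : 0 < 4 * csq c + 1 by lra.
have := Hu (e / 4) _; rewrite divr_gt0// => /(_ isT) h1.
have := Hv (e / (4 * csq c + 1)) _; rewrite divr_gt0// => /(_ isT) h2.
apply: filterS2 h1 h2 => k h1 h2.
apply: le_trans (Nc _ _ c (le_lt_trans h1 (ltry _)) (le_lt_trans h2 (ltry _))) _.
apply: le_trans (leeD (lee_wpmul2l _ h1) (lee_wpmul2l _ h2)) _.
- by rewrite lee_fin.
- by rewrite lee_fin mulr_ge0.
rewrite -!EFinM -EFinD lee_fin.
have : (4 * csq c + 1) * (e / (4 * csq c + 1)) = e by rewrite mulrC divfK// gt_eqF.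
have : 0 < e / (4 * csq c + 1) by rewrite divr_gt0.
set d := e / _; move=> d0 h; lra.
Qed.

Lemma eq_null_seq N u v : (forall k x, u k x = v k x) -> null_seq N u -> null_seq N v.
Proof. by move=> uv; rewrite (_ : u = v)//; apply/funext => k; apply/funext => x. Qed.

Lemma null_seq_cst N w : qnorm N -> N w = 0%E -> null_seq N (fun=> w).
Proof.
by move=> qN w0; apply/(null_seqP _ qN) => e e0; apply: nearW => k; rewrite w0 lee_fin ltW.
Qed.

Lemma null_seq_shift N u w : qnorm N -> N w = 0%E -> null_seq N u ->
  null_seq N (fun k x => u k x + w x).
Proof.
move=> qN w0 Hu; apply: (eq_null_seq _ (null_seq_comb 1 qN Hu (null_seq_cst qN w0))).
by move=> k x; rewrite mul1r.
Qed.

Lemma eq_smooth (f g : E -> R) : (forall x, f x = g x) -> smooth_fun f -> smooth_fun g.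
Proof. by move=> fg; rewrite (_ : f = g)//; apply/funext. Qed.

Lemma csmooth_comb u v c : @csmooth R n u -> csmooth v ->
  csmooth (fun x => u x + c * v x).
Proof.
move=> [u1 u2] [v1 v2]; split.
  apply: (eq_smooth _ (smoothD u1 (smoothD (smoothZ (complex.Re c) v1)
    (smoothZ (- complex.Im c) v2)))) => x.
  by rewrite CReD CReM mulNr.
apply: (eq_smooth _ (smoothD u2 (smoothD (smoothZ (complex.Re c) v2)
  (smoothZ (complex.Im c) v1)))) => x.
by rewrite CImD CImM.
Qed.

Section OneSurface.
Variables (lam : meas) (U : set E) (S : surface R n) (s : R).
Hypothesis oU : open U.
Hypothesis fU : (lam U < +oo)%E.
Hypothesis regS : regular_surface S.
Let mU : measurable (U : set B) := open_meas oU.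
Let qH := qnorm_sqHDelta oU fU s.
Let qHb t := qnorm_sqHb regS t.
Local Notation Ltwo := (inL2 (area S) setT).

Lemma dtraceP u phi : is_dirichlet_trace lam s U S u phi <->
  exists v : nat -> F, [/\ forall k, csmooth (v k),
    null_seq (sqHDelta lam s U) (fun k => fsub (v k) u)
  & null_seq (sqHb S (s - 1 / 2)) (fun k => fsub (v k) phi)].
Proof. by []. Qed.

Lemma dtrace_comb u v phi psi c :
  is_dirichlet_trace lam s U S u phi -> is_dirichlet_trace lam s U S v psi ->
  is_dirichlet_trace lam s U S (fun x => u x + c * v x) (fun x => phi x + c * psi x).
Proof.
move=> /dtraceP[u_ [su Hu hu]] /dtraceP[v_ [sv Hv hv]]; apply/dtraceP.
exists (fun k x => u_ k x + c * v_ k x); split.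
- by move=> k; exact: csmooth_comb.
- by apply: (eq_null_seq _ (null_seq_comb c qH Hu Hv)) => k x; rewrite /fsub; ring.
- by apply: (eq_null_seq _ (null_seq_comb c (qHb _) hu hv)) => k x; rewrite /fsub; ring.
Qed.

Lemma fsub_self (u : F) : fsub u u = fun=> 0.
Proof. by apply/funext => x; rewrite /fsub subrr. Qed.

Lemma dtrace_smooth v : csmooth v -> is_dirichlet_trace lam s U S v v.
Proof.
move=> sv; apply/dtraceP; exists (fun=> v); split => //; rewrite fsub_self.
  by apply: null_seq_cst => //; case: qH.
by apply: null_seq_cst => //; case: (qHb (s - 1 / 2)).
Qed.

Hypothesis dtb : dirichlet_trace_bounded lam s U S.

Lemma dtrace_bound u phi : in_HDelta lam s U u -> is_dirichlet_trace lam s U S u phi ->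
  in_Hb S (s - 1 / 2) phi.
Proof.
move=> hu tu; have [_ [C HC]] := dtb.
apply: le_lt_trans (HC u phi hu tu) _.
have [h _ _] := qH; move: hu; rewrite /in_HDelta -ge0_fin_numE// => /fineK <-.
by rewrite -EFinM ltry.
Qed.

Lemma dtrace_null u phi : sqHDelta lam s U u = 0%E ->
  is_dirichlet_trace lam s U S u phi -> ae_eq_on (area S) setT phi (fun=> 0).
Proof.
move=> u0 tu; have [_ [C HC]] := dtb.
have hu : in_HDelta lam s U u by rewrite /in_HDelta u0.
have := HC u phi hu tu; rewrite u0 mule0 => h.
apply: sqL2_eq0_ae => //; apply/eqP; rewrite eq_le sqL2_ge0 andbT.
by apply: le_trans h; exact: sqL2_le_sqHb.
Qed.

(** The difference of the traces is a trace of u - v, hence null by boundedness. With u = v this is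
    uniqueness of the trace, so the value picked by [dirichlet_trace] is determined up to a null
    set. *)
Lemma dtrace_ae u v phi psi : sqHDelta lam s U (fsub u v) = 0%E ->
  is_dirichlet_trace lam s U S u phi -> is_dirichlet_trace lam s U S v psi ->
  ae_eq_on (area S) setT phi psi.
Proof.
move=> uv tu tv; have t := dtrace_comb (-1) tu tv.
have : ae_eq_on (area S) setT (fun x => phi x + -1 * psi x) (fun=> 0).
  apply: dtrace_null t; rewrite -[RHS]uv; congr sqHDelta.
  by apply/funext => x; rewrite /fsub; ring.
apply: aeS => x h Dx; have := h Dx.
by rewrite mulN1r => /eqP; rewrite subr_eq0 => /eqP.
Qed.

Lemma gammaD_spec u : in_HDelta lam s U u ->
  is_dirichlet_trace lam s U S u (dirichlet_trace lam s U S u).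
Proof. by move=> hu; have [ex _] := dtb; have := xgetPex (fun=> 0) (ex u hu). Qed.

Lemma gammaD_ae u v phi : in_HDelta lam s U u -> sqHDelta lam s U (fsub u v) = 0%E ->
  is_dirichlet_trace lam s U S v phi ->
  ae_eq_on (area S) setT (dirichlet_trace lam s U S u) phi.
Proof. by move=> hu uv tv; apply: dtrace_ae uv _ tv; exact: gammaD_spec. Qed.

Lemma fsubuu (u : F) : sqHDelta lam s U (fsub u u) = 0%E.
Proof.
by have [_ h _] := qH; rewrite fsub_self h.
Qed.

Lemma gammaD_in_Hb u : in_HDelta lam s U u -> in_Hb S (s - 1 / 2) (dirichlet_trace lam s U S u).
Proof. by move=> hu; exact: dtrace_bound hu (gammaD_spec hu). Qed.

Lemma in_HDelta_comb u v c : in_HDelta lam s U u -> in_HDelta lam s U v ->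
  in_HDelta lam s U (fun x => u x + c * v x).
Proof. by move=> hu hv; exact: qnorm_lt_pinfty qH hu hv. Qed.

Lemma in_HDelta_transfer u v : sqHDelta lam s U (fsub u v) = 0%E ->
  in_HDelta lam s U u -> in_HDelta lam s U v.
Proof.
move=> uv hu; have h : in_HDelta lam s U (fsub u v) by rewrite /in_HDelta uv.
have := in_HDelta_comb (-1) hu h; rewrite (_ : (fun x => _) = v)//.
by apply/funext => x; rewrite /fsub; ring.
Qed.

Lemma gammaD_comb u v c : in_HDelta lam s U u -> in_HDelta lam s U v ->
  ae_eq_on (area S) setT (dirichlet_trace lam s U S (fun x => u x + c * v x))
    (fun x => dirichlet_trace lam s U S u x + c * dirichlet_trace lam s U S v x).
Proof.
move=> hu hv; apply: gammaD_ae (fsubuu _) _; first exact: in_HDelta_comb.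
by apply: dtrace_comb; exact: gammaD_spec.
Qed.

Lemma gammaD_cong u v : in_HDelta lam s U u -> sqHDelta lam s U (fsub u v) = 0%E ->
  ae_eq_on (area S) setT (dirichlet_trace lam s U S u) (dirichlet_trace lam s U S v).
Proof.
move=> hu uv; apply: (gammaD_ae hu uv); apply: gammaD_spec.
exact: in_HDelta_transfer uv hu.
Qed.

(** Boundedness applied to [v k] - u. The definition of the trace supplies some approximating
    sequence; here any smooth one will do, so that one sequence can serve two traces or two
    orders. *)
Lemma dtrace_L2_approx u (v : nat -> F) : in_HDelta lam s U u ->
  (forall k, csmooth (v k)) -> null_seq (sqHDelta lam s U) (fun k => fsub (v k) u) ->
  null_seq (sqHb S (s - 1 / 2)) (fun k => fsub (v k) (dirichlet_trace lam s U S u)).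
Proof.
move=> hu sv; have [_ [C HC]] := dtb; move/(null_seqP _ qH) => H.
apply/(null_seqP _ (qHb _)) => e e0; have tu := gammaD_spec hu.
have p : 0 < e / (`|C| + 1) by rewrite divr_gt0// ltr_wpDl.
apply: filterS (H _ p) => k hk.
have t := dtrace_comb (-1) (dtrace_smooth (sv k)) tu.
have e1 : (fun x => v k x + -1 * u x) = fsub (v k) u.
  by apply/funext => x; rewrite /fsub mulN1r.
have e2 : (fun x => v k x + -1 * dirichlet_trace lam s U S u x) =
    fsub (v k) (dirichlet_trace lam s U S u).
  by apply/funext => x; rewrite /fsub mulN1r.
rewrite e1 e2 in t.
apply: le_trans (HC _ _ (le_lt_trans hk (ltry _)) t) _.
have [h0 _ _] := qH.
apply: (@le_trans _ _ ((`|C| + 1)%:E * sqHDelta lam s U (fsub (v k) u))%E).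
  apply: lee_wpmul2r => //; rewrite lee_fin; apply: le_trans (ler_norm _) _.
  by rewrite lerDl.
apply: (@le_trans _ _ ((`|C| + 1)%:E * (e / (`|C| + 1))%:E)%E).
  by apply: lee_wpmul2l => //; rewrite lee_fin addr_ge0.
by rewrite -EFinM lee_fin mulrC divfK// gt_eqF// ltr_wpDl.
Qed.

Section Neumann.
Variable eps : R.
Local Notation t := (3 / 2 - s).

Lemma flux_pair_comb u v c phi : csmooth u -> csmooth v -> Ltwo phi ->
  surf_pair S (flux S eps (fun x => u x + c * v x)) phi =
  surf_pair S (flux S eps u) phi + c * surf_pair S (flux S eps v) phi.
Proof.
move=> su sv Lp; rewrite /surf_pair -!/(bil _ _ _ _).
rewrite (_ : flux S eps (fun x => u x + c * v x) =
   (fun x => flux S eps u x + c * flux S eps v x)).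
  by rewrite bil_combl//; exact: L2S_flux.
apply/funext => x; rewrite /flux mulrCA -mulrDr; congr (_ * _).
rewrite mulr_sumr -big_split/=; apply: eq_bigr => i _.
rewrite mulrCA -mulrDr; congr (_ * _).
have [u1 u2] := su; have [v1 v2] := sv.
have D3 (a b d : E -> R) (r r' : R) : smooth_fun a -> smooth_fun b -> smooth_fun d ->
    pderiv i (fun y => a y + (r * b y + r' * d y)) x =
    pderiv i a x + (r * pderiv i b x + r' * pderiv i d x).
  move=> sa sb sd; rewrite pderivD//; last by apply: smoothD; exact: smoothZ.
  by rewrite pderivD; [rewrite !pderivZ|exact: smoothZ|exact: smoothZ].
rewrite /cpartial; apply: eq_CReIm.
  rewrite CReD CReM /= -mulNr -D3//; congr (pderiv i _ x).
  by apply/funext => y; rewrite CReD CReM mulNr.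
rewrite CImD CImM /= -D3//; congr (pderiv i _ x).
by apply/funext => y; rewrite CImD CImM.
Qed.

Lemma ntraceP u T : is_neumann_trace lam s U S eps u T <->
  exists v : nat -> F, [/\ forall k, csmooth (v k),
    null_seq (sqHDelta lam s U) (fun k => fsub (v k) u)
  & forall e : R, 0 < e -> \forall k \near \oo, forall phi, in_Hb S t phi ->
      ((csq (surf_pair S (flux S eps (v k)) phi - T phi))%:E <= e%:E * sqHb S t phi)%E].
Proof. by []. Qed.

Lemma ntrace_comb u v T T' c :
  is_neumann_trace lam s U S eps u T -> is_neumann_trace lam s U S eps v T' ->
  is_neumann_trace lam s U S eps (fun x => u x + c * v x)
    (fun phi => T phi + c * T' phi).
Proof.
move=> /ntraceP[u_ [su Hu hu]] /ntraceP[v_ [sv Hv hv]]; apply/ntraceP.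
exists (fun k x => u_ k x + c * v_ k x); split.
- by move=> k; exact: csmooth_comb.
- by apply: (eq_null_seq _ (null_seq_comb c qH Hu Hv)) => k x; rewrite /fsub; ring.
- move=> e e0.
  have c0 := csq_ge0 c; have p : 0 < 4 * csq c + 1 by lra.
  have e1 : 0 < e / 4 by rewrite divr_gt0.
  have e2 : 0 < e / (4 * csq c + 1) by rewrite divr_gt0.
  apply: filterS2 (hu _ e1) (hv _ e2) => k h1 h2 phi hphi.
  have := h1 phi hphi; have := h2 phi hphi.
  rewrite flux_pair_comb//; last exact: in_Hb_L2 hphi.
  have [hb0 _ _] := qHb t.
  move: hphi; rewrite /in_Hb -ge0_fin_numE// => /fineK <-.
  rewrite -!EFinM !lee_fin.
  set a := surf_pair S (flux S eps (u_ k)) phi; set b := surf_pair S (flux S eps (v_ k)) phi.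
  set N := fine _ => h3 h4.
  have N0 : 0 <= N by rewrite fine_ge0.
  rewrite (_ : _ - _ = (a - T phi) + c * (b - T' phi)); last by ring.
  apply: le_trans (csqD_le _ _) _; rewrite csqM.
  have : (4 * csq c + 1) * (e / (4 * csq c + 1)) = e by rewrite mulrC divfK// gt_eqF.
  move: e2 h3; set d := e / (_ + 1); move=> e2 h3 hd.
  have : csq c * csq (b - T' phi) <= csq c * (d * N) by rewrite ler_wpM2l.
  have : 0 <= d * N by rewrite mulr_ge0// ltW.
  move: h4; set X := csq _; set Y := csq (b - _); set Z := csq c.
  have : (4 * Z + 1) * d * N = e * N by rewrite hd.
  lra.
Qed.

Lemma ntrace_transfer u v T : sqHDelta lam s U (fsub u v) = 0%E ->
  is_neumann_trace lam s U S eps u T -> is_neumann_trace lam s U S eps v T.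
Proof.
move=> uv /ntraceP[u_ [su Hu hu]]; apply/ntraceP; exists u_; split; [exact: su| |exact: hu].
by apply: (eq_null_seq _ (null_seq_shift qH uv Hu)) => k x; rewrite /fsub; ring.
Qed.

Lemma fsubC0 u v : sqHDelta lam s U (fsub u v) = 0%E -> sqHDelta lam s U (fsub v u) = 0%E.
Proof.
have [h0 h1 hc] := qH => uv; apply/eqP; rewrite eq_le h0 andbT.
have := hc (fun=> 0) (fsub u v) (-1); rewrite h1 uv !mule0 adde0.
rewrite (_ : (fun x => _) = fsub v u); first by apply.
by apply/funext => x; rewrite /fsub; ring.
Qed.

Lemma gammaN_cong u v : sqHDelta lam s U (fsub u v) = 0%E ->
  neumann_trace lam s U S eps u = neumann_trace lam s U S eps v.
Proof.
move=> uv; rewrite /neumann_trace.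
suff -> : is_neumann_trace lam s U S eps u = is_neumann_trace lam s U S eps v by [].
apply/funext => T; apply/propext; split; first exact: ntrace_transfer uv.
exact: ntrace_transfer (fsubC0 uv).
Qed.

Lemma csq_small (a : R[i]) (N : R) : (forall e : R, 0 < e -> csq a <= e * N) -> a = 0.
Proof.
move=> h; apply: csq_eq0; apply/eqP; rewrite eq_le csq_ge0 andbT.
have [N0|N0] := leP N 0.
  by have := h 1 ltr01; rewrite mul1r => h1; exact: le_trans h1 N0.
apply/ler_addgt0Pr => e e0; rewrite add0r.
by have := h (e / N) (divr_gt0 e0 N0); rewrite divfK// gt_eqF.
Qed.

(** T is a priori an arbitrary map; it inherits linearity on H^t(S) from the fluxes that approximate
    it. *)
Lemma ntrace_linear u T phi psi c : is_neumann_trace lam s U S eps u T ->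
  in_Hb S t phi -> in_Hb S t psi ->
  T (fun x => phi x + c * psi x) = T phi + c * T psi.
Proof.
move=> /ntraceP[v [sv Hv hv]] hphi hpsi; have hc := in_Hb_comb regS c hphi hpsi.
have [hb0 _ _] := qHb t.
have fp : sqHb S t phi \is a fin_num by rewrite ge0_fin_numE.
have fq : sqHb S t psi \is a fin_num by rewrite ge0_fin_numE.
have fc : sqHb S t (fun x => phi x + c * psi x) \is a fin_num by rewrite ge0_fin_numE.
apply/eqP; rewrite -subr_eq0; apply/eqP.
set Nc := fine (sqHb S t (fun x => phi x + c * psi x)).
apply: (@csq_small _ (2 * Nc + 2 * (2 * fine (sqHb S t phi) +
   2 * (csq c * fine (sqHb S t psi))))) => e e0.
have [k _ /(_ k (leqnn k)) H] := hv e e0.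
have h1 := H _ hc; have h2 := H _ hpsi; have h3 := H _ hphi.
rewrite -(fineK fc) -EFinM lee_fin -/Nc in h1.
rewrite -(fineK fq) -EFinM lee_fin in h2; rewrite -(fineK fp) -EFinM lee_fin in h3.
move: h1 h2 h3; rewrite /surf_pair -!/(bil _ _ _ _) bil_combr//; first last.
- exact: in_Hb_L2 hpsi.
- exact: in_Hb_L2 hphi.
- exact: L2S_flux.
set a := bil _ _ _ phi; set b := bil _ _ _ psi.
set M := fine (sqHb S t psi); set N := fine (sqHb S t phi) => h1 h2 h3.
set X := T (fun x => _).
(* The defect of linearity of T becomes three approximation errors, since the flux pairing itself is
   linear. *)
rewrite (_ : X - _ = - (a + c * b - X) + ((a - T phi) + c * (b - T psi))); last by ring.
apply: le_trans (csqD_le _ _) _; rewrite csqN.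
have h4 := csqD_le (a - T phi) (c * (b - T psi)); rewrite csqM in h4.
have h5 : csq c * csq (b - T psi) <= csq c * (e * M) by rewrite ler_wpM2l ?csq_ge0.
lra.
Qed.

Hypothesis ntb : neumann_trace_bounded lam s U S eps.

Lemma gammaN_spec u : in_HDelta lam s U u ->
  is_neumann_trace lam s U S eps u (neumann_trace lam s U S eps u).
Proof. by move=> hu; have [ex _] := ntb; have := xgetPex (fun=> 0) (ex u hu). Qed.

Lemma ntrace_unique u v T T' : sqHDelta lam s U (fsub u v) = 0%E ->
  is_neumann_trace lam s U S eps u T -> is_neumann_trace lam s U S eps v T' ->
  dual_eq S t T T'.
Proof.
move=> uv tu tv phi hphi; have tc := ntrace_comb (-1) tu tv.
have [_ [C HC]] := ntb.
have e : (fun x => u x + -1 * v x) = fsub u v by apply/funext => x; rewrite /fsub mulN1r.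
rewrite e in tc; have := HC _ _ phi _ tc hphi.
rewrite /in_HDelta uv => /(_ (ltry _)).
rewrite mul0e mule0 lee_fin => h.
have /csq_eq0 : csq (T phi + -1 * T' phi) = 0 by apply/eqP; rewrite eq_le h csq_ge0.
by rewrite mulN1r => /eqP; rewrite subr_eq0 => /eqP.
Qed.

Lemma gammaN_comb u v c : in_HDelta lam s U u -> in_HDelta lam s U v ->
  dual_eq S t (neumann_trace lam s U S eps (fun x => u x + c * v x))
    (fun phi => neumann_trace lam s U S eps u phi + c * neumann_trace lam s U S eps v phi).
Proof.
move=> hu hv; apply: ntrace_unique (fsubuu _) _ _.
  by apply: gammaN_spec; exact: in_HDelta_comb.
by apply: ntrace_comb; exact: gammaN_spec.
Qed.

Lemma gammaN_linear u phi psi c : in_HDelta lam s U u ->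
  in_Hb S t phi -> in_Hb S t psi ->
  neumann_trace lam s U S eps u (fun x => phi x + c * psi x) =
  neumann_trace lam s U S eps u phi + c * neumann_trace lam s U S eps u psi.
Proof. by move=> hu; apply: ntrace_linear; exact: gammaN_spec. Qed.

Lemma gammaN_bound u : in_HDelta lam s U u -> exists C : R, forall phi, in_Hb S t phi ->
  csq (neumann_trace lam s U S eps u phi) <= C * fine (sqHb S t phi).
Proof.
move=> hu; have [_ [C HC]] := ntb.
exists (C * fine (sqHDelta lam s U u)) => phi hphi.
have := HC _ _ phi hu (gammaN_spec hu) hphi.
have [hb0 _ _] := qHb t; have [h0 _ _] := qH.
move: hphi; rewrite /in_Hb -ge0_fin_numE// => /fineK <-.
move: hu; rewrite /in_HDelta -ge0_fin_numE// => /fineK <-.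
by rewrite -!EFinM lee_fin mulrA.
Qed.

End Neumann.
End OneSurface.
End Traces.

Local Transparent sqHDelta sqHb sqH sqL2 sqSlob cintegral.

(** * Lebesgue measure of a Lipschitz boundary *)

Section LebesgueMeasure.
Variables (R : realType) (n : nat).
Notation E := 'rV[R]_n.
Notation B := (borelT R n).
Notation F := (fn R n).
Notation meas := {measure set (borelT R n) -> \bar R}.

Definition obox (a b : E) : set E := [set x | forall i, a 0 i < x 0 i <= b 0 i].

Lemma obox_meas a b : measurable (obox a b : set B).
Proof.
rewrite (_ : obox a b = \bigcap_(i in [set: 'I_n]) [set x : E | a 0 i < x 0 i <= b 0 i]).
  apply: fin_bigcap_measurable => // i _.
  rewrite -[X in measurable X]setTI.
  have := @coord_meas R n i measurableT _ (measurable_itv `]a 0 i, b 0 i]).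
  by congr measurable; apply/seteqP; split => x /=; rewrite in_itv.
by apply/seteqP; split => x /= H i; [move=> _; exact: H|exact: H].
Qed.

Lemma obox_setI : setI_closed (range (fun p : E * E => obox p.1 p.2)).
Proof.
move=> _ _ [[a b] _ <-] [[c d] _ <-] /=.
exists (\row_i Num.max (a 0 i) (c 0 i), \row_i Num.min (b 0 i) (d 0 i)) => //.
apply/seteqP; split => x /=; rewrite /obox /=.
  by move=> H; split => i; have := H i; rewrite !mxE gt_max le_min
      => /andP[/andP[h1 h2] /andP[h3 h4]]; apply/andP.
by move=> [H K] i; rewrite !mxE gt_max le_min; move: (H i) (K i) => /andP[-> ->] /andP[-> ->].
Qed.

Lemma open_obox (U : set E) : open U -> forall x, U x ->
  exists p : 'rV[rat]_n * 'rV[rat]_n,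
    let Q := obox (map_mx ratr p.1) (map_mx ratr p.2) in Q x /\ Q `<=` U.
Proof.
move=> oU x Ux; have : nbhs x U by apply: open_nbhs_nbhs.
move=> /nbhs_ballP[e /= e0 He].
have /choice[a Ha] : forall i, exists q : rat, ratr q \in `](x 0 i - e), (x 0 i)[.
  by move=> i; apply: rat_in_itvoo; rewrite ltrBlDr ltrDl.
have /choice[b Hb] : forall i, exists q : rat, ratr q \in `](x 0 i), (x 0 i + e)[.
  by move=> i; apply: rat_in_itvoo; rewrite ltrDl.
exists (\row_i a i, \row_i b i); split => /=.
  move=> i; rewrite !mxE; have := Ha i; have := Hb i; rewrite !in_itv/=.
  by move=> /andP[h1 _] /andP[_ h2]; rewrite h2 ltW.
move=> y Hy; apply: He; split => // i j; rewrite (ord1 i) /ball /=.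
have := Hy j; have := Ha j; have := Hb j; rewrite !mxE !in_itv/=.
move=> /andP[h1 h2] /andP[h3 h4] /andP[h5 h6].
by rewrite ltr_norml; apply/andP; split; lra.
Qed.

(** An open set is the union of the half-open boxes with rational corners that it contains, and
    these are countably many. *)
Lemma borel_obox :
  (measurable : set (set B)) = <<s range (fun p : E * E => obox p.1 p.2) >>.
Proof.
apply/seteqP; split; last first.
  apply: smallest_sub; first exact: sigma_algebra_measurable.
  by move=> _ [p _ <-]; exact: obox_meas.
apply: smallest_sub; first exact: smallest_sigma_algebra.
move=> U oU.
pose Q (p : 'rV[rat]_n * 'rV[rat]_n) : set E := obox (map_mx ratr p.1) (map_mx ratr p.2).
(* An enumeration of the rational boxes inside U; codes of nothing, and boxes sticking out of U,
   give the empty set. *)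
pose A k : set E := if (unpickle k : option ('rV[rat]_n * 'rV[rat]_n)) is Some p
  then (if `[< Q p `<=` U >] then Q p else set0) else set0.
rewrite (_ : U = \bigcup_k A k); last first.
  apply/seteqP; split => [x Ux|x [k _]].
    have [p [Qx QU]] := open_obox oU Ux.
    by exists (pickle p) => //; rewrite /A pickleK asboolT.
  by rewrite /A; case: unpickle => // p; case: asboolP => // QU /QU.
apply: sigma_algebra_bigcup => k; rewrite /A; case: unpickle => [p|]; last first.
  exact: sigma_algebra0.
case: asboolP => _; last exact: sigma_algebra0.
by apply: sub_sigma_algebra; exists (map_mx ratr p.1, map_mx ratr p.2).
Qed.

Lemma is_lebesgue_obox (lam : meas) a b : is_lebesgue lam ->
  (lam (obox a b) < +oo)%E.
Proof.
move=> Hl; have [ab|nab] := pselect (forall i, a 0 i <= b 0 i).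
  by rewrite Hl// ltry.
rewrite (_ : obox a b = set0) ?measure0//.
rewrite -subset0 => x H; apply: nab => i; have /andP[h1 h2] := H i.
by apply: ltW; exact: lt_le_trans h1 h2.
Qed.

(** Boxes form a generating pi-system and exhaust the space with finite measure. [is_lebesgue]
    speaks of ordered corners; with unordered ones the box is empty. *)
Lemma lebesgue_unique (lam lam' : meas) : is_lebesgue lam -> is_lebesgue lam' ->
  forall A, measurable (A : set B) -> lam A = lam' A.
Proof.
move=> Hl Hl' A mA.
apply: (@measure_unique _ R B (range (fun p : E * E => obox p.1 p.2))
  (fun k => obox (const_mx (- k%:R)) (const_mx k%:R)) _ _ _ _ lam lam' _ _ A mA).
- exact: borel_obox.
- exact: obox_setI.
- by move=> k; exists (const_mx (- k%:R), const_mx k%:R).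
- apply/seteqP; split => // x _.
  pose M := \sum_i `|x 0 i|.
  have M0 : 0 <= M by apply: sumr_ge0.
  have [k Hk] : exists k : nat, M < k%:R by exists (Num.bound M); exact: archi_boundP.
  exists k => // i; rewrite !mxE.
  have h : `|x 0 i| < k%:R.
    by apply: le_lt_trans Hk; rewrite /M (bigD1 i)//= lerDl sumr_ge0.
  by move: h; rewrite ltr_norml => /andP[-> /ltW ->].
- move=> _ [[a b] _ <-] /=.
  have [ab|nab] := pselect (forall i, a 0 i <= b 0 i).
    by rewrite /obox Hl// Hl'.
  rewrite (_ : obox a b = set0) ?measure0//.
  rewrite -subset0 => x H; apply: nab => i; have /andP[h1 h2] := H i.
  by apply: ltW; exact: lt_le_trans h1 h2.
- by move=> k; exact: is_lebesgue_obox.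
Qed.

Lemma shift_meas (c : E) : measurable_fun setT (fun x : B => (x + c : B)).
Proof.
apply: (@measurability _ _ B B setT (fun x : B => (x + c : B)) (@open E)) => //.
move=> _ [U oU <-]; rewrite setTI; apply: open_meas.
apply: (open_comp (f := fun x : E => x + c)) => // x _.
apply: (@continuousD _ _ _ id (cst c)); [exact: id|exact: cst_continuous].
Qed.

(** The image of the measure under translation has the right value on boxes, so uniqueness
    applies. *)
Lemma lebesgue_shift (lam : meas) (c : E) (A : set E) : is_lebesgue lam ->
  measurable (A : set B) -> lam [set x | A (x + c)] = lam A.
Proof.
move=> Hl mA.
pose phi (x : B) : B := x + c.
have mphi : measurable_fun setT phi := shift_meas c.
pose lam' : meas := measure_function_pushforward__canonical__measure_function_Measure lam mphi.
have Hl' : is_lebesgue lam'.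
  move=> a b ab; rewrite /lam' /= /pushforward.
  have -> : phi @^-1` [set x : E | forall i, a 0 i < x 0 i <= b 0 i] =
    [set x : E | forall i, (a - c) 0 i < x 0 i <= (b - c) 0 i].
    apply/seteqP; split => x /= H i; have := H i; rewrite !mxE.
      by rewrite ltrBlDr lerBrDr.
    by rewrite ltrBlDr lerBrDr.
  rewrite Hl; last by move=> i; rewrite !mxE lerD2r.
  by congr EFin; apply: eq_bigr => i _; rewrite !mxE; ring.
by have := lebesgue_unique Hl Hl' mA => ->.
Qed.

Lemma bounded_obox (A : set E) : bounded_set A -> exists M : R, 0 < M /\
  (forall x, A x -> `|x| <= M) /\ A `<=` obox (const_mx (- M - 1)) (const_mx M).
Proof.
move=> [M0 [_ HM]]; pose M := Num.max 1 (M0 + 1).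
have M1 : 1 <= M by rewrite le_max lexx.
have bd x : A x -> `|x| <= M by move=> Ax; apply: HM => //; rewrite lt_max ltrDl ltr01 orbT.
exists M; split; first by apply: lt_le_trans M1.
split => // x Ax i; rewrite !mxE.
have : `|x 0 i| <= M.
  apply: le_trans (bd x Ax); rewrite -[leRHS]/(mx_norm x) mx_normrE.
  exact: (le_bigmax _ (fun ij : 'I_1 * 'I_n => `|x ij.1 ij.2|) (0, i)).
by rewrite ler_norml => /andP[h1 h2]; apply/andP; split => //; lra.
Qed.

Lemma lebesgue_bounded (lam : meas) (A : set E) : is_lebesgue lam ->
  measurable (A : set B) -> bounded_set A -> (lam A < +oo)%E.
Proof.
move=> Hl mA /bounded_obox[M [_ [_ AM]]].
apply: le_lt_trans (is_lebesgue_obox (const_mx (- M - 1)) (const_mx M) Hl).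
by apply: le_measure; rewrite ?inE//; exact: obox_meas.
Qed.

(** N disjoint translates of equal measure fit into one bounded set for every N, which forces the
    measure to be 0. *)
Lemma null_of_disjoint_translates (lam : meas) (Z : set E) (e : E) :
  is_lebesgue lam -> measurable (Z : set B) -> bounded_set Z ->
  (forall x t t', Z (x + t *: e) -> Z (x + t' *: e) -> t = t') -> lam Z = 0%E.
Proof.
move=> Hl mZ bZ disj.
have [M [M0 [HM _]]] := bounded_obox bZ.
(* Pairwise distinct shifts in the interval from 0 to 1: all translates stay in the closed ball of
   radius M + |e|. *)
pose c k : R := k.+1%:R^-1.
pose Zk k : set E := [set x | Z (x + c k *: e)].
have mZk k : measurable (Zk k : set B).
  have := shift_meas (c k *: e) measurableT mZ.
  by rewrite setTI.
pose Q : set E := [set x | `|x| <= M + `|e|].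
have mQ : measurable (Q : set B).
  apply: closed_meas.
  apply: (@preimage_closed _ _ (fun x : E => `|x|) [set t : R | t <= M + `|e|]).
    by move=> x _; exact: norm_continuous.
  exact: closed_le.
have bQ : bounded_set Q.
  exists (M + `|e|); split; first exact: num_real.
  by move=> M' HM' x /= h; apply: le_trans h (ltW HM').
have ZQ k : Zk k `<=` Q.
  move=> x /HM h; rewrite /Q/= (_ : x = (x + c k *: e) - c k *: e); last by rewrite addrK.
  apply: le_trans (ler_normB _ _) _; apply: lerD => //.
  rewrite normrZ ler_piMl// ger0_norm ?invr_ge0// invf_le1//.
  by rewrite ler1n.
have tZ : trivIset setT Zk.
  apply/trivIsetP => i j _ _ ij; rewrite -subset0 => x [h1 h2].
  have := disj _ _ _ h1 h2; rewrite /c => /invr_inj/eqP.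
  by rewrite eqr_nat eqSS (negbTE ij).
have lZ k : lam (Zk k) = lam Z by exact: lebesgue_shift.
have fQ := lebesgue_bounded Hl mQ bQ.
have le N : (\sum_(k < N) lam Z <= lam Q)%E.
  rewrite (eq_bigr (fun k : 'I_N => lam (Zk k))); last by move=> k _; rewrite lZ.
  rewrite -(measure_bigsetU lam mZk tZ).
  apply: le_measure; rewrite ?inE//; first exact: bigsetU_measurable.
  by move=> x; rewrite -bigcup_mkord => -[k _ /ZQ].
have fZ : lam Z \is a fin_num.
  rewrite ge0_fin_numE//; apply: le_lt_trans fQ.
  by have := le 1%N; rewrite big_ord_recl big_ord0 adde0.
have fQ' : lam Q \is a fin_num by rewrite ge0_fin_numE.
rewrite -(fineK fZ); congr EFin; apply/eqP; rewrite eq_le fine_ge0// andbT.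
rewrite leNgt; apply/negP => p.
pose N := Num.bound (fine (lam Q) / fine (lam Z)).
have := le N; rewrite -(fineK fZ) -(fineK fQ') sumEFin lee_fin sumr_const card_ord.
by rewrite leNgt -mulr_natl -ltr_pdivrMr// archi_boundP.
Qed.

Lemma dotp_continuous (e : E) : continuous (fun x : E => dotp x e).
Proof.
apply: smooth_continuous; apply: smooth_closure_smooth; rewrite /dotp.
elim: (index_enum _) => [|i s IH].
  by under eq_fun do rewrite big_nil; exact: SC_cst.
under eq_fun do rewrite big_cons; apply: SC_add => //.
by apply: SC_mul; [exact: SC_coord|exact: SC_cst].
Qed.

Lemma dotpDZ (x e v : E) t : dotp (x + t *: v) e = dotp x e + t * dotp v e.
Proof.
rewrite /dotp mulr_sumr -big_split/=; apply: eq_bigr => i _.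
by rewrite !mxE; ring.
Qed.

Lemma enorm_sqr (x : E) : enorm x ^+ 2 = dotp x x.
Proof. by rewrite sqr_sqrtr// sumr_ge0// => j _; rewrite -expr2 sqr_ge0. Qed.

Lemma enorm_continuous : continuous (@enorm R n).
Proof.
move=> x; apply: (@continuous_comp _ _ _ (fun x : E => dotp x x) (@Num.sqrt R)).
  apply: smooth_continuous; apply: smooth_closure_smooth; rewrite /dotp.
  elim: (index_enum _) => [|i s IH].
    by under eq_fun do rewrite big_nil; exact: SC_cst.
  under eq_fun do rewrite big_cons; apply: SC_add => //.
  by apply: SC_mul; exact: SC_coord.
exact: sqrt_continuous.
Qed.

Lemma enorm0 : enorm (0 : E) = 0.
Proof. by rewrite /enorm /dotp big1 ?sqrtr0// => i _; rewrite mxE mul0r. Qed.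

Lemma enorm_lipschitz_continuous (h : E -> R) L :
  (forall x y, `|h x - h y| <= L * enorm (x - y)) -> continuous h.
Proof.
move=> hL x; apply/(@cvgrPdist_lt _ _ _ (nbhs x) (nbhs_filter x)) => e e0.
have c : (fun y : E => L * enorm (x - y)) @ x --> (0 : R).
  have H : enorm (x - y) @[y --> x] --> enorm (x - x).
    apply: (@continuous_comp _ _ _ (fun y : E => x - y) (@enorm R n)); last exact: enorm_continuous.
    apply: (@continuousB _ _ _ (cst x) id); [exact: cst_continuous|exact: id].
  move: H; rewrite subrr enorm0 => H.
  by rewrite -(mulr0 L); exact: (cvgM (cvg_cst L) H).
move/(@cvgrPdist_lt _ _ _ (nbhs x) (nbhs_filter x)) : c => /(_ e e0); apply: filterS => y; rewrite sub0r normrN => hy.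
apply: le_lt_trans (hL x y) _; apply: le_lt_trans hy; exact: ler_norm.
Qed.

(** Locally the boundary lies in the graph of h over the hyperplane orthogonal to e, so a line in
    direction e meets it at most once and its translates along e are disjoint. Compactness leaves
    finitely many such pieces. *)
Lemma lipschitz_boundary_null (lam : meas) (U : set E) : is_lebesgue lam ->
  bounded_set U -> lipschitz_boundary U -> lam (bdry U) = 0%E /\ compact (bdry U).
Proof.
move=> Hl bU Hlip.
have cb : closed (bdry U).
  rewrite /bdry setDE; apply: closedI; first exact: closed_closure.
  by apply: open_closedC; exact: open_interior.
have [M [M0 [HM _]]] := bounded_obox bU.
have bb : bounded_set (bdry U).
  exists M; split; first exact: num_real.
  move=> M' HM' x [+ _]; move=> cx; apply: le_trans (ltW HM').
  have cl : closed [set y : E | `|y| <= M].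
    apply: (@preimage_closed _ _ (fun x : E => `|x|) [set t : R | t <= M]).
      by move=> y _; exact: norm_continuous.
    exact: closed_le.
  by apply: (cl x); apply: closure_subset cx => y; exact: HM.
have cpt : compact (bdry U) by exact: bounded_closed_compact.
split => //.
have rad p : exists r : R, 0 < r /\
    (bdry U p -> lam (bdry U `&` closed_ball p r) = 0%E).
  have [bp|nb] := pselect (bdry U p); last by exists 1.
  have [V [e [h [L [[oV Vp] en hinv hL HU]]]]] := Hlip p bp.
  have : nbhs p V by apply: open_nbhs_nbhs.
  move/nbhs_closedballP => [r rV]; exists r%:num; split => // _.
  have hc := enorm_lipschitz_continuous hL.
  have dc := @dotp_continuous e.
  (* Strictly above the graph a whole neighbourhood misses U, contradicting the closure; strictly
     below, a whole neighbourhood lies in U, contradicting that x is not interior. *)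
  have graph x : V x -> bdry U x -> dotp x e = h x.
    move=> Vx [cx nix]; apply/eqP; rewrite eq_le; apply/andP; split; rewrite leNgt; apply/negP => lt.
      have N : nbhs x [set y | V y /\ h y < dotp y e].
        have c : (fun y => dotp y e - h y) @ x --> dotp x e - h x.
          exact: (cvgB (dc x) (hc x)).
        have p0 : 0 < dotp x e - h x by rewrite subr_gt0.
        have := @cvgr_gt _ _ (nbhs x) (nbhs_filter x) _ _ c _ p0.
        have Vn : nbhs x V by apply: open_nbhs_nbhs.
        by move=> hn; apply: filterS2 Vn hn => y Vy; rewrite subr_gt0.
      have [y [Uy [Vy lty]]] := cx _ N.
      by have := (HU y Vy).1 Uy; rewrite ltNge ltW.
    apply: nix.
    have c : (fun y => h y - dotp y e) @ x --> h x - dotp x e.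
      exact: (cvgB (hc x) (dc x)).
    have p0 : 0 < h x - dotp x e by rewrite subr_gt0.
    have := @cvgr_gt _ _ (nbhs x) (nbhs_filter x) _ _ c _ p0.
    have Vn : nbhs x V by apply: open_nbhs_nbhs.
    by move=> hn; apply: filterS2 Vn hn => y Vy; rewrite subr_gt0 => /(HU y Vy).2.
  apply: (@null_of_disjoint_translates _ _ e) => //.
  - by apply: closed_meas; apply: closedI => //; exact: closed_ball_closed.
  - move: bb => [M1 [M1r HM1]]; exists M1; split => // M' /HM1 H x [bx _]; exact: H.
  (* Along e the function h is constant while the height has slope 1, because e is a unit vector. *)
  - move=> x t t' [b1 /rV v1] [b2 /rV v2].
    have := graph _ v1 b1; have := graph _ v2 b2; rewrite !hinv !dotpDZ.
    rewrite -enorm_sqr en expr1n !mulr1; lra.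
have /choice[r Hr] := rad.
have := cpt; rewrite compact_cover => /(_ E (bdry U) (fun a => ball a (r a))) [].
- by move=> a _; exact: ball_open.
- by move=> a Ka; exists a => //; apply: ballxx; case: (Hr a).
move=> D' D'K Kcov.
apply/eqP; rewrite -measure_le0.
apply: (@le_trans _ _ (lam (\big[setU/set0]_(a <- finmap.enum_fset D') (bdry U `&` closed_ball a (r a))))).
  apply: le_measure; rewrite ?inE.
  - exact: closed_meas.
  - by apply: bigsetU_measurable => a _; apply: closed_meas; apply: closedI => //; exact: closed_ball_closed.
  - move=> x bx; have [a aD bax] := Kcov x bx.
    rewrite -bigcup_seq; exists a => //; split => //; exact: (@subset_closure _ (ball a (r a))).
rewrite measure_le0; apply/eqP.
apply: measure_negligible.
  by apply: bigsetU_measurable => a _; apply: closed_meas; apply: closedI => //; exact: closed_ball_closed.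
rewrite big_seq; elim/big_ind : _ => //; first exact: negligible_set0.
  by move=> A A'; exact: negligibleU.
move=> a aD; apply/negligibleP.
  by apply: closed_meas; apply: closedI => //; exact: closed_ball_closed.
by apply: (Hr a).2; have := D'K a aD; rewrite inE.
Qed.

End LebesgueMeasure.

(** * Lipschitz functions and the kernel of H^{3/2} *)

Section KernelBound.
Variables (R : realType) (n : nat).
Notation E := 'rV[R]_n.
Notation B := (borelT R n).
Notation F := (fn R n).
Notation meas := {measure set (borelT R n) -> \bar R}.

Lemma half_sum N : \sum_(k < N) ((2 : R)^-1) ^+ k <= 2.
Proof.
suff -> : \sum_(k < N) ((2 : R)^-1) ^+ k = 2 - 2 * (2^-1) ^+ N.
  by rewrite lerBlDr lerDl mulr_ge0// exprn_ge0// invr_ge0.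
elim: N => [|N IH]; first by rewrite big_ord0 expr0 mulr1 subrr.
rewrite big_ord_recr/= IH exprS; set a := _ ^+ N.
by field.
Qed.

Lemma coord_le_norm (x : E) i : `|x 0 i| <= `|x|.
Proof.
rewrite -[leRHS]/(mx_norm x) mx_normrE.
exact: (le_bigmax _ (fun ij : 'I_1 * 'I_n => `|x ij.1 ij.2|) (0, i)).
Qed.

Lemma enorm_ge0 (x : E) : 0 <= enorm x.
Proof. exact: sqrtr_ge0. Qed.

Lemma norm_le_enorm (x : E) : `|x| <= enorm x.
Proof.
rewrite -[leLHS]/(mx_norm x) mx_normrE; apply: bigmax_le => /= [|ij _]; first exact: enorm_ge0.
rewrite (ord1 ij.1) -(ler_pXn2r (n := 2))// ?nnegrE// ?enorm_ge0//.
by rewrite real_normK ?num_real// coord_le_enorm.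
Qed.

Lemma enorm_le_norm (x : E) : enorm x <= n.+1%:R * `|x|.
Proof.
rewrite -(ler_pXn2r (n := 2))// ?nnegrE// ?enorm_ge0// ?mulr_ge0//.
rewrite enorm_sqr /dotp.
apply: (@le_trans _ _ (\sum_(i < n) `|x| ^+ 2)).
  apply: ler_sum => i _; rewrite -expr2 -real_normK ?num_real//.
  by rewrite ler_pXn2r// ?nnegrE//; exact: coord_le_norm.
rewrite sumr_const card_ord -[leLHS]mulr_natl exprMn ler_wpM2r// ?exprn_ge0//.
by rewrite -natrX ler_nat expnS expn1 (leq_trans (leqnSn n))// leq_pmulr.
Qed.

Lemma bounded_diam (D : set E) : bounded_set D ->
  exists2 d : R, 1 <= d & forall x y, D x -> D y -> enorm (x - y) <= d.
Proof.
move=> /bounded_obox[M [M0 [HM _]]].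
exists (n.+1%:R * (2 * M) + 1); first by rewrite lerDr !mulr_ge0// ltW.
move=> x y /HM hx /HM hy; apply: le_trans (enorm_le_norm _) _.
apply: ler_wpDr => //; rewrite ler_wpM2l//.
by apply: le_trans (ler_normB _ _) _; lra.
Qed.

(* Dyadic shells: the part of D at sup-distance between r/2 and r of x
   contributes at most a multiple of r. *)
Lemma kernel_int (lam : meas) (D : set E) : is_lebesgue lam -> (0 < n)%N ->
  measurable (D : set B) -> bounded_set D ->
  exists2 C : R, 0 <= C & forall x, D x ->
    (\int[lam]_(y in (D : set B))
       (enorm (x - y) ^+ 2 / enorm (x - y) ^+ n.+1)%:E <= C%:E)%E.
Proof.
move=> Hl n0 mD bD.
have [M [M0 [HM _]]] := bounded_obox bD.
(* The radius starts at 2 M, a bound for the sup-distance of two points of D, and is halved at each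
   step. *)
pose rho k : R := 2 * M * (2^-1) ^+ k.
have rho0 k : 0 < rho k by rewrite !mulr_gt0// exprn_gt0// invr_gt0.
have rhoS k : rho k.+1 = rho k / 2 by rewrite /rho exprS; field.
(* The integrand is |x - y|^(1-n), at most [c k] outside the ball of radius rho/2. Times the volume
   (3 rho)^n of the box below this is 2^(n-1) 3^n rho, which explains K. *)
pose c k : R := ((rho k / 2) ^+ n.-1)^-1.
have c0 k : 0 < c k by rewrite invr_gt0 exprn_gt0// divr_gt0.
pose K : R := 2 ^+ n.-1 * 3 ^+ n.
have K0 : 0 <= K by rewrite mulr_ge0// exprn_ge0.
exists (K * (2 * M * 2)); first by rewrite !mulr_ge0// ltW.
move=> x Dx.
(* Boxes are open at their lower faces; doubling the distance there makes the box contain the closed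
   cube of radius rho. *)
pose Q k : set E := obox (\row_i (x 0 i - 2 * rho k)) (\row_i (x 0 i + rho k)).
have mQ k : measurable (Q k : set B) by exact: obox_meas.
have lQ k : lam (Q k) = ((3 * rho k) ^+ n)%:E.
  rewrite Hl; last by move=> i; rewrite !mxE; have := rho0 k; lra.
  rewrite (eq_bigr (fun=> 3 * rho k)); last by move=> i _; rewrite !mxE; ring.
  by rewrite prodr_const card_ord.
pose f k (y : B) : \bar R := (c k * \1_(Q k) y)%:E.
have f0 k y : (0 <= f k y)%E by rewrite lee_fin mulr_ge0// ltW.
have mf k : measurable_fun (D : set B) (f k).
  by apply/measurable_EFinP; apply: measurable_funM => //; exact: measurable_indic.
have fint k : (\int[lam]_(y in (D : set B)) f k y <= (K * rho k)%:E)%E.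
  rewrite /f; under eq_integral do rewrite EFinM.
  rewrite ge0_integralZl//; last 2 first.
  - by apply/measurable_EFinP; exact: measurable_indic.
  - by rewrite lee_fin ltW.
  rewrite integral_indic//.
  apply: (@le_trans _ _ ((c k)%:E * lam (Q k))%E).
    apply: lee_wpmul2l; first by rewrite lee_fin ltW.
    by apply: le_measure; rewrite ?inE//; exact: measurableI.
  rewrite lQ -EFinM lee_fin /c /K; have := rho0 k; move: (rho k) => r r0.
  case: (n) n0 => // m _ /=.
  rewrite !exprMn exprVn !exprS.
  rewrite le_eqVlt; apply/orP; left; apply/eqP.
  have a0 : r ^+ m != 0 by rewrite expf_neq0// gt_eqF.
  have b0 : (2 : R) ^+ m != 0 by rewrite expf_neq0.
  by field; rewrite a0 b0.
apply: (@le_trans _ _ (\int[lam]_(y in (D : set B)) (\sum_(k <oo) f k y))%E).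
  apply: ge0_le_integral_nm => [y Dy|y Dy].
    by rewrite lee_fin divr_ge0// exprn_ge0// enorm_ge0.
  have [->|xy] := eqVneq x y.
    by rewrite subrr enorm0 expr0n/= mul0r; apply: nneseries_ge0 => k _ _; exact: f0.
  have d0 : 0 < `|x - y| by rewrite normr_gt0 subr_eq0.
  have ed : `|x - y| <= enorm (x - y) by exact: norm_le_enorm.
  have e0 : 0 < enorm (x - y) by exact: lt_le_trans ed.
  have [j0 hj0] : exists j, rho j < `|x - y|.
    pose N := Num.bound (2 * M / `|x - y|); exists N.
    have hN : 2 * M / `|x - y| < 2 ^+ N.
      apply: lt_trans (archi_boundP _) _; first by rewrite divr_ge0// ?mulr_ge0// ltW.
      by rewrite -natrX ltr_nat ltn_expl.
    move: hN; rewrite ltr_pdivrMr// => hN; rewrite /rho exprVn ltr_pdivrMr ?exprn_gt0//.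
    by rewrite [ltRHS]mulrC.
  (* The first radius below |x - y| is not the initial one, so its predecessor k is the index of the
     shell containing y. *)
  case: (ex_minnP (ex_intro (fun j => rho j < `|x - y|) j0 hj0)) => -[|k] hk hmin.
    exfalso; move: hk; rewrite /rho expr0 mulr1 ltNge => /negP; apply.
    apply: le_trans (ler_normB _ _) _; have := HM x Dx; have := HM y Dy; lra.
  have hk' : `|x - y| <= rho k.
    rewrite leNgt; apply/negP => /hmin; by rewrite ltnn.
  apply: (@le_trans _ _ (f k y)).
    have Qy : Q k y.
      move=> i; rewrite !mxE.
      have := le_trans (coord_le_norm (x - y) i) hk'; rewrite !mxE ler_norml.
      by have := rho0 k => r0 /andP[h1 h2]; apply/andP; split; lra.
    rewrite /f indicE mem_set// mulr1 lee_fin /c.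
    have r2 : rho k / 2 <= enorm (x - y) by rewrite -rhoS; apply: le_trans (ltW hk) ed.
    have r1 : 0 < rho k / 2 by rewrite divr_gt0.
    move: (enorm (x - y)) e0 r2 => r e0 r2; case: (n) n0 => // m _ /=.
    have -> : r ^+ 2 / r ^+ m.+2 = (r ^+ m)^-1.
      rewrite -(addn2 m) exprD; have a0 : r != 0 by rewrite gt_eqF.
      by rewrite invfM mulrCA divff ?mulr1// expf_neq0.
    by rewrite lef_pV2 ?posrE ?exprn_gt0// lerXn2r// nnegrE ltW.
  apply: le_trans (nneseries_lim_ge k.+1 (fun i _ _ => f0 i y)).
  rewrite big_mkord big_ord_recr/=.
  by rewrite leeDr// sume_ge0.
rewrite integral_nneseries//.
apply: lime_le.
  by apply: is_cvg_nneseries => k _ _; exact: integral_ge0.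
apply: nearW => N; apply: (@le_trans _ _ (\sum_(0 <= k < N) (K * rho k)%:E)%E).
  by apply: lee_sum => k _; exact: fint.
rewrite big_mkord sumEFin lee_fin -mulr_sumr ler_wpM2l// /rho -mulr_sumr.
by rewrite ler_wpM2l ?half_sum// mulr_ge0// ltW.
Qed.

Notation e_ i := (delta_mx 0 i : E).

Lemma smooth_line (f : E -> R) (w : E) i (t : R) : smooth_fun f ->
  is_derive t (1 : R) (fun t => f (w + t *: e_ i)) (pderiv i f (w + t *: e_ i)).
Proof.
move=> sf; have d := @smooth_derivable _ _ f i (w + t *: e_ i) sf.
have eqf : (fun h : R => h^-1 *: (f (w + (h *: (1 : R) + t) *: e_ i) - f (w + t *: e_ i))) =
    (fun h : R => h^-1 *: (f (h *: e_ i + (w + t *: e_ i)) - f (w + t *: e_ i))).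
  apply/funext => h; congr (_ *: (f _ - _)).
  by rewrite -[h *: (1 : R)]/(h * 1) mulr1 scalerDl addrCA.
apply: DeriveDef; first by rewrite /derivable eqf.
by rewrite /derive /pderiv /derive eqf.
Qed.

Lemma line_lipschitz (f : E -> R) M i : smooth_fun f ->
  (forall x, `|pderiv i f x| <= M) ->
  forall w t, `|f (w + t *: e_ i) - f w| <= M * `|t|.
Proof.
move=> sf HM w t.
have dr x := @smooth_line f w i x sf.
have cont (x : R) : {for x, continuous (fun t : R => f (w + t *: e_ i))}.
  by apply: differentiable_continuous; apply/derivable1_diffP; case: (dr x).
have key a b : a <= b -> `|f (w + b *: e_ i) - f (w + a *: e_ i)| <= M * (b - a).
  move=> ab.
  have [|c _ ->] := @MVT_segment R (fun t : R => f (w + t *: e_ i)) _ a b ab (fun x _ => dr x).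
    by apply: continuous_subspaceT.
  by rewrite normrM (ger0_norm (x := b - a)) ?subr_ge0// ler_wpM2r// subr_ge0.
have [t0|t0] := leP 0 t.
  by have := key _ _ t0; rewrite scale0r addr0 subr0 (ger0_norm t0).
by have := key _ _ (ltW t0); rewrite scale0r addr0 sub0r distrC (ltr0_norm t0).
Qed.

Lemma test_lipschitz (U : set E) (f : E -> R) : test_fun U f ->
  exists2 L : R, 0 <= L & forall x y, `|f x - f y| <= L * enorm (x - y).
Proof.
move=> tf; have [sf _] := tf.
have /choice[M HM] : forall i, exists M, forall x, `|pderiv i f x| <= M.
  by move=> i; exact: test_bound (test_pderiv i tf).
have M0 i : 0 <= M i by exact: le_trans (HM i 0).
exists (\sum_i M i); first by rewrite sumr_ge0.
move=> x y.
(* A path from y to x that changes one coordinate at a time, so that only partial derivatives are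
   needed. *)
pose w k : E := \row_i (if (i < k)%N then x 0 i else y 0 i).
have wS (k : 'I_n) : w k.+1 = w k + (x 0 k - y 0 k) *: e_ k.
  apply/rowP => j; rewrite !mxE/= ltnS.
  have [->|jk] := eqVneq j k; first by rewrite leqnn ltnn mulr1; ring.
  by rewrite mulr0 addr0 leq_eqVlt (_ : (j == k :> nat) = false)//; exact/negbTE.
have w0 : w 0%N = y by apply/rowP => j; rewrite mxE.
have wn : w n = x by apply/rowP => j; rewrite mxE ltn_ord.
have -> : f x - f y = \sum_(k < n) (f (w k.+1) - f (w k)).
  by rewrite -(big_mkord xpredT (fun k => f (w k.+1) - f (w k))) telescope_sumr// wn w0.
apply: le_trans (ler_norm_sum _ _ _) _; rewrite mulr_suml.
apply: ler_sum => k _; rewrite wS.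
apply: le_trans (line_lipschitz sf (HM k) _ _) _; rewrite ler_wpM2l//.
have := coord_le_norm (x - y) k; rewrite !mxE => h.
exact: le_trans h (norm_le_enorm _).
Qed.

(** At theta = 1/2 the exponent is n + 1, and the Lipschitz bound reduces the kernel to the one that
    [kernel_int] bounds uniformly in x. *)
Lemma test_sqSlob_half (lam : meas) (D V : set E) (f : E -> R) : is_lebesgue lam ->
  (0 < n)%N -> measurable (D : set B) -> bounded_set D -> test_fun V f ->
  (sqSlob lam D n%:R (3 / 2 - 1) (fun x => (f x)%:C%C) < +oo)%E.
Proof.
move=> Hl n0 mD bD tf.
have fD := lebesgue_bounded Hl mD bD.
have [C C0 HC] := kernel_int Hl n0 mD bD.
have [L L0 HL] := test_lipschitz tf.
rewrite sqSlobnE; last by apply/eqP; lra.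
apply: lte_add_pinfty; first exact: L2_test fD tf.
apply: (@le_lt_trans _ _ (\int[lam]_(x in (D : set B)) (L ^+ 2 * C)%:E)%E); last first.
  by rewrite integral_cst// lte_mul_pinfty// lee_fin mulr_ge0// exprn_ge0.
apply: ge0_le_integral_nm => [x Dx|x Dx].
  by apply: integral_ge0 => y Dy; rewrite lee_fin slob_kernel_ge0.
apply: (@le_trans _ _ ((L ^+ 2)%:E * C%:E)%E); last by rewrite -EFinM.
have mk : measurable_fun (D : set B)
    (fun y : B => (enorm (x - y) ^+ 2 / enorm (x - y) ^+ n.+1)%:E).
  have me : measurable_fun (D : set B) (fun y : B => enorm (x - y)).
    apply: continuous_meas => y.
    apply: (@continuous_comp _ _ _ (fun y : E => x - y) (@enorm R n)); last exact: enorm_continuous.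
    by apply: (@continuousB _ _ _ (cst x) id); [exact: cst_continuous|exact: id].
  rewrite (_ : (fun y => _) = EFin \o
      (fun y : B => enorm (x - y) ^+ 2 * enorm (x - y) `^ (- n.+1%:R))); last first.
    by apply/funext => y /=; rewrite powRN powR_mulrn// enorm_ge0.
  apply/measurable_EFinP; apply: measurable_funM; first exact: measurable_funX.
  exact: (measurableT_comp (measurable_powR _) me).
apply: (@le_trans _ _ ((L ^+ 2)%:E * \int[lam]_(y in (D : set B))
   (enorm (x - y) ^+ 2 / enorm (x - y) ^+ n.+1)%:E)%E); last first.
  by rewrite lee_wpmul2l// ?HC// lee_fin exprn_ge0.
rewrite -ge0_integralZl//; last 2 first.
- by move=> y _; rewrite lee_fin divr_ge0// exprn_ge0// enorm_ge0.
- by rewrite lee_fin exprn_ge0.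
apply: ge0_le_integral_nm => [y Dy|y Dy]; first by rewrite lee_fin slob_kernel_ge0.
rewrite -EFinM lee_fin /slob_kernel (_ : n%:R + 2 * (3 / 2 - 1) = n.+1%:R); last first.
  by rewrite -natr1; field.
rewrite powR_mulrn ?enorm_ge0// mulrA ler_wpM2r// ?invr_ge0 ?exprn_ge0 ?enorm_ge0//.
rewrite -rmorphB csqC -exprMn -real_normK ?num_real//.
by rewrite ler_pXn2r// ?nnegrE// ?mulr_ge0// ?enorm_ge0.
Qed.

End KernelBound.

(** * Green's identity *)

Section GaussGreen.
Variables (R : realType) (n : nat) (G : transmission R n).
Notation E := 'rV[R]_n.
Notation B := (borelT R n).
Notation F := (fn R n).
Notation lam := (lebn G).
Notation Sig := (Sig G).
Notation dOm := (dOm G).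

Lemma Omp_open : open (Omp G).
Proof. by apply: openI; [exact: Om_open|apply: closed_openC; exact: closed_closure]. Qed.

Lemma bounded_subset (A A' : set E) : A `<=` A' -> bounded_set A' -> bounded_set A.
Proof. by move=> AA' [M [Mr HM]]; exists M; split => // M' /HM H x /AA'; exact: H. Qed.

Lemma Omm_sub_Om : Omm G `<=` Om G.
Proof. by move=> x xm; apply: (@Omm_sub _ _ G); exact: subset_closure. Qed.

Lemma bdry_sub_Om : bdry (Omm G) `<=` Om G.
Proof. by move=> x [cx _]; exact: (@Omm_sub _ _ G). Qed.

Lemma Omp_bounded : bounded_set (Omp G).
Proof. by apply: bounded_subset (@Om_bounded _ _ G) => x []. Qed.

Lemma Omm_bounded : bounded_set (Omm G).
Proof. by apply: bounded_subset (@Om_bounded _ _ G); exact: Omm_sub_Om. Qed.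

Lemma dim_gt0 : (0 < n)%N.
Proof. exact: leq_trans (dim_ge2 G). Qed.

Lemma regular_of_boundary (U : set E) (S : surface R n) : bounded_set U ->
  lipschitz_boundary U -> is_boundary_of lam U S -> regular_surface S.
Proof.
move=> bU lU [h1 h2 h3 _]; exists (bdry U); split => //.
exact: (lipschitz_boundary_null (@lamP _ _ G) bU lU).2.
Qed.

Lemma regular_Sig : regular_surface Sig.
Proof.
exact: regular_of_boundary Omm_bounded (@Omm_lipschitz _ _ G) (@SigP _ _ G).
Qed.

Lemma regular_dOm : regular_surface dOm.
Proof.
exact: regular_of_boundary (@Om_bounded _ _ G) (@Om_lipschitz _ _ G) (@dOmP _ _ G).
Qed.

Lemma L2_continuous (U : set E) (f : E -> R) : open U -> bounded_set U ->
  continuous f -> inL2 lam U (fun x => (f x)%:C%C).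
Proof.
move=> oU bU cf; have mU := open_meas oU.
have [M [M0 [HM _]]] := bounded_obox bU.
have cl : closed [set y : E | `|y| <= M].
  apply: (@preimage_closed _ _ (fun x : E => `|x|) [set t : R | t <= M]).
    by move=> y _; exact: norm_continuous.
  exact: closed_le.
have bd : bounded_set [set y : E | `|y| <= M].
  exists M; split; first exact: num_real.
  by move=> M' HM' x /= h; apply: le_trans h (ltW HM').
have [K HK] := compact_bound (bounded_closed_compact bd cl) cf.
apply: (L2_bounded_ae (M := K ^+ 2) mU).
- exact: lebesgue_bounded (@lamP _ _ G) mU bU.
- by apply: mfn_real; exact: continuous_meas.
- apply: aeW => x Ux; rewrite csqC -real_normK ?num_real//.
  rewrite lerXn2r// ?nnegrE//; last by apply: HK; exact: HM.
  by apply: le_trans (HK x (HM x Ux)).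
Qed.

Lemma cont_integrable (U : set E) (f : E -> R) : open U -> bounded_set U ->
  continuous f -> lam.-integrable (U : set B) (EFin \o (f : B -> R)).
Proof.
move=> oU bU cf.
have c1 : continuous (fun _ : E => 1 : R) by exact: cst_continuous.
have [h _] := L2_mul_integrable (open_meas oU) (L2_continuous oU bU cf) (L2_continuous oU bU c1).
by apply: eq_integrable h; rewrite ?inE//; [exact: open_meas|move=> x _ /=; rewrite mulr1 mul0r subr0].
Qed.

(** The surface measure sits on the boundary of V, where a function with compact support in the open
    set V vanishes. *)
Lemma test_pderiv_int0 (V : set E) (S : surface R n) i (w : E -> R) : open V ->
  is_boundary_of lam V S -> test_fun V w -> Rintegral lam V (pderiv i w) = 0.
Proof.
move=> oV [a0 mnu _ HG] tw; rewrite HG; last exact: testS tw.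
have [_ [K [_ KV wK]]] := tw.
rewrite /Rintegral (_ : integral _ _ _ = 0%E)//.
transitivity (\int[area S]_(x in setT) (cst 0%E x : \bar R))%E; last exact: integral0.
apply: integral_ae; exists (~` bdry V); split => //.
  rewrite -[X in measurable X]setTI; apply: measurableI => //; apply: measurableC.
  apply: closed_meas; rewrite /bdry setDE; apply: closedI; first exact: closed_closure.
  by apply: open_closedC; exact: open_interior.
move=> x nx bx; apply: nx => /= _.
rewrite wK ?mul0r// => /KV Vx; apply: bx.2.
by rewrite (interior_id _).1.
Qed.

Lemma Rint_off (U V : set E) (h : E -> R) : U `<=` V ->
  (forall x, V x -> ~ U x -> h x = 0) -> Rintegral lam V h = Rintegral lam U h.
Proof.
move=> UV H; rewrite Rintegral_mkcond [RHS]Rintegral_mkcond.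
apply: eq_Rintegral => x _; rewrite /patch.
have [Vx|nVx] := pselect (V x); have [Ux|nUx] := pselect (U x).
- by rewrite !mem_set.
- by rewrite mem_set// memNset//; exact: H.
- by case: nVx; exact: UV.
- by rewrite !memNset.
Qed.

Lemma test_off (U : set E) i (w : E -> R) : test_fun U w -> forall x, ~ U x -> pderiv i w x = 0.
Proof.
move=> [_ [K [cK KU wK]]] x nU.
by apply: (pderiv_off _ (compact_closedE cK) wK) => /KU.
Qed.

(* U lies on one side of Sigma, eps being the sign of the normal; nothing is
   seen of the outer boundary by functions vanishing near it. *)
Definition one_sided (U : set E) (eps : R) : Prop :=
  [/\ open U, bounded_set U,
      forall i w, test_fun U w -> Rintegral lam U (pderiv i w) = 0
    & forall i f, test_fun (Om G) f -> Rintegral lam U (pderiv i f) =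
        eps * Rintegral (area Sig) setT (fun x : B => f x * unormal Sig x 0 i)].

Lemma one_sided_m : one_sided (Omm G) 1.
Proof.
split; [exact: Omm_open|exact: Omm_bounded| |].
  by move=> i w tw; exact: (test_pderiv_int0 i (@Omm_open _ _ G) (@SigP _ _ G)).
move=> i f tf; rewrite mul1r; have [_ _ _ HG] := @SigP _ _ G.
by apply: HG; exact: testS tf.
Qed.

(** For a test function in Omega the integral of a derivative over Omega is 0. As Sigma is a null
    set, the integrals over the two sides are opposite, and the one over Omega_- is given by
    Gauss-Green. *)
Lemma one_sided_p : one_sided (Omp G) (-1).
Proof.
have D0 i w : test_fun (Om G) w -> Rintegral lam (Om G) (pderiv i w) = 0.
  exact: (test_pderiv_int0 i (@Om_open _ _ G) (@dOmP _ _ G)).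
split; [exact: Omp_open|exact: Omp_bounded| |].
  move=> i w tw; have sub : Omp G `<=` Om G by move=> x [].
  by rewrite -(@Rint_off _ (Om G)) ?D0//; [exact: testS tw|move=> x _; exact: test_off].
move=> i f tf; rewrite mulN1r; have [_ _ _ HG] := @SigP _ _ G.
rewrite -HG; last exact: testS tf.
have [nz cb] := lipschitz_boundary_null (@lamP _ _ G) Omm_bounded (@Omm_lipschitz _ _ G).
have mb : measurable (bdry (Omm G) : set B) by apply: closed_meas; exact: compact_closedE.
have mm : measurable (Omm G : set B) by apply: open_meas; exact: Omm_open.
have mp : measurable (Omp G : set B) by apply: open_meas; exact: Omp_open.
have mo : measurable (Om G : set B) by apply: open_meas; exact: Om_open.
have cf : continuous (pderiv i f) by apply: smooth_continuous; apply: smooth_pderiv; case: tf.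
have int := cont_integrable (@Om_open _ _ G) (@Om_bounded _ _ G) cf.
have dec : Om G = Omp G `|` (Omm G `|` bdry (Omm G)).
  apply/seteqP; split => x; last first.
    by move=> [[]//|[/Omm_sub_Om//|/bdry_sub_Om]].
  move=> Ox; have [cx|ncx] := pselect (closure (Omm G) x); last by left.
  right; have [mx|nmx] := pselect (Omm G x); first by left.
  by right; split => //; rewrite (interior_id _).1//; exact: Omm_open.
apply/eqP; rewrite -subr_eq0 opprK; apply/eqP; rewrite -[RHS](D0 i f tf) dec.
rewrite Rintegral_setU//; last 3 first.
- exact: measurableU.
- by rewrite -dec.
- apply/disj_setPS => x [[_ ncx] [mx|[cx _]]]; apply: ncx => //; exact: subset_closure.
congr (_ + _); rewrite Rintegral_setU//; last 2 first.
- by apply: integrableS int => //; [exact: measurableU|rewrite dec => x; right].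
- apply/disj_setPS => x [mx [_]]; apply.
  by rewrite (interior_id _).1//; exact: Omm_open.
rewrite (_ : Rintegral lam (bdry _) _ = 0) ?addr0//.
rewrite /Rintegral null_set_integral//.
by apply/measurable_EFinP; exact: continuous_meas.
Qed.

Lemma integrable_sumR (mu : {measure set B -> \bar R}) (D : set B) (s : seq 'I_n)
    (h : 'I_n -> B -> R) : measurable D -> (forall i, mu.-integrable D (EFin \o h i)) ->
  mu.-integrable D (EFin \o (fun x => \sum_(i <- s) h i x)).
Proof.
move=> mD ih; apply: (eq_integrable mD (fun x => (\sum_(j <- s) (EFin \o h j) x)%E)).
  by move=> x _ /=; rewrite sumEFin.
exact: integrable_sum.
Qed.

Lemma Rint_sum (mu : {measure set B -> \bar R}) (D : set B) (h : 'I_n -> B -> R) :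
  measurable D -> (forall i, mu.-integrable D (EFin \o h i)) ->
  Rintegral mu D (fun x => \sum_i h i x) = \sum_i Rintegral mu D (h i).
Proof.
move=> mD ih; elim: (index_enum _) => [|i s IH].
  under eq_Rintegral do rewrite big_nil.
  by rewrite big_nil Rintegral_cst// mul0r.
under eq_Rintegral do rewrite big_cons.
rewrite big_cons RintegralD//; first by rewrite IH.
exact: integrable_sumR.
Qed.

Local Opaque pderiv.

Definition ndiff (f : E -> R) (x : E) : R := \sum_i unormal Sig x 0 i * pderiv i f x.

Lemma L2S_surface_mul (f : E -> R) i : continuous f ->
  (area Sig).-integrable setT (EFin \o (fun x : B => f x * unormal Sig x 0 i)).
Proof.
move=> cf; have r := regular_Sig.
have L1 := L2S_continuous r (@cst_continuous E R 1).
have [h _] := L2_mul_integrable measurableT (L2S_continuous r cf) (L2S_normal r i L1).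
by apply: eq_integrable h => // x _ /=; rewrite !(mulr1, mul0r, subr0, mulr0, addr0).
Qed.

Lemma flux_Re eps v x : complex.Re (flux Sig eps v x) = eps * ndiff (fun y => complex.Re (v y)) x.
Proof.
rewrite /flux CReM CReC CImC mul0r subr0; congr (_ * _).
rewrite (big_morph _ (@CReD R) (erefl : complex.Re (0 : R[i]) = 0)); apply: eq_bigr => i _.
by rewrite CReM CReC CImC mul0r subr0.
Qed.

Lemma flux_Im eps v x : complex.Im (flux Sig eps v x) = eps * ndiff (fun y => complex.Im (v y)) x.
Proof.
rewrite /flux CImM CReC CImC mul0r addr0; congr (_ * _).
rewrite (big_morph _ (@CImD R) (erefl : complex.Im (0 : R[i]) = 0)); apply: eq_bigr => i _.
by rewrite CImM CReC CImC mul0r addr0.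
Qed.

Section OneSided.
Variables (U : set E) (eps : R).
Hypothesis sU : one_sided U eps.
Let oU : open U. Proof. by case: sU. Qed.
Let bU : bounded_set U. Proof. by case: sU. Qed.
Let mU : measurable (U : set B) := open_meas oU.
Let fU : (lam U < +oo)%E := lebesgue_bounded (@lamP _ _ G) mU bU.

Lemma divergence_Sig (w : 'I_n -> E -> R) : (forall i, test_fun (Om G) (w i)) ->
  Rintegral lam U (fun x => \sum_i pderiv i (w i) x) =
  Rintegral (area Sig) setT (fun x : B => eps * \sum_i w i x * unormal Sig x 0 i).
Proof.
move=> tw; have [_ _ _ HU] := sU.
rewrite Rint_sum//; last first.
  move=> i; apply: cont_integrable => //; apply: smooth_continuous.
  by apply: smooth_pderiv; case: (tw i).
have Iw i : (area Sig).-integrable setT (EFin \o (fun x : B => w i x * unormal Sig x 0 i)).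
  by apply: L2S_surface_mul; apply: smooth_continuous; case: (tw i).
rewrite RintegralZl//; last first.
  exact: integrable_sumR.
rewrite Rint_sum//.
by rewrite mulr_sumr; apply: eq_bigr => i _; rewrite HU.
Qed.

Lemma divergence_test (w : 'I_n -> E -> R) : (forall i, test_fun U (w i)) ->
  Rintegral lam U (fun x => \sum_i pderiv i (w i) x) = 0.
Proof.
move=> tw; have [_ _ HU _] := sU.
rewrite Rint_sum//; last first.
  move=> i; apply: cont_integrable => //; apply: smooth_continuous.
  by apply: smooth_pderiv; case: (tw i).
by rewrite big1// => i _; rewrite HU.
Qed.

Lemma div_lapl (f v : E -> R) x : smooth_fun f -> smooth_fun v ->
  \sum_i pderiv i (fun y => f y * pderiv i v y + - 1 * (v y * pderiv i f y)) x =
  f x * lapl v x - v x * lapl f x.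
Proof.
move=> sf sv; rewrite /lapl !mulr_sumr -sumrB; apply: eq_bigr => i _.
have s1 := smooth_pderiv i sf; have s2 := smooth_pderiv i sv.
rewrite (pderivD _ _ (smoothM sf s2) (smoothZ _ (smoothM sv s1))).
rewrite (pderivZ _ _ _ (smoothM sv s1)) (pderivM _ _ sf s2) (pderivM _ _ sv s1).
move: (f x) (v x) (pderiv i f x) (pderiv i v x) (pderiv i (pderiv i v) x) (pderiv i (pderiv i f) x).
by move=> a b c d e g; ring.
Qed.

(** A component of the field f grad v - v grad f, whose divergence is the integrand of Green's
    identity; f alone supplies the compact support. *)
Lemma test_wronskian V (f v : E -> R) i : test_fun V f -> smooth_fun v ->
  test_fun V (fun y => f y * pderiv i v y + - 1 * (v y * pderiv i f y)).
Proof.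
move=> tf sv; apply: testD; first exact: (test_mull tf (smooth_pderiv i sv)).
apply: testZ; have := test_mull (test_pderiv i tf) sv.
by rewrite (_ : (fun y => pderiv i f y * v y) = fun y => v y * pderiv i f y)//;
  apply/funext => y; rewrite mulrC.
Qed.

Lemma green_real (f v : E -> R) : test_fun (Om G) f -> smooth_fun v ->
  Rintegral lam U (fun x => f x * lapl v x - v x * lapl f x) =
  Rintegral (area Sig) setT (fun x : B => eps * (f x * ndiff v x - v x * ndiff f x)).
Proof.
move=> tf sv; have [sf _] := tf.
under eq_Rintegral do rewrite -div_lapl//.
rewrite (divergence_Sig (fun i => test_wronskian i tf sv)).
apply: eq_Rintegral => x _; congr (_ * _); rewrite /ndiff !mulr_sumr -sumrB; apply: eq_bigr => i _.
by ring.
Qed.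

Lemma green_test (f v : E -> R) : test_fun U f -> smooth_fun v ->
  Rintegral lam U (fun x => f x * lapl v x - v x * lapl f x) = 0.
Proof.
move=> tf sv; have [sf _] := tf.
under eq_Rintegral do rewrite -div_lapl//.
exact: (divergence_test (fun i => test_wronskian i tf sv)).
Qed.

Lemma smooth_sum (s : seq 'I_n) (h : 'I_n -> E -> R) : (forall i, smooth_fun (h i)) ->
  smooth_fun (fun x => \sum_(i <- s) h i x).
Proof.
move=> sh; elim: s => [|i s IH].
  by under eq_fun do rewrite big_nil; exact: smooth_cst.
by under eq_fun do rewrite big_cons; apply: smoothD.
Qed.

Lemma smooth_lapl (f : E -> R) : smooth_fun f -> smooth_fun (lapl f).
Proof. by move=> sf; apply: smooth_sum => i; exact: (smooth_pderiv i (smooth_pderiv i sf)).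
Qed.

Lemma weak_lapP u l : weak_lap lam U u l <-> inL2 lam U l /\
  forall f, test_fun U f ->
    bil lam U u (fun x => (lapl f x)%:C%C) = bil lam U l (fun x => (f x)%:C%C).
Proof. by []. Qed.

Lemma lapl_cst c x : @lapl R n (fun=> c) x = 0.
Proof.
rewrite /lapl big1// => i _.
have -> : pderiv i (fun _ : E => c) = fun=> 0 by apply/funext => y; exact: pderiv_cst.
exact: pderiv_cst.
Qed.

Definition laplC (v : F) : F := fun x =>
  Complex (lapl (fun y => complex.Re (v y)) x) (lapl (fun y => complex.Im (v y)) x).

Lemma laplC_real (f : E -> R) : laplC (fun x => (f x)%:C%C) = fun x => (lapl f x)%:C%C.
Proof.
apply/funext => x; apply: eq_CReIm; first by [].
exact: (lapl_cst 0 x).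
Qed.

Lemma ndiff_cst c x : ndiff (fun=> c) x = 0.
Proof. by rewrite /ndiff big1// => i _; rewrite pderiv_cst mulr0. Qed.

Lemma ReB_real (l v : R[i]) (f g : R) :
  complex.Re (l * f%:C%C) - complex.Re (v * g%:C%C) = f * complex.Re l - complex.Re v * g.
Proof. by rewrite !CReM !CReC !CImC !mulr0 !subr0 (mulrC _ f). Qed.

Lemma ImB_real (l v : R[i]) (f g : R) :
  complex.Im (l * f%:C%C) - complex.Im (v * g%:C%C) = f * complex.Im l - complex.Im v * g.
Proof. by rewrite !CImM !CReC !CImC !mulr0 !add0r (mulrC _ f). Qed.

Local Opaque lapl ndiff.

Lemma L2_csmooth v : csmooth v -> inL2 lam U v.
Proof.
move=> [/smooth_continuous c1 /smooth_continuous c2].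
have L1 := L2_continuous oU bU c1; have L2' := L2_continuous oU bU c2.
rewrite (_ : v = fun x => (complex.Re (v x))%:C%C + 'i%C * (complex.Im (v x))%:C%C).
  exact: L2_comb.
by apply/funext => x; apply: eq_CReIm; rewrite /= !(mul0r, mulr0, mul1r, addr0, add0r, subr0).
Qed.

Lemma L2_laplC v : csmooth v -> inL2 lam U (laplC v).
Proof. by move=> [h1 h2]; apply: L2_csmooth; split; exact: smooth_lapl. Qed.

Lemma L2S_ndiff (c : R) (f : E -> R) : smooth_fun f ->
  inL2 (area Sig) setT (fun x => (c * ndiff f x)%:C%C).
Proof.
move=> sf; have csf : csmooth (fun x => (f x)%:C%C).
  by split; [exact: sf|exact: (smooth_cst 0)].
have := L2S_flux regular_Sig c csf.
rewrite (_ : flux Sig c _ = (fun x => (c * ndiff f x)%:C%C))//.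
apply/funext => x; apply: eq_CReIm; first by rewrite flux_Re.
by rewrite flux_Im /= ndiff_cst mulr0.
Qed.

(** The test function is real, so the identity splits into [green_real] for the two components of
    v. *)
Lemma green_csmooth v (f : E -> R) : csmooth v -> test_fun (Om G) f ->
  bil lam U (laplC v) (fun x => (f x)%:C%C) - bil lam U v (fun x => (lapl f x)%:C%C) =
  surf_pair Sig (flux Sig eps v) (fun x => (f x)%:C%C) -
  bil (area Sig) setT v (fun x => (eps * ndiff f x)%:C%C).
Proof.
move=> cv tf; have [sa sb] := cv; have [sf _] := tf.
have Lf := L2_continuous oU bU (smooth_continuous sf).
have Llf := L2_continuous oU bU (smooth_continuous (smooth_lapl sf)).
have Lv := L2_csmooth cv; have Llv := L2_laplC cv.
have [i1 i2] := L2_mul_integrable mU Llv Lf.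
have [i3 i4] := L2_mul_integrable mU Lv Llf.
have r := regular_Sig.
have LSv := csmooth_cont r cv.
have LSf := L2S_continuous r (smooth_continuous sf).
have LSn := L2S_ndiff eps sf.
have [j1 j2] := L2_mul_integrable measurableT (L2S_flux r eps cv) LSf.
have [j3 j4] := L2_mul_integrable measurableT LSv LSn.
apply: eq_CReIm.
  rewrite !CReD !CReN /bil /surf_pair !Re_cint -!RintegralB//.
  transitivity (Rintegral lam U (fun x : B => f x * complex.Re (laplC v x) - complex.Re (v x) * lapl f x)); first by apply: eq_Rintegral => x _; exact: ReB_real.
  rewrite [LHS](green_real tf sa); apply: eq_Rintegral => x _.
  by rewrite ReB_real flux_Re mulrBr (mulrCA eps (f x)) (mulrCA eps (complex.Re (v x))).
rewrite !CImD !CImN /bil /surf_pair !Im_cint -!RintegralB//.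
transitivity (Rintegral lam U (fun x : B => f x * complex.Im (laplC v x) - complex.Im (v x) * lapl f x)); first by apply: eq_Rintegral => x _; exact: ImB_real.
rewrite [LHS](green_real tf sb); apply: eq_Rintegral => x _.
by rewrite ImB_real flux_Im mulrBr (mulrCA eps (f x)) (mulrCA eps (complex.Im (v x))).
Qed.

Lemma weak_lap_csmooth v : csmooth v -> weak_lap lam U v (laplC v).
Proof.
move=> cv; apply/weak_lapP; split; first exact: L2_laplC.
move=> f tf; have [sa sb] := cv; have [sf _] := tf.
have Lf := L2_continuous oU bU (smooth_continuous sf).
have Llf := L2_continuous oU bU (smooth_continuous (smooth_lapl sf)).
have Lv := L2_csmooth cv; have Llv := L2_laplC cv.
have [i1 i2] := L2_mul_integrable mU Llv Lf.
have [i3 i4] := L2_mul_integrable mU Lv Llf.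
apply/eqP; rewrite -subr_eq0; apply/eqP; rewrite -[LHS]opprK opprB -[RHS]oppr0; congr (- _).
apply: eq_CReIm.
  rewrite CReD CReN /bil !Re_cint -!RintegralB// -[RHS](green_test tf sa).
  by apply: eq_Rintegral => x _; exact: ReB_real.
rewrite CImD CImN /bil !Im_cint -!RintegralB// -[RHS](green_test tf sb).
by apply: eq_Rintegral => x _; exact: ImB_real.
Qed.

End OneSided.
End GaussGreen.

Local Opaque sqHDelta sqHb sqH sqL2 sqSlob cintegral pderiv lapl ndiff.
(** The fundamental lemma of the calculus of variations for U, in the form in which it is used; it
    is deduced below from a self-adjoint Dirichlet Laplacian. *)
Definition weak_lap_unique (R : realType) (n : nat)
    (lam : {measure set (borelT R n) -> \bar R}) U := forall u l l' : fn R n,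
  weak_lap lam U u l -> weak_lap lam U u l' -> ae_eq_on lam U l l'.

(** * Change of order, and Green's identity for Neumann traces *)

Section GreenTrace.
Variables (R : realType) (n : nat) (G : transmission R n).
Notation E := 'rV[R]_n.
Notation B := (borelT R n).
Notation F := (fn R n).
Notation lam := (lebn G).
Notation Sig := (Sig G).
Notation dOm := (dOm G).

Section Levels.
Variables (U : set E) (S : surface R n).
Hypothesis oU : open U.
Hypothesis bU : bounded_set U.
Hypothesis regS : regular_surface S.
Let mU : measurable (U : set B) := open_meas oU.
Let fU : (lam U < +oo)%E := lebesgue_bounded (@lamP _ _ G) mU bU.

Lemma null_seq_level s s' (w : nat -> F) : 1 <= s' <= s ->
  null_seq (sqHDelta lam s U) w -> null_seq (sqHDelta lam s' U) w.
Proof.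
move=> ss; have [d d1 Hd] := bounded_diam bU.
have [C C1 HC] := sqHDelta_mono (lam := lam) oU fU (dim_gt0 G) ss d1 Hd.
move/(null_seqP _ (qnorm_sqHDelta oU fU s)) => H.
apply/(null_seqP _ (qnorm_sqHDelta oU fU s')) => e e0.
have p : 0 < e / C by rewrite divr_gt0// (lt_le_trans _ C1).
apply: filterS (H _ p) => k hk; apply: le_trans (HC _) _.
apply: (@le_trans _ _ (C%:E * (e / C)%:E)%E).
  by apply: lee_wpmul2l => //; rewrite lee_fin (le_trans _ C1).
by rewrite -EFinM lee_fin mulrCA divff ?mulr1// gt_eqF// (lt_le_trans _ C1).
Qed.

Lemma in_HDelta_level s s' u : 1 <= s' <= s -> in_HDelta lam s U u ->
  in_HDelta lam s' U u.
Proof.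
move=> ss; have [d d1 Hd] := bounded_diam bU.
have [C C1 HC] := sqHDelta_mono (lam := lam) oU fU (dim_gt0 G) ss d1 Hd.
move=> hu; apply: le_lt_trans (HC u) _.
by apply: lte_mul_pinfty => //; rewrite lee_fin (le_trans _ C1).
Qed.

Lemma null_seq_L2_unique (mu : {measure set B -> \bar R}) (D : set E) (w : nat -> F) a b :
  measurable (D : set B) ->
  null_seq (sqL2 mu D) (fun k => fsub (w k) a) ->
  null_seq (sqL2 mu D) (fun k => fsub (w k) b) -> ae_eq_on mu D a b.
Proof.
move=> mD; have q := qnorm_sqL2 mu mD.
move=> /(null_seqP _ q) Ha /(null_seqP _ q) Hb.
have z : sqL2 mu D (fsub a b) = 0%E.
  apply/eqP; rewrite eq_le sqL2_ge0 andbT; apply/lee_addgt0Pr => e e0; rewrite add0e.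
  have p : 0 < e / 4 by rewrite divr_gt0.
  have [k [h1 h2]] := filter_ex (filterI (Ha _ p) (Hb _ p)).
  have := @qnormB _ _ (sqL2 mu D) (fsub (w k) b) (fsub (w k) a) q
    (le_lt_trans h2 (ltry _)) (le_lt_trans h1 (ltry _)).
  rewrite (_ : fsub (fsub (w k) b) (fsub (w k) a) = fsub a b); last first.
    by apply/funext => x; rewrite /fsub; ring.
  move=> h; apply: le_trans h _.
  apply: (@le_trans _ _ (2%:E * (e / 4)%:E + 2%:E * (e / 4)%:E)%E).
    by apply: leeD; apply: lee_wpmul2l => //; rewrite lee_fin.
  by rewrite -!EFinM -EFinD lee_fin; lra.
apply: (aeS _ (sqL2_eq0_ae mD z)) => x + Dx => /(_ Dx).
by rewrite /fsub => /eqP; rewrite subr_eq0 => /eqP.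
Qed.

Lemma null_seq_Hb_L2 t (w : nat -> F) : null_seq (sqHb S t) w ->
  null_seq (sqL2 (area S) setT) w.
Proof.
move/(null_seqP _ (qnorm_sqHb regS t)) => H.
apply/(null_seqP _ (qnorm_sqL2 _ measurableT)) => e e0.
by apply: filterS (H _ e0) => k; apply: le_trans; exact: sqL2_le_sqHb.
Qed.

(** One smooth sequence approximates u at both orders, and its restrictions to S have both traces as
    limits in L^2(S). Needed since B is posed at order 3/2 and A at order s. *)
Lemma gammaD_level s s' u : 1 <= s' <= s ->
  dirichlet_trace_bounded lam s U S -> dirichlet_trace_bounded lam s' U S ->
  in_HDelta lam s U u ->
  ae_eq_on (area S) setT (dirichlet_trace lam s' U S u) (dirichlet_trace lam s U S u).
Proof.
move=> ss b b' hu; have hu' := in_HDelta_level ss hu.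
have /dtraceP[v [sv vu vt]] := gammaD_spec b hu.
have vt' := dtrace_L2_approx oU fU regS b' hu' sv (null_seq_level ss vu).
exact: (null_seq_L2_unique measurableT (null_seq_Hb_L2 vt') (null_seq_Hb_L2 vt)).
Qed.

End Levels.

Section OneSided.
Variables (U : set E) (eps : R).
Hypothesis sU : one_sided G U eps.
Let oU : open U. Proof. by case: sU. Qed.
Let bU : bounded_set U. Proof. by case: sU. Qed.
Let mU : measurable (U : set B) := open_meas oU.
Let fU : (lam U < +oo)%E := lebesgue_bounded (@lamP _ _ G) mU bU.

Lemma weak_partial_test (f : E -> R) i : test_fun (Om G) f ->
  weak_partial lam U i (fun x => (f x)%:C%C) (fun x => (pderiv i f x)%:C%C).
Proof.
move=> tf; have [sf _] := tf; split; first exact: (L2_test mU fU (test_pderiv i tf)).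
move=> g tg; have [sg _] := tg.
have [_ _ H _] := sU.
have C h : continuous h -> lam.-integrable (U : set B) (EFin \o (h : B -> R)).
  exact: cont_integrable.
have cM (h k : E -> R) : smooth_fun h -> smooth_fun k -> continuous (fun x => h x * k x).
  by move=> sh sk; apply: smooth_continuous; exact: smoothM.
have sgi := smooth_pderiv i sg; have sfi := smooth_pderiv i sf.
have ef : pderiv i (fun x => g x * f x) = fun x => g x * pderiv i f x + f x * pderiv i g x.
  by apply/funext => x; exact: pderivM.
have := H i _ (test_mull tg sf); rewrite ef.
rewrite RintegralD//; [|exact: C (cM _ _ sg sfi)|exact: C (cM _ _ sf sgi)].
move=> /eqP; rewrite addrC addr_eq0 => /eqP e.
have Rr (h k : E -> R) : cintegral lam U (fun x => (h x)%:C%C * (k x)%:C%C) =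
    (Rintegral lam U (fun x : B => h x * k x))%:C%C.
  apply: eq_CReIm; rewrite ?Re_cint ?Im_cint ?CReC ?CImC.
    by apply: eq_Rintegral => x _; rewrite CReM !CReC !CImC mulr0 subr0.
  transitivity (Rintegral lam U (fun=> 0 : R)); last by rewrite Rintegral_cst// mul0r.
  by apply: eq_Rintegral => x _; rewrite CImM !CReC !CImC mulr0 mul0r addr0.
by rewrite !Rr e rmorphN; congr (- _%:C%C); apply: eq_Rintegral => x _; exact: mulrC.
Qed.

Lemma csmooth_real (f : E -> R) : smooth_fun f -> @csmooth R n (fun x => (f x)%:C%C).
Proof. by move=> sf; split; [exact: sf|exact: (smooth_cst 0)]. Qed.

Lemma test_in_HDelta (f : E -> R) : test_fun (Om G) f ->
  in_HDelta lam (3 / 2) U (fun x => (f x)%:C%C).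
Proof.
move=> tf; have [sf _] := tf.
have wl := weak_lap_csmooth sU (csmooth_real sf).
Local Transparent sqHDelta sqH.
have s0 : ((3 : R) / 2 < 1) = false by apply/negbTE; rewrite -leNgt; lra.
rewrite /in_HDelta /sqHDelta /sqH s0; apply: le_lt_trans (ereal_inf_lbound _) _; first by exists (laplC (fun x : E => (f x)%:C%C)); [exact: wl|reflexivity].
apply: lte_add_pinfty; last exact: (L2_laplC sU (csmooth_real sf)).
apply: le_lt_trans (ereal_inf_lbound _) _.
  by exists (fun i x => (pderiv i f x)%:C%C); [move=> i; exact: weak_partial_test|reflexivity].
apply: lte_add_pinfty; first exact: (L2_test mU fU tf).
apply: lte_sum_pinfty => i _.
exact: (test_sqSlob_half (@lamP _ _ G) (dim_gt0 G) mU bU (test_pderiv i tf)).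
Qed.
Local Opaque sqHDelta sqH.

(** A smooth function is its own trace, and boundedness of the trace at order 3/2 lands in order 1;
    no tangential derivative has to be computed. *)
Lemma test_in_Hb1 (f : E -> R) : dirichlet_trace_bounded lam (3 / 2) U Sig ->
  test_fun (Om G) f -> in_Hb Sig 1 (fun x => (f x)%:C%C).
Proof.
move=> b tf; have [sf _] := tf.
rewrite (_ : 1 = 3 / 2 - 1 / 2); last by field.
apply: (dtrace_bound oU fU b (test_in_HDelta tf)).
exact: (dtrace_smooth _ oU fU (@regular_Sig _ _ G) (csmooth_real sf)).
Qed.

(** The norm is an infimum that need not be attained; the factor 2 buys the strict inequality from
    which a witness is extracted. *)
Lemma weak_lap_small s u (e : R) : 0 < e -> (sqHDelta lam s U u <= e%:E)%E ->
  exists2 l, weak_lap lam U u l & (sqL2 lam U l <= (2 * e)%:E)%E.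
Proof.
Local Transparent sqHDelta.
rewrite /sqHDelta => e0 h.
have lt : (ereal_inf [set (sqH lam s U u + sqL2 lam U l)%E | l in weak_lap lam U u] < (2 * e)%:E)%E.
  by apply: le_lt_trans h _; rewrite lte_fin; lra.
have [_ [l wl <-] hl] := ereal_inf_lt lt.
exists l => //; apply: le_trans (ltW hl); rewrite leeDr//.
by apply: le_trans (sqL2_le_sqH _ _ _ _); exact: sqL2_ge0.
Qed.
Local Opaque sqHDelta.

Lemma csq_sum4 (a b c d : R[i]) :
  csq (a + b + (c + d)) <= 4 * csq a + 4 * csq b + (4 * csq c + 4 * csq d).
Proof.
have := csqD_le (a + b) (c + d); have := csqD_le a b; have := csqD_le c d; lra.
Qed.

(** Green's identity for smooth approximants of u, in the limit: the flux term tends to the Neumann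
    trace at f, and the term with the normal derivative of f vanishes since u has Dirichlet trace 0
    on Sigma. *)
Lemma green_trace s u l (f : E -> R) : weak_lap_unique lam U ->
  dirichlet_trace_bounded lam s U Sig -> neumann_trace_bounded lam s U Sig eps ->
  in_HDelta lam s U u -> weak_lap lam U u l ->
  ae_eq_on (area Sig) setT (dirichlet_trace lam s U Sig u) (fun=> 0) ->
  test_fun (Om G) f -> in_Hb Sig (3 / 2 - s) (fun x => (f x)%:C%C) ->
  neumann_trace lam s U Sig eps u (fun x => (f x)%:C%C) =
  bil lam U l (fun x => (f x)%:C%C) - bil lam U u (fun x => (lapl f x)%:C%C).
Proof.
move=> wu db nb hu wl d0 tf hf; have r := @regular_Sig _ _ G.
have [sf _] := tf.
set f1 : F := fun x => (f x)%:C%C; set f2 : F := fun x => (lapl f x)%:C%C.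
set f3 : F := fun x => (eps * ndiff G f x)%:C%C.
have Lf1 : inL2 lam U f1 by exact: (L2_test mU fU tf).
have Lf2 : inL2 lam U f2 by exact: (L2_test mU fU (test_lapl tf)).
have Lu := in_HDelta_L2 hu; have [Ll _] := wl.
have csf := csmooth_real sf.
have Lf3 : inL2 (area Sig) setT f3 := L2S_ndiff G eps sf.
have [v [sv vu vT]]
  := (ntraceP _ _ _ _ _ _ _).1 (gammaN_spec nb hu).
have vS := null_seq_Hb_L2 r (dtrace_L2_approx oU fU r db hu sv vu).
set T := neumann_trace _ _ _ _ _ _ in vT *.
pose Nb := fine (sqHb Sig (3 / 2 - s) f1).
have NbE : sqHb Sig (3 / 2 - s) f1 = Nb%:E.
  rewrite fineK// ge0_fin_numE//; have [q _ _] := qnorm_sqHb r (3 / 2 - s); exact: q.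
(* One summand for each of the four errors below; 4 comes from [csq_sum4], and 2 from
   [weak_lap_small]. *)
pose K := 4 * (Nb + 2 * N2 lam U f1 + N2 lam U f2 + N2 (area Sig) setT f3).
apply/eqP; rewrite -subr_eq0; apply/eqP; apply: (@csq_small _ _ K) => e e0.
move/(null_seqP _ (qnorm_sqHDelta oU fU s)): vu => vu.
move/(null_seqP _ (qnorm_sqL2 _ measurableT)): vS => vS.
have [k [[k1 k2] k3]] := filter_ex (filterI (filterI (vu _ e0) (vT _ e0)) (vS _ e0)).
have {k2} := k2 f1 hf; rewrite NbE -EFinM lee_fin => k2.
have [l' wl' hl'] := weak_lap_small e0 k1.
have Lv := L2_csmooth sU (sv k); have Llv := L2_laplC sU (sv k).
have Lvu : inL2 lam U (fsub (v k) u) by exact: L2B.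
have [Ll' _] := wl'.
have wv := weak_lap_comb oU fU 1 Lvu Lu wl' wl.
have ev : (fun x => fsub (v k) u x + 1 * u x) = v k.
  by apply/funext => x; rewrite /fsub; ring.
rewrite ev in wv.
(* The classical Laplacian of [v k] and l' + l are both weak Laplacians of [v k], hence equal almost
   everywhere. *)
have ae := wu _ _ _ (weak_lap_csmooth sU (sv k)) wv.
have e1 : bil lam U (laplC (v k)) f1 = bil lam U l' f1 + 1 * bil lam U l f1.
  have er : ae_eq_on lam U f1 f1 by apply: aeW.
  by rewrite (bil_ae ae er) bil_combl.
have e2 : bil lam U (v k) f2 = bil lam U (fsub (v k) u) f2 + 1 * bil lam U u f2.
  by rewrite -{1}ev bil_combl.
have := green_csmooth sU (sv k) tf; rewrite -/f1 -/f2 -/f3 e1 e2 => gr.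
have LSv := csmooth_cont r (sv k).
have -> : T f1 - (bil lam U l f1 - bil lam U u f2) =
   - (surf_pair Sig (flux Sig eps (v k)) f1 - T f1) + bil lam U l' f1
   + (- bil lam U (fsub (v k) u) f2 + bil (area Sig) setT (v k) f3).
  move: gr; move: (surf_pair _ _ _) (T f1) (bil _ _ _ _) (bil _ _ _ _) (bil _ _ _ _) (bil _ _ _ _) (bil _ _ _ _).
  move=> a b c d g h i; rewrite !mul1r => H.
  have -> : a = i + h - (g + d) + c by rewrite H subrK.
  by ring.
apply: le_trans (csq_sum4 _ _ _ _) _; rewrite !csqN.
have c1 : csq (bil lam U l' f1) <= 2 * e * N2 lam U f1.
  apply: le_trans (cauchy_schwarz mU Ll' Lf1) _; rewrite ler_wpM2r ?N2_ge0//.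
  by rewrite -lee_fin -N2E.
have c2 : csq (bil lam U (fsub (v k) u) f2) <= e * N2 lam U f2.
  apply: le_trans (cauchy_schwarz mU Lvu Lf2) _; rewrite ler_wpM2r ?N2_ge0//.
  by rewrite -lee_fin -N2E//; apply: le_trans k1; exact: sqL2_le_sqHDelta.
have k4 := inL2_mfn (le_lt_trans k3 (ltry _)).
have c3 : csq (bil (area Sig) setT (v k) f3) <= e * N2 (area Sig) setT f3.
  apply: le_trans (cauchy_schwarz measurableT LSv Lf3) _; rewrite ler_wpM2r ?N2_ge0//.
  rewrite -lee_fin -N2E//; apply: le_trans k3.
  rewrite le_eqVlt; apply/orP; left; apply/eqP; apply: sqL2_ae => //.
  - exact: inL2_mfn LSv.
  - by apply: (aeS _ d0) => x + Dx => /(_ Dx); rewrite /fsub => ->; rewrite subr0.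
by move: k2 c1 c2 c3; rewrite /K; nra.
Qed.

End OneSided.
End GreenTrace.

(** * Gluing along two disjoint sets *)

Section Pieces.
Variables (R : realType) (n : nat).
Notation E := 'rV[R]_n.
Notation B := (borelT R n).
Notation F := (fn R n).
Notation meas := {measure set (borelT R n) -> \bar R}.

Lemma mfn_eq (D : set E) u v : (forall x, D x -> u x = v x) -> mfn D u -> @mfn R n D v.
Proof.
move=> uv [h1 h2]; split; [apply: eq_measurable_fun h1|apply: eq_measurable_fun h2].
  by move=> x /set_mem Dx; rewrite uv.
by move=> x /set_mem Dx; rewrite uv.
Qed.

Lemma weak_lap_ael (lam : meas) U u v l : ae_eq_on lam U u v ->
  weak_lap lam U u l -> weak_lap lam U v l.
Proof.
move=> uv [Ll wl]; split => // f tf; rewrite -wl//.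
by apply: bil_ae; [apply: aeS uv => x h /h|apply: aeW].
Qed.

Lemma sqHDelta_ae (lam : meas) s U u v : open U -> (lam U < +oo)%E -> 1 <= s ->
  mfn U u -> mfn U v -> ae_eq_on lam U u v -> sqHDelta lam s U (fsub u v) = 0%E.
Proof.
move=> oU fU s1 mu mv uv; apply: sqHDelta_ae0 => //.
  by apply: mfnD => //; exact: mfnN.
by apply: aeS uv => x h Ux; rewrite /fsub h// subrr.
Qed.

Section TwoPieces.
Variables (lam : meas) (U V : set E).
Hypothesis mU : measurable (U : set B).
Hypothesis mV : measurable (V : set B).
Hypothesis disj : forall x, U x -> ~ V x.

Lemma ae_setU u v : ae_eq_on lam (U `|` V) u v <->
  ae_eq_on lam U u v /\ ae_eq_on lam V u v.
Proof.
split=> [h|[h1 h2]]; last by apply: aeS2 h1 h2 => x a b [/a|/b].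
by split; apply: aeS h => x a Dx; apply: a; [left|right].
Qed.

Lemma mfn_setU u : mfn (U `|` V) u <-> mfn U u /\ mfn V u.
Proof.
split=> [h|[[a b] [c d]]]; last by split; apply/measurable_funU.
by split; apply: mfnS h; try exact: measurableU; move=> x; [left|right].
Qed.

Local Transparent sqL2.
Lemma sqL2_setU u : sqL2 lam (U `|` V) u = (sqL2 lam U u + sqL2 lam V u)%E.
Proof.
have [m|nm] := pselect (mfn (U `|` V) u).
  have [m1 m2] := (mfn_setU u).1 m.
  rewrite !sqL2E// ge0_integral_setU//.
  - by apply/measurable_EFinP; exact: mfn_csq.
  - by move=> x _; rewrite lee_fin csq_ge0.
  - by apply/disj_setPS => x [/disj].
have e D : ~ mfn D u -> sqL2 lam D u = +oo%E.
  by move=> h; rewrite /sqL2 asboolF.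
rewrite e//; have [m1|n1] := pselect (mfn U u); last first.
  by rewrite (e _ n1) addye// gt_eqF// (lt_le_trans (ltNyr 0))// sqL2_ge0.
have [m2|n2] := pselect (mfn V u); first by case: nm; apply/mfn_setU.
by rewrite (e _ n2) addey// gt_eqF// (lt_le_trans (ltNyr 0))// sqL2_ge0.
Qed.
Local Opaque sqL2.

Lemma inL2_setU u : inL2 lam (U `|` V) u <-> inL2 lam U u /\ inL2 lam V u.
Proof.
rewrite /inL2 sqL2_setU; split=> [h|[h1 h2]]; last exact: lte_add_pinfty.
by split; apply: le_lt_trans h; rewrite ?leeDl ?leeDr ?sqL2_ge0.
Qed.

Lemma bil_setU u v : inL2 lam (U `|` V) u -> inL2 lam (U `|` V) v ->
  bil lam (U `|` V) u v = bil lam U u v + bil lam V u v.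
Proof.
move=> Lu Lv; have [i1 i2] := L2_mul_integrable (measurableU _ _ mU mV) Lu Lv.
have d : [disjoint U & V] by apply/disj_setPS => x [/disj].
by apply: eq_CReIm; rewrite ?CReD ?CImD !(Re_cint, Im_cint) Rintegral_setU.
Qed.

(** A pair of functions on the two sides is one total function; this glues solutions that were found
    or chosen separately. *)
Definition piecewise (u v : F) : F := fun x => if `[< V x >] then v x else u x.

Lemma piecewiseU u v x : U x -> piecewise u v x = u x.
Proof. by move=> /disj nV; rewrite /piecewise asboolF. Qed.

Lemma piecewiseV u v x : V x -> piecewise u v x = v x.
Proof. by move=> Vx; rewrite /piecewise asboolT. Qed.

End TwoPieces.
End Pieces.

(** * Dirichlet Laplacians *)

Section DirichletRealization.
Variables (R : realType) (n : nat).
Notation E := 'rV[R]_n.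
Notation B := (borelT R n).
Notation F := (fn R n).
Notation meas := {measure set (borelT R n) -> \bar R}.
Variables (lam : meas) (U : set E) (s : R) (Z : F -> Prop) (T : operator R n).
Hypothesis s1 : 1 <= s.
Hypothesis oU : open U.
Hypothesis fU : (lam U < +oo)%E.
Let mU : measurable (U : set B) := open_meas oU.
(** Z stands for vanishing Dirichlet traces: on Sigma and the outer boundary for Omega_+, on Sigma
    for Omega_-. Abstracting it treats both Dirichlet Laplacians at once. *)
Hypothesis Z_comb : forall u v c, in_HDelta lam s U u -> in_HDelta lam s U v ->
  Z u -> Z v -> Z (fun x => u x + c * v x).
Hypothesis Z_cong : forall u v, in_HDelta lam s U u ->
  sqHDelta lam s U (fsub u v) = 0%E -> Z u -> Z v.
Hypothesis Z0 : Z (fun=> 0).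
Hypothesis TE : forall u f, T u f <-> [/\ in_HDelta lam s U u, Z u
  & exists2 l, weak_lap lam U u l & ae_eq_on lam U f (fun x => - l x)].

Lemma dir_comb u f v g c : T u f -> T v g ->
  T (fun x => u x + c * v x) (fun x => f x + c * g x).
Proof.
move=> /TE[hu zu [l wl fl]] /TE[hv zv [m wm gm]]; apply/TE; split.
- exact: in_HDelta_comb.
- exact: Z_comb.
exists (fun x => l x + c * m x).
  exact: (weak_lap_comb oU fU c (in_HDelta_L2 hu) (in_HDelta_L2 hv) wl wm).
by apply: aeS2 fl gm => x a b Ux; rewrite a// b// mulrN opprD.
Qed.

Lemma dir_L2 u f : T u f -> inL2 lam U u.
Proof. by move=> /TE[/in_HDelta_L2]. Qed.

Lemma dir_rep u f : T u f -> exists f0, [/\ inL2 lam U f0, ae_eq_on lam U f f0 & T u f0].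
Proof.
move=> /TE[hu zu [l wl fl]]; exists (fun x => - l x); split => //.
  by apply: L2N => //; case: wl.
by apply/TE; split => //; exists l => //; apply: aeW.
Qed.

Lemma dir_aer u f f' : T u f -> ae_eq_on lam U f f' -> T u f'.
Proof.
move=> /TE[hu zu [l wl fl]] ff; apply/TE; split => //; exists l => //.
by apply: aeS2 fl ff => x a b Ux; rewrite -b// a.
Qed.

Lemma dir_ael u u' f : T u f -> mfn U u' -> ae_eq_on lam U u u' -> T u' f.
Proof.
move=> Tuf mu' uu; have mu := inL2_mfn (dir_L2 Tuf).
move: Tuf => /TE[hu zu [l wl fl]].
have z := sqHDelta_ae oU fU s1 mu mu' uu.
apply/TE; split.
- exact: in_HDelta_transfer z hu.
- exact: Z_cong z zu.
- by exists l => //; apply: weak_lap_ael wl.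
Qed.

Lemma dir_0 l : weak_lap lam U (fun=> 0) l -> T (fun=> 0) (fun x => - l x).
Proof.
move=> wl; apply/TE; split => //.
  by rewrite /in_HDelta; have [_ -> _] := qnorm_sqHDelta oU fU s.
by exists l => //; apply: aeW.
Qed.

(* An ambiguity d of the weak Laplacian gives T 0 = - d, which symmetry and
   density of the domain exclude. *)
Lemma dir_weak_lap_unique : self_adjoint lam U T -> weak_lap_unique lam U.
Proof.
move=> [dense sym _] u l l' [Ll wl] [Ll' wl'].
pose d : F := fun x => l x - l' x.
have Ld : inL2 lam U d by exact: L2B.
have wd : weak_lap lam U (fun=> 0) d.
  split => // f tf.
  have Lf : inL2 lam U (fun x => (f x)%:C%C) by exact: (L2_test mU fU tf).
  transitivity (0 : R[i]); first exact: bil0l.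
  transitivity (bil lam U d (fun x => (f x)%:C%C)); last by [].
  rewrite bilBl//; have e1 := wl f tf; have e2 := wl' f tf.
  by rewrite -[bil lam U l _]e1 -[bil lam U l' _]e2 subrr.
have T0 := dir_0 wd.
have LJ := L2J Ld.
have N0 : N2 lam U d = 0.
  suff : (((N2 lam U d)%:C)%C : R[i]) = 0 by move/(congr1 (@complex.Re R)).
  rewrite -bil_self//; apply: (@csq_small _ _ (N2 lam U d)) => e e0.
  have [v [g [Tvg hv]]] := dense d Ld e e0.
  have Lv := dir_L2 Tvg.
  have h := sym _ _ _ _ Tvg T0.
  have z : bil lam U v (fun x => (d x)^*%C) = 0.
    have : innerL2 lam U g (fun=> 0) = 0.
      rewrite innerE bilC (_ : (fun x => _) = fun=> 0) ?bil0l//.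
      by apply/funext => x; rewrite conjc0.
    rewrite h innerE (_ : (fun x => ((- d x)^*)%C) = (fun x => -1 * (d x)^*%C)); last first.
      by apply/funext => x; rewrite mulN1r; apply: eq_CReIm; rewrite !CE.
    by rewrite bilZr// => /eqP; rewrite mulN1r oppr_eq0 => /eqP.
  rewrite (_ : bil lam U d _ = bil lam U (fun x => d x - v x) (fun x => (d x)^*%C)); last first.
    by rewrite bilBl// z subr0.
  apply: le_trans (cauchy_schwarz mU (L2B mU Ld Lv) LJ) _.
  rewrite N2J ler_wpM2r ?N2_ge0// -lee_fin -N2E//; last exact: L2B.
  exact: ltW.
have := N2_eq0_ae mU Ld N0; apply: aeS => x h Ux.
by have := h Ux; rewrite /d => /eqP; rewrite subr_eq0 => /eqP.
Qed.

Lemma dir_resolvent z f : self_adjoint lam U T -> complex.Im z != 0 -> inL2 lam U f ->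
  exists u g, T u g /\ ae_eq_on lam U f (fun x => g x - z * u x).
Proof.
move=> sa z0 Lf.
have [u [g [Tug _ h]]] := self_adjoint_surjective mU dir_comb dir_L2 dir_rep sa z0 Lf.
by exists u, g.
Qed.

Lemma dir_bound z u g f : self_adjoint lam U T -> T u g -> inL2 lam U f ->
  ae_eq_on lam U f (fun x => g x - z * u x) ->
  complex.Im z ^+ 2 * N2 lam U u <= N2 lam U f.
Proof.
move=> [_ sym _] Tug Lf fg; have [g0 [Lg0 gg0 Tug0]] := dir_rep Tug.
have Lu := dir_L2 Tug.
have := symmetric_im_bound mU dir_L2 z sym Tug0 Lg0.
congr (_ <= _); congr fine; apply: sqL2_ae => //.
- exact: inL2_mfn (L2B mU Lg0 (L2Z mU z Lu)).
- exact: inL2_mfn Lf.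
- by apply: aeS2 fg gg0 => x a b Ux; rewrite a// -b.
Qed.

End DirichletRealization.

Section TraceEquations.
Variables (R : realType) (n : nat).
Notation E := 'rV[R]_n.
Notation B := (borelT R n).
Notation F := (fn R n).
Notation meas := {measure set (borelT R n) -> \bar R}.
Variables (lam : meas) (U : set E) (S : surface R n) (s : R).
Hypothesis oU : open U.
Hypothesis fU : (lam U < +oo)%E.
Hypothesis regS : regular_surface S.
Hypothesis dtb : dirichlet_trace_bounded lam s U S.

Lemma trace_eq_comb u v a b c : in_HDelta lam s U u -> in_HDelta lam s U v ->
  ae_eq_on (area S) setT (dirichlet_trace lam s U S u) a ->
  ae_eq_on (area S) setT (dirichlet_trace lam s U S v) b ->
  ae_eq_on (area S) setT (dirichlet_trace lam s U S (fun x => u x + c * v x))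
    (fun x => a x + c * b x).
Proof.
move=> hu hv ua vb; have h := gammaD_comb oU fU regS dtb c hu hv.
have q : ae_eq_on (area S) setT (fun x => dirichlet_trace lam s U S u x +
    c * dirichlet_trace lam s U S v x) (fun x => a x + c * b x).
  by apply: aeS2 ua vb => x p r Tx; rewrite (p Tx) (r Tx).
by apply: aeS2 h q => x p r Tx; rewrite (p Tx) (r Tx).
Qed.

Lemma trace_eq_cong u v a : in_HDelta lam s U u -> sqHDelta lam s U (fsub u v) = 0%E ->
  ae_eq_on (area S) setT (dirichlet_trace lam s U S u) a ->
  ae_eq_on (area S) setT (dirichlet_trace lam s U S v) a.
Proof.
move=> hu uv ua; have h := gammaD_cong oU fU regS dtb hu uv.
by apply: (aeS2 _ h ua) => x p q Tx; rewrite -(p Tx) q.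
Qed.

Lemma in_HDelta0 : in_HDelta lam s U (fun=> 0).
Proof. by rewrite /in_HDelta; have [_ -> _] := qnorm_sqHDelta oU fU s. Qed.

Lemma trace_eq0 : ae_eq_on (area S) setT (dirichlet_trace lam s U S (fun=> 0)) (fun=> 0).
Proof.
have h0 : @csmooth R n (fun=> 0) by split; exact: (smooth_cst 0).
exact: (gammaD_ae oU fU regS dtb in_HDelta0 (fsubuu _ oU fU _) (dtrace_smooth s oU fU regS h0)).
Qed.

End TraceEquations.

(** * The resolvent set of B *)

Section Transmission.
Variables (R : realType) (n : nat) (G : transmission R n) (mu : R).
Notation E := 'rV[R]_n.
Notation B := (borelT R n).
Notation F := (fn R n).
Notation lam := (lebn G).
Notation Sig := (Sig G).
Notation dOm := (dOm G).
Hypothesis mu0 : mu != 0.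
Hypothesis htr : traces_bounded G.
Hypothesis hsa : dirichlet_laplacians_self_adjoint G.

Lemma oP : open (Omp G). Proof. exact: Omp_open. Qed.
Lemma oM : open (Omm G). Proof. exact: Omm_open. Qed.
Lemma mP : measurable (Omp G : set B). Proof. exact: open_meas oP. Qed.
Lemma mM : measurable (Omm G : set B). Proof. exact: open_meas oM. Qed.
Lemma mBulk : measurable (bulk G : set B).
Proof. by apply: measurableU; [exact: mP|exact: mM]. Qed.
Lemma fP : (lam (Omp G) < +oo)%E.
Proof. exact: (lebesgue_bounded (@lamP _ _ G) mP (@Omp_bounded _ _ G)). Qed.
Lemma fM : (lam (Omm G) < +oo)%E.
Proof. exact: (lebesgue_bounded (@lamP _ _ G) mM (@Omm_bounded _ _ G)). Qed.
Lemma disjPM x : Omp G x -> ~ Omm G x.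
Proof. by move=> [_ h] /subset_closure. Qed.

Lemma dtb_p s : 1 / 2 <= s <= 3 / 2 -> dirichlet_trace_bounded lam s (Omp G) Sig.
Proof. by move=> h; have [] := htr.1 s h. Qed.
Lemma dtb_m s : 1 / 2 <= s <= 3 / 2 -> dirichlet_trace_bounded lam s (Omm G) Sig.
Proof. by move=> h; have [] := htr.1 s h. Qed.
Lemma dtb_bd s : 1 / 2 <= s <= 3 / 2 -> dirichlet_trace_bounded lam s (Omp G) dOm.
Proof. by move=> h; have [] := htr.1 s h. Qed.

Lemma half_three : 1 / 2 <= (3 / 2 : R) <= 3 / 2. Proof. by lra. Qed.
Lemma one_three : 1 <= (3 / 2 : R). Proof. by lra. Qed.

Definition zero_trace_p (u : F) := eq_dOm G (gammaD_bd G (3 / 2) u) (fun=> 0) /\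
  eq_Sig G (gammaD_p G (3 / 2) u) (fun=> 0).
Definition zero_trace_m (u : F) := eq_Sig G (gammaD_m G (3 / 2) u) (fun=> 0).

Lemma zero_comb (S : surface R n) (a : F) c : ae_eq_on (area S) setT a (fun x => 0 + c * 0) ->
  ae_eq_on (area S) setT a (fun=> 0).
Proof. by apply: aeS => x h Tx; rewrite (h Tx) mulr0 addr0. Qed.

Lemma zero_trace_p_comb u v c : in_HDelta lam (3 / 2) (Omp G) u ->
  in_HDelta lam (3 / 2) (Omp G) v -> zero_trace_p u -> zero_trace_p v ->
  zero_trace_p (fun x => u x + c * v x).
Proof.
move=> hu hv [a1 a2] [b1 b2]; split; apply: (@zero_comb _ _ c).
  exact: (trace_eq_comb oP fP (regular_dOm G) (dtb_bd half_three) c hu hv a1 b1).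
exact: (trace_eq_comb oP fP (regular_Sig G) (dtb_p half_three) c hu hv a2 b2).
Qed.

Lemma zero_trace_m_comb u v c : in_HDelta lam (3 / 2) (Omm G) u ->
  in_HDelta lam (3 / 2) (Omm G) v -> zero_trace_m u -> zero_trace_m v ->
  zero_trace_m (fun x => u x + c * v x).
Proof.
move=> hu hv a2 b2; apply: (@zero_comb _ _ c).
exact: (trace_eq_comb oM fM (regular_Sig G) (dtb_m half_three) c hu hv a2 b2).
Qed.

Lemma zero_trace_p_cong u v : in_HDelta lam (3 / 2) (Omp G) u ->
  sqHDelta lam (3 / 2) (Omp G) (fsub u v) = 0%E -> zero_trace_p u -> zero_trace_p v.
Proof.
move=> hu uv [a1 a2]; split.
  exact: (trace_eq_cong oP fP (regular_dOm G) (dtb_bd half_three) hu uv a1).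
exact: (trace_eq_cong oP fP (regular_Sig G) (dtb_p half_three) hu uv a2).
Qed.

Lemma zero_trace_m_cong u v : in_HDelta lam (3 / 2) (Omm G) u ->
  sqHDelta lam (3 / 2) (Omm G) (fsub u v) = 0%E -> zero_trace_m u -> zero_trace_m v.
Proof.
move=> hu uv; exact: (trace_eq_cong oM fM (regular_Sig G) (dtb_m half_three) hu uv).
Qed.

Lemma zero_trace_p0 : zero_trace_p (fun=> 0).
Proof.
split; first exact: (trace_eq0 oP fP (regular_dOm G) (dtb_bd half_three)).
exact: (trace_eq0 oP fP (regular_Sig G) (dtb_p half_three)).
Qed.

Lemma zero_trace_m0 : zero_trace_m (fun=> 0).
Proof. exact: (trace_eq0 oM fM (regular_Sig G) (dtb_m half_three)). Qed.

Lemma dirichlet_pE u f : dirichlet_p G u f <-> [/\ in_HDelta lam (3 / 2) (Omp G) u,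
  zero_trace_p u & exists2 l, weak_lap lam (Omp G) u l &
  ae_eq_on lam (Omp G) f (fun x => - l x)].
Proof. by split=> [[h1 h2 h3 h4]|[h1 [h2 h3] h4]]; split. Qed.

Lemma dirichlet_mE u f : dirichlet_m G u f <-> [/\ in_HDelta lam (3 / 2) (Omm G) u,
  zero_trace_m u & exists2 l, weak_lap lam (Omm G) u l &
  ae_eq_on lam (Omm G) f (fun x => - l x)].
Proof. by []. Qed.

Lemma weak_lap_unique_p : weak_lap_unique lam (Omp G).
Proof. exact: (dir_weak_lap_unique oP fP zero_trace_p0 dirichlet_pE hsa.1). Qed.

Lemma weak_lap_unique_m : weak_lap_unique lam (Omm G).
Proof. exact: (dir_weak_lap_unique oM fM zero_trace_m0 dirichlet_mE hsa.2). Qed.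

Local Notation piecewise := (piecewise (Omm G)).

Lemma ae_piecewise_p u v : ae_eq_on lam (Omp G) u (piecewise u v).
Proof. by apply: aeW => x Px; rewrite (piecewiseU disjPM). Qed.

Lemma ae_piecewise_m u v : ae_eq_on lam (Omm G) v (piecewise u v).
Proof. by apply: aeW => x Mx; rewrite piecewiseV. Qed.

Lemma mfn_piecewise_p u v : mfn (Omp G) u -> mfn (Omp G) (piecewise u v).
Proof. by apply: mfn_eq => x Px; rewrite (piecewiseU disjPM). Qed.

Lemma mfn_piecewise_m u v : mfn (Omm G) v -> mfn (Omm G) (piecewise u v).
Proof. by apply: mfn_eq => x Px; rewrite piecewiseV. Qed.

Lemma divC_real (a : R[i]) : a / (mu%:C)%C = a * ((mu^-1)%:C)%C.
Proof. by rewrite -(fmorphV (real_complex R)). Qed.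

Lemma Im_divC (z : R[i]) : complex.Im (z / (mu%:C)%C) = complex.Im z / mu.
Proof. by rewrite divC_real CImM CReC CImC mulr0 add0r. Qed.

Lemma muC_neq0 : (mu%:C)%C != 0 :> R[i].
Proof. by apply/eqP => /(congr1 (@complex.Re R)) /= /eqP; rewrite (negbTE mu0). Qed.

(** B is a direct sum. On Omega_- the equation is divided by mu and becomes one for the Dirichlet
    Laplacian at z / mu with datum f / mu; the two solutions are glued. *)
Lemma nonreal_resolvent z : complex.Im z != 0 -> ~ spec_B G mu z.
Proof.
move=> z0; have zm0 : complex.Im (z / (mu%:C)%C) != 0.
  by rewrite Im_divC mulf_neq0// invr_eq0.
have L2bulk := inL2_setU lam mP mM disjPM.
apply; split=> [f /L2bulk[Lfp Lfm]|].
  have [up [gp [Tp hp]]] := dir_resolvent oP fP zero_trace_p_comb dirichlet_pE hsa.1 z0 Lfp.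
  have Lfm' := L2Z mM ((mu%:C)%C)^-1 Lfm.
  have [um [gm [Tm hm]]] := dir_resolvent oM fM zero_trace_m_comb dirichlet_mE hsa.2 zm0 Lfm'.
  exists (piecewise up um), (piecewise gp (fun x => (mu%:C)%C * gm x)).
    exists gm; last first.
      by apply: aeW => x Mx; rewrite piecewiseV.
    split.
      apply: (dir_aer dirichlet_pE (f := gp)); last exact: ae_piecewise_p.
      apply: (dir_ael one_three oP fP zero_trace_p_cong dirichlet_pE Tp).
        exact: mfn_piecewise_p (inL2_mfn (dir_L2 dirichlet_pE Tp)).
      exact: ae_piecewise_p.
    apply: (dir_ael one_three oM fM zero_trace_m_cong dirichlet_mE Tm).
      exact: mfn_piecewise_m (inL2_mfn (dir_L2 dirichlet_mE Tm)).
    exact: ae_piecewise_m.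
  apply/ae_setU; split.
    by apply: aeS hp => x h Px; rewrite !(piecewiseU disjPM)// h.
  apply: aeS hm => x h Mx; rewrite !piecewiseV//.
  rewrite -[LHS]mul1r -(divff muC_neq0) -mulrA h// mulrBr; congr (_ - _).
  by rewrite mulrA mulrCA divff ?mulr1// muC_neq0.
(* On Omega_- both Im (z / mu)^2 and the datum carry the factor mu^-2, so the same constant serves
   both sides. *)
pose K := complex.Im z ^+ 2; have K0 : 0 < K by rewrite exprn_even_gt0.
exists K^-1 => u f [g [f' [Tp Tm] gf'] /ae_setU[hp hm]].
have [->|fin] := eqVneq (sqL2 lam (bulk G) f) +oo%E.
  by rewrite gt0_muley ?leey// lte_fin invr_gt0.
have /L2bulk[Lfp Lfm] : (sqL2 lam (bulk G) f < +oo)%E by rewrite ltey.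
have Lup := dir_L2 dirichlet_pE Tp; have Lum := dir_L2 dirichlet_mE Tm.
rewrite !(sqL2_setU _ mP mM disjPM) !N2E// -!EFinD -EFinM lee_fin mulrDr.
have bp := dir_bound oP dirichlet_pE hsa.1 Tp Lfp hp.
have hm' : ae_eq_on lam (Omm G) (fun x => ((mu%:C)%C)^-1 * f x)
    (fun x => f' x - z / (mu%:C)%C * u x).
  apply: aeS2 hm gf' => x a b Mx; rewrite a// b// mulrBr mulrA mulVf ?muC_neq0// mul1r.
  by rewrite mulrA [_ * z]mulrC.
have bm : (complex.Im z / mu) ^+ 2 * N2 lam (Omm G) u <= (mu^-1) ^+ 2 * N2 lam (Omm G) f.
  have e : ((mu^-1)%:C)%C = ((mu%:C)%C)^-1 :> R[i] by rewrite -(fmorphV (real_complex R)).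
  rewrite -Im_divC -[mu^-1 ^+ 2]csqC e -(N2Z mM)//.
  exact: (dir_bound oM dirichlet_mE hsa.2 Tm (L2Z mM _ Lfm) hm').
apply: lerD; first by rewrite ler_pdivlMl.
rewrite ler_pdivlMl//; move: bm; rewrite exprMn -/K [K * _ ^+ _]mulrC -mulrA ler_pM2l//.
by rewrite exprn_even_gt0// invr_eq0.
Qed.

(** A real z is its own conjugate, and a non-real one has a non-real conjugate, which is in the
    resolvent set anyway. *)
Lemma spec_B_conj z : ~ spec_B G mu z -> ~ spec_B G mu (z^*)%C.
Proof.
move=> hz; have [z0|z0] := eqVneq (complex.Im z) 0.
  rewrite (_ : (z^*)%C = z)//; apply: eq_CReIm; rewrite !CE//.
  by rewrite z0 oppr0.
by apply: nonreal_resolvent; rewrite CImJ oppr_eq0.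
Qed.

End Transmission.

Section Helmholtz.
Variables (R : realType) (n : nat).
Notation E := 'rV[R]_n.
Notation B := (borelT R n).
Notation F := (fn R n).
Notation meas := {measure set (borelT R n) -> \bar R}.
Variables (lam : meas) (U : set E).
Hypothesis oU : open U.
Hypothesis fU : (lam U < +oo)%E.

Lemma helmholtz_ae k z u v : ae_eq_on lam U u v -> helmholtz lam U k z u ->
  helmholtz lam U k z v.
Proof.
move=> uv [l wl h]; exists l; first exact: weak_lap_ael wl.
by apply: aeS2 h uv => x a b Ux; rewrite -b// a.
Qed.

Lemma helmholtz_comb k z u v c : inL2 lam U u -> inL2 lam U v ->
  helmholtz lam U k z u -> helmholtz lam U k z v ->
  helmholtz lam U k z (fun x => u x + c * v x).
Proof.
move=> Lu Lv [l wl h] [m wm h']; exists (fun x => l x + c * m x).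
  exact: (weak_lap_comb oU fU c Lu Lv wl wm).
apply: aeS2 h h' => x a b Ux; rewrite !mulrDr a//; congr (_ + _).
by rewrite mulrCA [RHS]mulrCA b.
Qed.

End Helmholtz.

Section Eigenvectors.
Variables (R : realType) (n : nat).
Notation meas := {measure set (borelT R n) -> \bar R}.

(** Symmetry applied to the eigenvector against itself reads (z - conj z) |u|^2 = 0. *)
Lemma symmetric_eigenvector0 (m : meas) (D : set 'rV[R]_n) (T : operator R n) z u :
  measurable (D : set (borelT R n)) -> op_symmetric m D T -> T u (fun x => z * u x) ->
  inL2 m D u -> complex.Im z != 0 -> ae_eq_on m D u (fun=> 0).
Proof.
move=> mD sym Tu Lu z0; have := sym _ _ _ _ Tu Tu; rewrite !innerE.
have LuJ := L2J Lu.
have -> : (fun x => ((z * u x)^*)%C) = fun x => (z^*)%C * (u x)^*%C.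
  by apply/funext => x; rewrite conjcM.
rewrite (bilZl mD)// (bilZr mD)// bil_self// => /eqP.
rewrite -subr_eq0 -mulrBl mulf_eq0 => /orP[/eqP/(congr1 (@complex.Im R))|/eqP/(congr1 (@complex.Re R)) N0].
  by rewrite CImD CImN CImJ opprK => h; case/eqP: z0; move: h => /=; lra.
exact: N2_eq0_ae N0.
Qed.

End Eigenvectors.

(** * Poisson and Dirichlet-to-Neumann operators *)

Section Poisson.
Variables (R : realType) (n : nat) (G : transmission R n) (mu : R).
Notation E := 'rV[R]_n.
Notation B := (borelT R n).
Notation F := (fn R n).
Notation lam := (lebn G).
Notation Sig := (Sig G).
Notation dOm := (dOm G).
Hypothesis mu0 : mu != 0.
Hypothesis htr : traces_bounded G.
Hypothesis hsa : dirichlet_laplacians_self_adjoint G.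

Lemma mulN1C (a : R[i]) : - (1%:C)%C * a = - a.
Proof. by rewrite (_ : (1%:C)%C = 1)// mulNr mul1r. Qed.

Lemma divide_mu (a b z : R[i]) : - (mu%:C)%C * a = z * b <-> - a = z / (mu%:C)%C * b.
Proof.
have m0 := muC_neq0 mu0; split=> e.
  by rewrite [z / _]mulrC -mulrA -e mulNr mulrN mulrA mulVf ?mul1r.
by rewrite mulNr -mulrN e mulrA mulrCA divff ?mulr1.
Qed.

(** One half of [is_poisson], indexed by the order of the solution instead of that of the datum. *)
Definition solves_p s z phi u := [/\ in_HDelta lam s (Omp G) u,
  helmholtz lam (Omp G) 1 z u, eq_Sig G (gammaD_p G s u) phi &
  eq_dOm G (gammaD_bd G s u) (fun=> 0)].
Definition solves_m s z phi u := [/\ in_HDelta lam s (Omm G) u,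
  helmholtz lam (Omm G) mu z u & eq_Sig G (gammaD_m G s u) phi].

Lemma is_poissonE r z phi u : is_poisson G mu (r - 1 / 2) z phi u <->
  solves_p r z phi u /\ solves_m r z phi u.
Proof.
rewrite /is_poisson (_ : r - 1 / 2 + 1 / 2 = r); last by rewrite subrK.
by split=> [[[? ?] [? ?] ? ? ?]|[[? ? ? ?] [? ? ?]]]; do !split.
Qed.

Lemma solves_p_ae s z phi u v : 1 <= s <= 3 / 2 -> solves_p s z phi u ->
  mfn (Omp G) v -> ae_eq_on lam (Omp G) u v -> solves_p s z phi v.
Proof.
move=> /andP[s1 s2] [h1 h2 h3 h4] mv uv.
have hs : 1 / 2 <= s <= 3 / 2 by rewrite s2 andbT; lra.
have z0 := sqHDelta_ae (@oP _ _ G) (fP G) s1 (inL2_mfn (in_HDelta_L2 h1)) mv uv.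
split.
- exact: (in_HDelta_transfer (@oP _ _ G) (fP G) z0 h1).
- exact: helmholtz_ae uv h2.
- exact: (trace_eq_cong (@oP _ _ G) (fP G) (regular_Sig G) (dtb_p htr hs) h1 z0 h3).
- exact: (trace_eq_cong (@oP _ _ G) (fP G) (regular_dOm G) (dtb_bd htr hs) h1 z0 h4).
Qed.

Lemma solves_m_ae s z phi u v : 1 <= s <= 3 / 2 -> solves_m s z phi u ->
  mfn (Omm G) v -> ae_eq_on lam (Omm G) u v -> solves_m s z phi v.
Proof.
move=> /andP[s1 s2] [h1 h2 h3] mv uv.
have hs : 1 / 2 <= s <= 3 / 2 by rewrite s2 andbT; lra.
have z0 := sqHDelta_ae (@oM _ _ G) (fM G) s1 (inL2_mfn (in_HDelta_L2 h1)) mv uv.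
split.
- exact: (in_HDelta_transfer (@oM _ _ G) (fM G) z0 h1).
- exact: helmholtz_ae uv h2.
- exact: (trace_eq_cong (@oM _ _ G) (fM G) (regular_Sig G) (dtb_m htr hs) h1 z0 h3).
Qed.

Lemma solves_p_comb s z phi psi u v c : 1 / 2 <= s <= 3 / 2 ->
  solves_p s z phi u -> solves_p s z psi v ->
  solves_p s z (fun x => phi x + c * psi x) (fun x => u x + c * v x).
Proof.
move=> hs [h1 h2 h3 h4] [k1 k2 k3 k4]; split.
- exact: (in_HDelta_comb (@oP _ _ G) (fP G) c h1 k1).
- exact: (helmholtz_comb (@oP _ _ G) (fP G) c (in_HDelta_L2 h1) (in_HDelta_L2 k1) h2 k2).
- exact: (trace_eq_comb (@oP _ _ G) (fP G) (regular_Sig G) (dtb_p htr hs) c h1 k1 h3 k3).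
- apply: (@zero_comb _ _ _ _ c).
  exact: (trace_eq_comb (@oP _ _ G) (fP G) (regular_dOm G) (dtb_bd htr hs) c h1 k1 h4 k4).
Qed.

Lemma solves_m_comb s z phi psi u v c : 1 / 2 <= s <= 3 / 2 ->
  solves_m s z phi u -> solves_m s z psi v ->
  solves_m s z (fun x => phi x + c * psi x) (fun x => u x + c * v x).
Proof.
move=> hs [h1 h2 h3] [k1 k2 k3]; split.
- exact: (in_HDelta_comb (@oM _ _ G) (fM G) c h1 k1).
- exact: (helmholtz_comb (@oM _ _ G) (fM G) c (in_HDelta_L2 h1) (in_HDelta_L2 k1) h2 k2).
- exact: (trace_eq_comb (@oM _ _ G) (fM G) (regular_Sig G) (dtb_m htr hs) c h1 k1 h3 k3).
Qed.

Lemma solves_p_L2 s z phi u : solves_p s z phi u -> inL2 lam (Omp G) u.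
Proof. by move=> [/in_HDelta_L2]. Qed.

Lemma solves_m_L2 s z phi u : solves_m s z phi u -> inL2 lam (Omm G) u.
Proof. by move=> [/in_HDelta_L2]. Qed.

Lemma solves_0 s z phi : 1 / 2 <= s <= 3 / 2 -> eq_Sig G phi (fun=> 0) ->
  solves_p s z phi (fun=> 0) /\ solves_m s z phi (fun=> 0).
Proof.
move=> hs p0.
have wl U : open U -> (lam U < +oo)%E -> weak_lap lam U (fun=> 0) (fun=> 0).
  by move=> oU fU; apply: weak_lap0 => //; apply: aeW.
have tr a : eq_Sig G a (fun=> 0) -> eq_Sig G a phi.
  by move=> a0; apply: aeS2 a0 p0 => x h k Tx; rewrite h// k.
split; split.
- exact: (in_HDelta0 _ (@oP _ _ G) (fP G)).
- exists (fun=> 0); first exact: wl (@oP _ _ G) (fP G).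
  by apply: aeW => x _; rewrite !mulr0.
- by apply: tr; exact: (trace_eq0 (@oP _ _ G) (fP G) (regular_Sig G) (dtb_p htr hs)).
- exact: (trace_eq0 (@oP _ _ G) (fP G) (regular_dOm G) (dtb_bd htr hs)).
- exact: (in_HDelta0 _ (@oM _ _ G) (fM G)).
- exists (fun=> 0); first exact: wl (@oM _ _ G) (fM G).
  by apply: aeW => x _; rewrite !mulr0.
- by apply: tr; exact: (trace_eq0 (@oM _ _ G) (fM G) (regular_Sig G) (dtb_m htr hs)).
Qed.

Hypothesis hpoi : poisson_well_posed G mu.

Lemma poisson_spec r z phi : ~ spec_B G mu z -> 1 / 2 <= r <= 3 / 2 ->
  in_Hb Sig (r - 1 / 2) phi ->
  [/\ solves_p r z phi (poisson_op G mu z phi), solves_m r z phi (poisson_op G mu z phi)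
    & forall u, solves_p r z phi u -> solves_m r z phi u ->
        ae_eq_on lam (bulk G) u (poisson_op G mu z phi)].
Proof.
move=> hz hr hphi; have ht : 0 <= r - 1 / 2 <= 1 by move: hr => /andP[a b]; apply/andP; split; lra.
have [/(_ phi hphi)[/is_poissonE[h1 h2] H] _] := hpoi hz ht.
by split => // u up um; apply: H; apply/is_poissonE.
Qed.

Section Level.
Variable s : R.
Hypothesis hs : 1 <= s <= 3 / 2.

Lemma hs_half : 1 / 2 <= s <= 3 / 2.
Proof. by move: hs => /andP[a b]; apply/andP; split; lra. Qed.

Lemma s_ge1 : 1 <= s. Proof. by case/andP: hs. Qed.

Lemma ntb_p : neumann_trace_bounded lam s (Omp G) Sig (-1).
Proof. by have [] := htr.2 s hs. Qed.
Lemma ntb_m : neumann_trace_bounded lam s (Omm G) Sig 1.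
Proof. by have [] := htr.2 s hs. Qed.

Lemma gammaN_p_ae u v : inL2 lam (Omp G) u -> mfn (Omp G) v ->
  ae_eq_on lam (Omp G) u v -> gammaN_p G s u = gammaN_p G s v.
Proof.
move=> Lu mv uv; apply: (@gammaN_cong _ _ lam (Omp G) Sig s (@oP _ _ G) (fP G) (-1) u v).
exact: (sqHDelta_ae (@oP _ _ G) (fP G) s_ge1 (inL2_mfn Lu) mv uv).
Qed.

Lemma gammaN_m_ae u v : inL2 lam (Omm G) u -> mfn (Omm G) v ->
  ae_eq_on lam (Omm G) u v -> gammaN_m G s u = gammaN_m G s v.
Proof.
move=> Lu mv uv; apply: (@gammaN_cong _ _ lam (Omm G) Sig s (@oM _ _ G) (fM G) 1 u v).
exact: (sqHDelta_ae (@oM _ _ G) (fM G) s_ge1 (inL2_mfn Lu) mv uv).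
Qed.

(** [dn_p] picks its own solution on Omega_+, while uniqueness is known for pairs. Completing that
    choice by the Poisson solution on Omega_- gives a pair to which uniqueness applies. *)
Lemma dn_pE z psi : ~ spec_B G mu z -> in_Hb Sig (s - 1 / 2) psi ->
  dn_p G s z psi = gammaN_p G s (poisson_op G mu z psi).
Proof.
move=> hz hpsi; have [sp sm uniq] := poisson_spec hz hs_half hpsi.
rewrite /dn_p; set X := [set u | _]; set u1 := xget _ X.
have X1 : X u1 by apply: xgetPex; exists (poisson_op G mu z psi).
have {}X1 : solves_p s z psi u1 by [].
have L1 := solves_p_L2 X1; have Lp := solves_p_L2 sp.
pose w := piecewise (Omm G) u1 (poisson_op G mu z psi).
have wp : solves_p s z psi w.
  by apply: (solves_p_ae hs X1); [exact: mfn_piecewise_p (inL2_mfn L1)|exact: ae_piecewise_p].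
have wm : solves_m s z psi w.
  apply: (solves_m_ae hs sm); [exact: mfn_piecewise_m (inL2_mfn (solves_m_L2 sm))|exact: ae_piecewise_m].
have /ae_setU[h _] := uniq w wp wm.
apply: gammaN_p_ae => //; first exact: (inL2_mfn Lp).
by apply: aeS2 h (ae_piecewise_p G u1 (poisson_op G mu z psi)) => x a b Px; exact: etrans (b Px) (a Px).
Qed.

Lemma dn_mE z psi : ~ spec_B G mu z -> in_Hb Sig (s - 1 / 2) psi ->
  dn_m G s (z / (mu%:C)%C) psi = gammaN_m G s (poisson_op G mu z psi).
Proof.
move=> hz hpsi; have [sp sm uniq] := poisson_spec hz hs_half hpsi.
have m0 := muC_neq0 mu0.
rewrite /dn_m; set X := [set u | _]; set u1 := xget _ X.
have X1 : X u1.
  apply: xgetPex; exists (poisson_op G mu z psi); have [h1 [l wl hl] h3] := sm.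
  split; [exact: h1| |exact: h3]; exists l; first exact: wl.
  by apply: aeS hl => x h Mx; rewrite mulN1C; apply/divide_mu; exact: h.
have {}X1 : solves_m s z psi u1.
  have [h1 [l wl hl] h3] := X1; split; [exact: h1| |exact: h3]; exists l; first exact: wl.
  by apply: aeS hl => x h Mx; apply/divide_mu; rewrite -mulN1C; exact: h.
have L1 := solves_m_L2 X1; have Lp := solves_m_L2 sm.
pose w := piecewise (Omm G) (poisson_op G mu z psi) u1.
have wm : solves_m s z psi w.
  by apply: (solves_m_ae hs X1); [exact: mfn_piecewise_m (inL2_mfn L1)|exact: ae_piecewise_m].
have wp : solves_p s z psi w.
  apply: (solves_p_ae hs sp); [exact: mfn_piecewise_p (inL2_mfn (solves_p_L2 sp))|exact: ae_piecewise_p].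
have /ae_setU[_ h] := uniq w wp wm.
apply: gammaN_m_ae => //; first exact: (inL2_mfn Lp).
by apply: aeS2 h (ae_piecewise_m G (poisson_op G mu z psi) u1) => x a b Px; exact: etrans (b Px) (a Px).
Qed.

Definition njump (u : F) : F -> R[i] := fun phi =>
  (mu%:C)%C * gammaN_m G s u phi + gammaN_p G s u phi.

Lemma ThetaM_njump z psi phi : ~ spec_B G mu z -> in_Hb Sig (s - 1 / 2) psi ->
  ThetaM G mu s z psi phi = njump (poisson_op G mu z psi) phi.
Proof.
move=> hz hpsi; rewrite /ThetaM /M_op opprB addrC subrK.
by rewrite dn_pE// dn_mE// addrC.
Qed.

Lemma njump_ae u v : inL2 lam (bulk G) u -> mfn (bulk G) v ->
  ae_eq_on lam (bulk G) u v -> njump u = njump v.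
Proof.
move=> /(inL2_setU lam (mP G) (mM G) (@disjPM _ _ G))[L1 L2].
move=> /(mfn_setU (mP G) (mM G))[m1 m2] /ae_setU[h1 h2].
by rewrite /njump (gammaN_p_ae L1 m1 h1) (gammaN_m_ae L2 m2 h2).
Qed.

Lemma njump_comb u v c phi : in_HDelta lam s (Omp G) u -> in_HDelta lam s (Omm G) u ->
  in_HDelta lam s (Omp G) v -> in_HDelta lam s (Omm G) v ->
  in_Hb Sig (3 / 2 - s) phi ->
  njump (fun x => u x + c * v x) phi = njump u phi + c * njump v phi.
Proof.
move=> u1 u2 v1 v2 hphi; rewrite /njump /gammaN_p /gammaN_m.
rewrite (gammaN_comb (@oP _ _ G) (fP G) (regular_Sig G) ntb_p c u1 v1)//.
rewrite (gammaN_comb (@oM _ _ G) (fM G) (regular_Sig G) ntb_m c u2 v2)//.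
move: (neumann_trace _ _ _ _ _ _ _) (neumann_trace _ _ _ _ _ _ _) (neumann_trace _ _ _ _ _ _ _) (neumann_trace _ _ _ _ _ _ _).
by move=> a b d e; ring.
Qed.

Lemma solves_A z phi u : solves_p s z phi u -> solves_m s z phi u ->
  dual_eq Sig (3 / 2 - s) (njump u) (fun=> 0) ->
  A_op G mu s u (fun x => z * u x).
Proof.
move=> [h1 [lp wp hp] h3 h4] [k1 [lm wm hm] k3] j0; split => //.
- by apply: aeS2 h3 k3 => x a b Tx; rewrite a// b.
exists lp, lm; split => //.
  by apply: aeS hp => x h Px; rewrite -(h Px) mulN1C.
by apply: aeS hm => x h Px; rewrite -(h Px).
Qed.

Lemma A_solves z u g : A_op G mu s u g ->
  ae_eq_on lam (bulk G) (fun=> 0) (fun x => g x - z * u x) ->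
  [/\ solves_p s z (gammaD_p G s u) u, solves_m s z (gammaD_p G s u) u
    & dual_eq Sig (3 / 2 - s) (njump u) (fun=> 0)].
Proof.
move=> [[h1 h2] h3 h4 h5 [lp [lm [wp wm gp gm]]]] /ae_setU[zp zm].
have r0 : eq_Sig G (gammaD_p G s u) (gammaD_p G s u) by apply: aeW.
split; [split; [exact: h1| |exact: r0|exact: h3]|split; [exact: h2| |exact: h4]|exact: h5].
  exists lp; first exact: wp.
  apply: aeS2 gp zp => x a b Px; rewrite mulN1C -a//.
  by apply/eqP; rewrite -subr_eq0; apply/eqP; rewrite -b.
exists lm; first exact: wm.
apply: aeS2 gm zm => x a b Px; rewrite -a//.
by apply/eqP; rewrite -subr_eq0; apply/eqP; rewrite -b.
Qed.

Lemma kernel_A z u : ~ spec_B G mu z -> inL2 lam (bulk G) u ->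
  op_shift lam (bulk G) (A_op G mu s) z u (fun=> 0) <->
  exists psi, [/\ in_Hb Sig (s - 1 / 2) psi,
    dual_eq Sig (3 / 2 - s) (ThetaM G mu s z psi) (fun=> 0)
    & ae_eq_on lam (bulk G) u (poisson_op G mu z psi)].
Proof.
move=> hz Lu; have Lbulk := inL2_setU lam (mP G) (mM G) (@disjPM _ _ G).
split=> [[g Aug gz]|[psi [hpsi Tpsi up]]].
  have [sp sm j0] := A_solves Aug gz.
  have hpsi : in_Hb Sig (s - 1 / 2) (gammaD_p G s u).
    by apply: (gammaD_in_Hb (@oP _ _ G) (fP G) (dtb_p htr hs_half)); case: sp.
  have [psp psm uniq] := poisson_spec hz hs_half hpsi.
  have up := uniq u sp sm.
  exists (gammaD_p G s u); split => // phi hphi; rewrite ThetaM_njump//.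
  rewrite -(@njump_ae u)//; first exact: j0.
  by apply: (@inL2_mfn _ _ lam); apply/Lbulk; split; [exact: solves_p_L2 psp|exact: solves_m_L2 psm].
have [psp psm _] := poisson_spec hz hs_half hpsi.
have /ae_setU[up1 up2] := up.
have /(mfn_setU (mP G) (mM G))[m1 m2] := inL2_mfn Lu.
exists (fun x => z * u x); last by apply: aeW => x _; rewrite subrr.
apply: (@solves_A z psi).
- by apply: (solves_p_ae hs psp) => //; apply: aeS up1 => x h Px; rewrite h.
- by apply: (solves_m_ae hs psm) => //; apply: aeS up2 => x h Px; rewrite h.
move=> phi hphi; rewrite (@njump_ae u (poisson_op G mu z psi))//.
  by rewrite -ThetaM_njump// Tpsi.
by apply: (@inL2_mfn _ _ lam); apply/Lbulk; split; [exact: solves_p_L2 psp|exact: solves_m_L2 psm].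
Qed.

Lemma nonreal_injective z : op_symmetric lam (bulk G) (A_op G mu s) ->
  complex.Im z != 0 -> ThetaM_injective G mu s z.
Proof.
move=> sym z0 psi1 psi2 h1 h2 e12.
have hz := nonreal_resolvent mu0 htr hsa z0.
have [p1 m1 _] := poisson_spec hz hs_half h1.
have [p2 m2 _] := poisson_spec hz hs_half h2.
set P1 := poisson_op G mu z psi1 in p1 m1; set P2 := poisson_op G mu z psi2 in p2 m2.
pose u : F := fun x => P1 x + -1 * P2 x.
have sp := solves_p_comb (-1) hs_half p1 p2.
have sm := solves_m_comb (-1) hs_half m1 m2.
have Lu : inL2 lam (bulk G) u.
  apply/(inL2_setU lam (mP G) (mM G) (@disjPM _ _ G)).
  by split; [exact: solves_p_L2 sp|exact: solves_m_L2 sm].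
have j0 : dual_eq Sig (3 / 2 - s) (njump u) (fun=> 0).
  move=> phi hphi; rewrite njump_comb//; [|by case: p1|by case: m1|by case: p2|by case: m2].
  by rewrite -!ThetaM_njump// e12// mulN1r subrr.
have Au := solves_A sp sm j0.
have u0 := symmetric_eigenvector0 (mBulk G) sym Au Lu z0.
have /ae_setU[u0p _] := u0.
(* The difference u of the two Poisson solutions has trace psi1 - psi2 on Sigma; being null, it also
   has the trace of the zero function. *)
have [hu _ tu _] := sp; have [_ _ t0 _] := (solves_0 z hs_half (aeW _ (fun x _ => erefl (0 : R[i])))).1.
have zz := sqHDelta_ae (@oP _ _ G) (fP G) s_ge1 (inL2_mfn (in_HDelta_L2 hu)) (@mfn_cst _ _ _ 0) u0p.
have tu0 := trace_eq_cong (@oP _ _ G) (fP G) (regular_Sig G) (dtb_p htr hs_half) hu zz tu.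
apply: aeS2 tu0 t0 => x a b Tx; have /esym/eqP := etrans (esym (b Tx)) (a Tx).
by rewrite mulN1r subr_eq0 => /eqP.
Qed.

End Level.
End Poisson.

Section SlobodeckijTraces.
Variables (R : realType) (n : nat) (S : surface R n) (t : R).
Hypothesis t1 : t < 1.
Local Transparent sqHb.

Lemma sqHb_ae0 u : mfn setT u -> ae_eq_on (area S) setT u (fun=> 0) -> sqHb S t u = 0%E.
Proof. by move=> mu u0; rewrite /sqHb t1; apply: sqSlob_ae0. Qed.

Lemma in_Hb_ReIm u : in_Hb S t u ->
  in_Hb S t (fun x => (complex.Re (u x))%:C%C) /\ in_Hb S t (fun x => (complex.Im (u x))%:C%C).
Proof. by rewrite /in_Hb /sqHb t1 => /sqSlob_Re; apply. Qed.

End SlobodeckijTraces.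
Local Opaque sqHb.

Section GreenPairing.
Variables (R : realType) (n : nat).
Notation E := 'rV[R]_n.
Notation F := (fn R n).
Notation meas := {measure set (borelT R n) -> \bar R}.

Lemma conj_eigen (k : R) (a b z : R[i]) : - (k%:C)%C * a = (z^*)%C * b ->
  (k%:C)%C * (a^*)%C = - z * (b^*)%C.
Proof.
move=> e; have e1 := congr1 (@complex.Re R) e; have e2 := congr1 (@complex.Im R) e.
by move: e1 e2; rewrite !CE => e1 e2; apply: eq_CReIm; rewrite !CE; lra.
Qed.

(** Symmetry of T on u and p - h trades the real function h for the solution p of the homogeneous
    equation at conj z. That equation replaces k Lap p by a multiple of p, and the two terms combine
    into f. *)
Lemma green_pairing (lam : meas) (U : set E) (T : operator R n) (k : R) z
    (u l p lp h lh f : F) : measurable (U : set (borelT R n)) -> op_symmetric lam U T ->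
  T u (fun x => - l x) -> T (fun x => p x + -1 * h x) (fun x => - (lp x + -1 * lh x)) ->
  inL2 lam U u -> inL2 lam U l -> inL2 lam U p -> inL2 lam U lp ->
  inL2 lam U h -> inL2 lam U lh ->
  (forall x, (h x)^*%C = h x) -> (forall x, (lh x)^*%C = lh x) ->
  ae_eq_on lam U (fun x => - (k%:C)%C * lp x) (fun x => (z^*)%C * p x) ->
  ae_eq_on lam U f (fun x => - (k%:C)%C * l x - z * u x) ->
  (k%:C)%C * (bil lam U l h - bil lam U u lh) = - bil lam U f (fun x => (p x)^*%C).
Proof.
move=> mU sym Tu Tw Lu Ll Lp Llp Lh Llh hr lhr hp hf.
have LpJ := L2J Lp; have LlpJ := L2J Llp.
have := sym _ _ _ _ Tu Tw; rewrite !innerE.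
have -> : (fun x => ((p x + -1 * h x)^*)%C) = fun x => (p x)^*%C + -1 * h x.
  by apply/funext => x; rewrite !mulN1r conjcB hr.
have -> : (fun x => ((- (lp x + -1 * lh x))^*)%C) = fun x => lh x + -1 * (lp x)^*%C.
  by apply/funext => x; rewrite !mulN1r opprB conjcB lhr.
rewrite bilNl//; last exact: L2_comb.
rewrite !bil_combr// => e.
have er : ae_eq_on lam U u u by apply: aeW.
have ep : ae_eq_on lam U (fun x => (p x)^*%C) (fun x => (p x)^*%C) by apply: aeW.
have e2 : (k%:C)%C * bil lam U u (fun x => (lp x)^*%C) = - z * bil lam U u (fun x => (p x)^*%C).
  rewrite -!bilZr//; apply: bil_ae => //; apply: aeS hp => x hx Ux.
  exact: conj_eigen (hx Ux).
have -> : bil lam U l h - bil lam U u lh =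
    bil lam U l (fun x => (p x)^*%C) - bil lam U u (fun x => (lp x)^*%C).
  move: e; rewrite !mulN1r opprB => e.
  move: (bil lam U l h) (bil lam U u lh) (bil lam U l (fun x => (p x)^*%C))
    (bil lam U u (fun x => (lp x)^*%C)) e => a b c d e.
  by have -> : a = b - d + c by [rewrite -e subrK]; ring.
rewrite mulrBr e2 (bil_ae hf ep).
have -> : (fun x => - (k%:C)%C * l x - z * u x) = fun x => - (k%:C)%C * l x + - z * u x.
  by apply/funext => x; rewrite !mulNr.
rewrite bil_combl//; last exact: L2Z.
by rewrite bilZl//; ring.
Qed.

End GreenPairing.

(** * The resolvent formula *)

Section ResolventFormula.
Variables (R : realType) (n : nat) (G : transmission R n) (mu : R).
Notation E := 'rV[R]_n.
Notation B := (borelT R n).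
Notation F := (fn R n).
Notation lam := (lebn G).
Notation Sig := (Sig G).
Notation dOm := (dOm G).
Hypothesis mu0 : mu != 0.
Hypothesis htr : traces_bounded G.
Hypothesis hsa : dirichlet_laplacians_self_adjoint G.
Hypothesis hpoi : poisson_well_posed G mu.
Variable s : R.
Hypothesis hs : 1 <= s <= 3 / 2.

Lemma trace_smooth_self U (S : surface R n) r v : open U -> (lam U < +oo)%E ->
  regular_surface S -> dirichlet_trace_bounded lam r U S -> csmooth v ->
  in_HDelta lam r U v -> ae_eq_on (area S) setT (dirichlet_trace lam r U S v) v.
Proof.
move=> oU fU rS b cv hv.
exact: (gammaD_ae oU fU rS b hv (fsubuu _ oU fU _) (dtrace_smooth r oU fU rS cv)).
Qed.

Lemma ae_on_boundary (U : set E) (S : surface R n) a b : is_boundary_of lam U S ->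
  (forall x, bdry U x -> a x = b x) -> ae_eq_on (area S) setT a b.
Proof.
move=> [a0 _ _ _] ab; exists (~` bdry U); split => //.
  apply: measurableC; apply: closed_meas; rewrite /bdry setDE.
  apply: closedI; first exact: closed_closure.
  by apply: open_closedC; exact: open_interior.
by move=> x nx bx; apply: nx => /= _; exact: ab.
Qed.

Section OneTest.
Variables (z : R[i]) (ub gp gm f : F) (h : E -> R).
Hypothesis hz : ~ spec_B G mu z.
Hypothesis Tp : dirichlet_p G ub gp.
Hypothesis Tm : dirichlet_m G ub gm.
Hypothesis Lf : inL2 lam (bulk G) f.
Hypothesis fp : ae_eq_on lam (Omp G) f (fun x => gp x - z * ub x).
Hypothesis fm : ae_eq_on lam (Omm G) f (fun x => (mu%:C)%C * gm x - z * ub x).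
Hypothesis th : test_fun (Om G) h.
Let hC : F := fun x => (h x)%:C%C.
Hypothesis hHb : in_Hb Sig (3 / 2 - s) hC.
Let p := poisson_op G mu (z^*)%C hC.

(** [green_trace] makes each Neumann trace of [ub] at h a volume expression and [green_pairing]
    makes that a pairing of f with p; the weight mu on Omega_- is the one in the jump. *)
Lemma njump_test : njump G mu s ub hC = - innerL2 lam (bulk G) f p.
Proof.
have [sh _] := th; have ch := csmooth_real sh.
have h32 : 1 / 2 <= (3 / 2 : R) <= 3 / 2 by exact: half_three.
(* The datum h must have order 1 for p to have order 3/2, the order at which the Dirichlet
   Laplacians are defined. *)
have h1 : in_Hb Sig (3 / 2 - 1 / 2) hC.
  have e1 : (3 / 2 - 1 / 2 : R) = 1 by lra.
  by rewrite e1; exact: (test_in_Hb1 (one_sided_m G) (dtb_m htr h32) th).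
have [sp sm _] := poisson_spec hpoi (spec_B_conj mu0 htr hsa hz) h32 h1.
rewrite -/p in sp sm.
have [pp [lpp wpp hpp] tpp bpp] := sp; have [pm [lpm wpm hpm] tpm] := sm.
have hhp := test_in_HDelta (one_sided_p G) th.
have hhm := test_in_HDelta (one_sided_m G) th.
have whp := weak_lap_csmooth (one_sided_p G) ch.
have whm := weak_lap_csmooth (one_sided_m G) ch.
pose lh := laplC hC.
have s32 : 1 <= s <= 3 / 2 by [].
have oP' := @oP _ _ G; have oM' := @oM _ _ G.
have zc (a b : F) : ae_eq_on (area Sig) setT a (fun x => b x + -1 * b x) ->
    ae_eq_on (area Sig) setT a (fun=> 0).
  by apply: aeS => x e Tx; rewrite (e Tx) mulN1r subrr.
have Twp : dirichlet_p G (fun x => p x + -1 * hC x) (fun x => - (lpp x + -1 * lh x)).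
  apply/dirichlet_pE; split.
  - exact: (in_HDelta_comb oP' (fP G) (-1) pp hhp).
  - split.
      apply: (@zero_comb _ _ _ _ (-1)).
      apply: (trace_eq_comb oP' (fP G) (regular_dOm G) (dtb_bd htr h32) (-1) pp hhp bpp).
      apply: aeS2 (trace_smooth_self oP' (fP G) (regular_dOm G) (dtb_bd htr h32) ch hhp)
        (@ae_on_boundary _ _ hC (fun=> 0) (@dOmP _ _ G) _) => [x a b Tx|x [_ bx]].
        exact: etrans (a Tx) (b Tx).
      have [_ [K [_ KU hK]]] := th; rewrite /hC hK// => /KU Ox; apply: bx.
      by rewrite (interior_id _).1//; exact: Om_open.
    apply: (@zc _ hC).
    apply: (trace_eq_comb oP' (fP G) (regular_Sig G) (dtb_p htr h32) (-1) pp hhp tpp).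
    exact: (trace_smooth_self oP' (fP G) (regular_Sig G) (dtb_p htr h32) ch hhp).
  - exists (fun x => lpp x + -1 * lh x); last by apply: aeW.
    exact: (weak_lap_comb oP' (fP G) (-1) (in_HDelta_L2 pp) (in_HDelta_L2 hhp) wpp whp).
have Twm : dirichlet_m G (fun x => p x + -1 * hC x) (fun x => - (lpm x + -1 * lh x)).
  apply/dirichlet_mE; split.
  - exact: (in_HDelta_comb oM' (fM G) (-1) pm hhm).
  - apply: (@zc _ hC).
    apply: (trace_eq_comb oM' (fM G) (regular_Sig G) (dtb_m htr h32) (-1) pm hhm tpm).
    exact: (trace_smooth_self oM' (fM G) (regular_Sig G) (dtb_m htr h32) ch hhm).
  - exists (fun x => lpm x + -1 * lh x); last by apply: aeW.
    exact: (weak_lap_comb oM' (fM G) (-1) (in_HDelta_L2 pm) (in_HDelta_L2 hhm) wpm whm).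
have /dirichlet_pE[up [ubd uSp] [lup wup gpe]] := Tp.
have /dirichlet_mE[um uSm [lum wum gme]] := Tm.
have e32 : 1 <= s <= 3 / 2 by [].
have level U S (oU : open U) (bU : bounded_set U) (rS : regular_surface S)
    (b : forall r, 1 / 2 <= r <= 3 / 2 -> dirichlet_trace_bounded lam r U S) :
    in_HDelta lam (3 / 2) U ub ->
    ae_eq_on (area S) setT (dirichlet_trace lam (3 / 2) U S ub) (fun=> 0) ->
    ae_eq_on (area S) setT (dirichlet_trace lam s U S ub) (fun=> 0).
  move=> hu t0; have := gammaD_level oU bU rS hs (b _ h32) (b _ (hs_half hs)) hu.
  by move=> lv; apply: aeS2 lv t0 => x a c Tx; rewrite (a Tx) (c Tx).
have grp := green_trace (one_sided_p G) (weak_lap_unique_p htr hsa) (dtb_p htr (hs_half hs))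
  (ntb_p htr hs) (in_HDelta_level oP' (@Omp_bounded _ _ G) hs up) wup
  (level _ _ oP' (@Omp_bounded _ _ G) (regular_Sig G) (fun r => @dtb_p _ _ G htr r) up uSp) th hHb.
have grm := green_trace (one_sided_m G) (weak_lap_unique_m htr hsa) (dtb_m htr (hs_half hs))
  (ntb_m htr hs) (in_HDelta_level oM' (@Omm_bounded _ _ G) hs um) wum
  (level _ _ oM' (@Omm_bounded _ _ G) (regular_Sig G) (fun r => @dtb_m _ _ G htr r) um uSm) th hHb.
have Lbulk := inL2_setU lam (mP G) (mM G) (@disjPM _ _ G).
have /Lbulk[Lfp Lfm] := Lf.
have Lpb : inL2 lam (bulk G) p by apply/Lbulk; split; [exact: in_HDelta_L2 pp|exact: in_HDelta_L2 pm].
have lhE : (fun x => (lapl h x)%:C%C) = lh by rewrite /lh laplC_real.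
have reC (a : R) : ((a%:C)^*)%C = (a%:C)%C :> R[i] by exact: conjc_real.
have Tp' : dirichlet_p G ub (fun x => - lup x) by exact: (dir_aer (dirichlet_pE G) Tp gpe).
have Tm' : dirichlet_m G ub (fun x => - lum x) by exact: (dir_aer (dirichlet_mE G) Tm gme).
have [_ symp _] := hsa.1; have [_ symm _] := hsa.2.
have prp := green_pairing (k := 1) (z := z) (f := f) (mP G) symp Tp' Twp
  (in_HDelta_L2 up) wup.1 (in_HDelta_L2 pp) wpp.1 (in_HDelta_L2 hhp) whp.1.
have prm := green_pairing (k := mu) (z := z) (f := f) (mM G) symm Tm' Twm
  (in_HDelta_L2 um) wum.1 (in_HDelta_L2 pm) wpm.1 (in_HDelta_L2 hhm) whm.1.
rewrite /njump /gammaN_p /gammaN_m grp grm lhE.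
rewrite innerE (bil_setU (mP G) (mM G) (@disjPM _ _ G))//; last exact: L2J.
have hr x : (hC x)^*%C = hC x by exact: reC.
have lhr x : (lh x)^*%C = lh x by rewrite -lhE; exact: reC.
have fp' : ae_eq_on lam (Omp G) f (fun x => - (1%:C)%C * lup x - z * ub x).
  by apply: aeS2 fp gpe => x a b Px; rewrite (a Px) (b Px) mulN1C.
have fm' : ae_eq_on lam (Omm G) f (fun x => - (mu%:C)%C * lum x - z * ub x).
  by apply: aeS2 fm gme => x a b Px; rewrite (a Px) (b Px) mulrN mulNr.
rewrite prm// opprD addrC; congr (_ + _).
by rewrite -[LHS]mul1r; exact: prp.
Qed.

End OneTest.

(* Approximants: smooth functions tending in Omega_- to a Poisson extension of phi,
   times a cutoff equal to 1 on Sigma. *)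
Lemma hb_tests phi : in_Hb Sig (3 / 2 - s) phi -> exists v : nat -> F,
  (forall k, test_fun (Om G) (fun x => complex.Re (v k x)) /\
             test_fun (Om G) (fun x => complex.Im (v k x))) /\
  null_seq (sqHb Sig (3 / 2 - s)) (fun k => fsub (v k) phi).
Proof.
move=> hphi; have r := regular_Sig G.
have [s1 s2] := andP hs.
(* A datum of this order is the trace of a Poisson solution of order 2 - s, a number between 1/2 and
   1; the point z = i serves as it is outside the spectrum. *)
have er : 3 / 2 - s = (2 - s) - 1 / 2 by lra.
have hr : 1 / 2 <= 2 - s <= 3 / 2 by apply/andP; split; lra.
have hi : ~ spec_B G mu 'i%C by apply: (nonreal_resolvent mu0 htr hsa); rewrite /= oner_neq0.
rewrite er in hphi *.
have [_ [hm _ tm] _] := poisson_spec hpoi hi hr hphi.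
set q := poisson_op _ _ _ _ in hm tm.
have bm := dtb_m htr hr.
have /dtraceP[v [sv _ vt]] := gammaD_spec bm hm.
set ga := dirichlet_trace _ _ _ _ _ in vt.
have [nz cb] := lipschitz_boundary_null (@lamP _ _ G) (@Omm_bounded _ _ G) (@Omm_lipschitz _ _ G).
have [chi [tchi chi1]] := cutoff cb (@Om_open _ _ G) (@bdry_sub_Om _ _ G).
exists (fun k x => (chi x)%:C%C * v k x); split.
  move=> k; have [sa sb] := sv k; split.
    have := test_mull tchi sa.
    congr test_fun; apply/funext => x; by rewrite CReM CReC CImC mul0r subr0.
  have := test_mull tchi sb.
  congr test_fun; apply/funext => x; by rewrite CImM CReC CImC mul0r addr0.
have qn := qnorm_sqHb r (2 - s - 1 / 2).
move/(null_seqP _ qn): vt => vt.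
apply/(null_seqP _ qn) => e e0.
have p : 0 < e / 2 by rewrite divr_gt0.
apply: filterS (vt _ p) => k hk.
(* Both summands vanish almost everywhere on Sigma: chi is 1 there, and [ga] is the trace of a
   solution with datum phi. *)
pose d : F := fun x => ((chi x)%:C%C * v k x - v k x) + (ga x - phi x).
have Lv := csmooth_cont r (sv k).
have Lga := in_Hb_L2 (gammaD_in_Hb (@oM _ _ G) (fM G) bm hm).
have Lphi := in_Hb_L2 hphi.
have mchi : mfn setT (fun x => (chi x)%:C%C) by exact: (test_mfn _ tchi).
have d0 : sqHb Sig (2 - s - 1 / 2) d = 0%E.
  apply: sqHb_ae0; first by lra.
    apply: mfnD; apply: mfnD; [|exact: mfnN (inL2_mfn Lv)|exact: inL2_mfn Lga|exact: mfnN (inL2_mfn Lphi)].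
    exact: mfnM mchi (inL2_mfn Lv).
  have b0 := @ae_on_boundary _ _ (fun x => (chi x)%:C%C) (fun=> 1) (@SigP _ _ G)
    (fun x bx => congr1 (fun a : R => (a%:C)%C : R[i]) (chi1 x bx)).
  apply: aeS2 b0 tm => x a b Tx; rewrite /d (a Tx) mul1r subrr add0r.
  by rewrite -/(ga x) in b; apply/eqP; rewrite subr_eq0; apply/eqP; exact: b.
have -> : fsub (fun x => (chi x)%:C%C * v k x) phi = fun x => fsub (v k) ga x + 1 * d x.
  by apply/funext => x; rewrite /fsub /d mul1r; ring.
have [_ _ qc] := qn.
apply: le_trans (qc _ _ _ (le_lt_trans hk (ltry _)) _) _; first by rewrite d0.
rewrite d0 mule0 adde0; apply: le_trans (lee_wpmul2l _ hk) _ => //.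
by rewrite -EFinM lee_fin; lra.
Qed.

Lemma innerL2_conj (m : {measure set B -> \bar R}) (D : set E) u v :
  measurable (D : set B) -> inL2 m D u -> inL2 m D v ->
  innerL2 m D u v = (innerL2 m D v u)^*%C.
Proof.
move=> mD Lu Lv; rewrite !innerE -bilJ//; last exact: L2J.
rewrite bilC; congr (bil _ _ _ _); apply/funext => x; by rewrite conjcK.
Qed.

Section Adjoint.
Variables (z : R[i]) (ub gp gm f g : F).
Hypothesis hz : ~ spec_B G mu z.
Hypothesis Tp : dirichlet_p G ub gp.
Hypothesis Tm : dirichlet_m G ub gm.
Hypothesis Lf : inL2 lam (bulk G) f.
Hypothesis fp : ae_eq_on lam (Omp G) f (fun x => gp x - z * ub x).
Hypothesis fm : ae_eq_on lam (Omm G) f (fun x => (mu%:C)%C * gm x - z * ub x).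
Hypothesis adj : is_poisson_adjoint G mu (z^*)%C f g.

Lemma poisson_L2 phi : in_Hb Sig (3 / 2 - 1 / 2) phi ->
  inL2 lam (bulk G) (poisson_op G mu (z^*)%C phi).
Proof.
move=> hphi.
have [sp sm _] := poisson_spec hpoi (spec_B_conj mu0 htr hsa hz) (half_three R) hphi.
apply/(inL2_setU lam (mP G) (mM G) (@disjPM _ _ G)).
by split; [exact: solves_p_L2 sp|exact: solves_m_L2 sm].
Qed.

Lemma njump_test_adjoint (h : E -> R) : test_fun (Om G) h ->
  in_Hb Sig (3 / 2 - s) (fun x => (h x)%:C%C) ->
  njump G mu s ub (fun x => (h x)%:C%C) = - surf_pair Sig g (fun x => (h x)%:C%C).
Proof.
move=> th hHb; rewrite (njump_test hz Tp Tm Lf fp fm th hHb); congr (- _).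
have e1 : (3 / 2 - 1 / 2 : R) = 1 by lra.
have h1 : in_Hb Sig (3 / 2 - 1 / 2) (fun x => (h x)%:C%C).
  by rewrite e1; exact: (test_in_Hb1 (one_sided_m G) (dtb_m htr (half_three R)) th).
have Lh := in_Hb_L2 hHb; have [Lg adjE] := adj.
rewrite (innerL2_conj (mBulk G) Lf (poisson_L2 h1)) adjE//.
rewrite -(innerL2_conj measurableT Lg Lh) innerE; congr (bil _ _ _ _).
by apply/funext => x; exact: conjc_real.
Qed.

(** D, the sum of the two functionals, is linear and bounded on H^{3/2-s}(Sigma) and vanishes on
    test functions, which approximate phi by [hb_tests]. *)
Lemma njump_adjoint phi : in_Hb Sig (3 / 2 - s) phi ->
  njump G mu s ub phi = - surf_pair Sig g phi.
Proof.
move=> hphi; have r := regular_Sig G; have [Lg _] := adj.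
have [s1 s2] := andP hs.
have t1 : 3 / 2 - s < 1 by lra.
have hup : in_HDelta lam s (Omp G) ub.
  by apply: (in_HDelta_level (@oP _ _ G) (@Omp_bounded _ _ G) hs); case: Tp.
have hum : in_HDelta lam s (Omm G) ub.
  by apply: (in_HDelta_level (@oM _ _ G) (@Omm_bounded _ _ G) hs); case: Tm.
pose D phi := njump G mu s ub phi + surf_pair Sig g phi.
have Dlin a b c : in_Hb Sig (3 / 2 - s) a -> in_Hb Sig (3 / 2 - s) b ->
    D (fun x => a x + c * b x) = D a + c * D b.
  move=> ha hb; rewrite /D /njump /gammaN_p /gammaN_m.
  rewrite (gammaN_linear r (ntb_p htr hs) c hup ha hb).
  rewrite (gammaN_linear r (ntb_m htr hs) c hum ha hb).
  have es : surf_pair Sig g (fun x => a x + c * b x) = surf_pair Sig g a + c * surf_pair Sig g b.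
    exact: (bil_combr measurableT c Lg (in_Hb_L2 ha) (in_Hb_L2 hb)).
  rewrite es.
  move: (neumann_trace _ _ _ _ _ _ a) (neumann_trace _ _ (Omm G) _ _ _ a).
  move: (neumann_trace _ _ _ _ _ _ b) (neumann_trace _ _ (Omm G) _ _ _ b).
  move: (surf_pair Sig g a) (surf_pair Sig g b) => x1 x2 x3 x4 x5 x6.
  by ring.
have [Cp HCp] := gammaN_bound (@oP _ _ G) (fP G) r (ntb_p htr hs) hup.
have [Cm HCm] := gammaN_bound (@oM _ _ G) (fM G) r (ntb_m htr hs) hum.
pose K := 4 * mu ^+ 2 * Cm + 4 * Cp + 2 * N2 (area Sig) setT g.
have Dbound w : in_Hb Sig (3 / 2 - s) w -> csq (D w) <= K * fine (sqHb Sig (3 / 2 - s) w).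
  move=> hw; have Lw := in_Hb_L2 hw.
  have N0 : (0 <= sqHb Sig (3 / 2 - s) w)%E by have [q _ _] := qnorm_sqHb r (3 / 2 - s); exact: q.
  have c3 : csq (surf_pair Sig g w) <= N2 (area Sig) setT g * fine (sqHb Sig (3 / 2 - s) w).
    apply: le_trans (cauchy_schwarz measurableT Lg Lw) _; rewrite ler_wpM2l ?N2_ge0//.
    by apply: fine_le; rewrite ?ge0_fin_numE ?sqL2_ge0//; exact: sqL2_le_sqHb.
  have c1 := HCp w hw; have c2 := HCm w hw.
  apply: le_trans (csqD_le _ _) _.
  have c4 := csqD_le ((mu%:C)%C * gammaN_m G s ub w) (gammaN_p G s ub w).
  have c5 : csq ((mu%:C)%C * gammaN_m G s ub w) <= mu ^+ 2 * (Cm * fine (sqHb Sig (3 / 2 - s) w)).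
    by rewrite csqM csqC ler_wpM2l// sqr_ge0.
  rewrite -/(njump G mu s ub w) in c4.
  have {}c1 : csq (gammaN_p G s ub w) <= Cp * fine (sqHb Sig (3 / 2 - s) w) by exact: c1.
  move: (csq (njump _ _ _ _ _)) c4 => a1; move: (csq (surf_pair _ _ _)) c3 => a2.
  move: (csq ((mu%:C)%C * _)) c5 => a3; move: (csq (gammaN_p _ _ _ _)) c1 => a4.
  rewrite /K; move: (fine _) (N2 _ _ _) => a5 a6 h1 h2 h3 h4.
  rewrite -/K; nra.
have [v [tv nv]] := hb_tests hphi.
apply/eqP; rewrite -addr_eq0; apply/eqP; rewrite -/(D phi).
apply: (@csq_small _ _ `|K|) => e e0.
have qn := qnorm_sqHb r (3 / 2 - s).
have [k hk] := filter_ex ((null_seqP _ qn).1 nv _ e0).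
pose w := fsub (v k) phi; have hw : in_Hb Sig (3 / 2 - s) w by exact: (le_lt_trans hk (ltry _)).
have ev : v k = fun x => phi x + 1 * w x by apply/funext => x; rewrite /w /fsub; ring.
have hv : in_Hb Sig (3 / 2 - s) (v k) by rewrite ev; exact: (in_Hb_comb r 1 hphi hw).
(* Test functions are real, so the complex approximant is treated by components. *)
have D0 : D (v k) = 0.
  have [h1 h2] := in_Hb_ReIm t1 hv; have [t2 t3] := tv k.
  have -> : v k = fun x => (complex.Re (v k x))%:C%C + 'i%C * (complex.Im (v k x))%:C%C.
    by apply/funext => x; apply: eq_CReIm; rewrite /= !(mul0r, mulr0, mul1r, addr0, add0r, subr0).
  rewrite Dlin// /D njump_test_adjoint// njump_test_adjoint//.
  by rewrite !addNr mulr0 addr0.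
have : D (v k) = D phi + 1 * D w by rewrite {1}ev Dlin.
rewrite D0 mul1r => /esym/eqP; rewrite addr_eq0 => /eqP ->; rewrite csqN.
apply: le_trans (Dbound w hw) _; rewrite mulrC.
have N0 : (0 <= sqHb Sig (3 / 2 - s) w)%E by have [q _ _] := qn; exact: q.
apply: (@le_trans _ _ (fine (sqHb Sig (3 / 2 - s) w) * `|K|)).
  by rewrite ler_wpM2l ?fine_ge0// ler_norm.
by rewrite ler_wpM2r// -lee_fin fineK// ge0_fin_numE.
Qed.

End Adjoint.

Lemma A_comb u f v g c : A_op G mu s u f -> A_op G mu s v g ->
  A_op G mu s (fun x => u x + c * v x) (fun x => f x + c * g x).
Proof.
move=> [[h1 h2] h3 h4 h5 [lp [lm [wp wm gp gm]]]] [[k1 k2] k3 k4 k5 [mp [mm [xp xm yp ym]]]].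
have hh := hs_half hs.
have oP' := @oP _ _ G; have oM' := @oM _ _ G.
have rr (S : surface R n) a : ae_eq_on (area S) setT a a by apply: aeW.
split.
- split; first exact: (in_HDelta_comb oP' (fP G) c h1 k1).
  exact: (in_HDelta_comb oM' (fM G) c h2 k2).
- apply: (@zero_comb _ _ _ _ c).
  exact: (trace_eq_comb oP' (fP G) (regular_dOm G) (dtb_bd htr hh) c h1 k1 h3 k3).
- have a1 := trace_eq_comb oP' (fP G) (regular_Sig G) (dtb_p htr hh) c h1 k1 (rr _ _) (rr _ _).
  have a2 := trace_eq_comb oM' (fM G) (regular_Sig G) (dtb_m htr hh) c h2 k2 h4 k4.
  by apply: aeS2 a1 a2 => x a b Tx; exact: etrans (b Tx) (esym (a Tx)).
- move=> phi hphi; have e := njump_comb mu htr hs c h1 h2 k1 k2 hphi.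
  have e5 : njump G mu s u phi = 0 := h5 phi hphi.
  have e6 : njump G mu s v phi = 0 := k5 phi hphi.
  by rewrite e5 e6 mulr0 addr0 in e; exact: e.
exists (fun x => lp x + c * mp x), (fun x => lm x + c * mm x); split.
- exact: (weak_lap_comb oP' (fP G) c (in_HDelta_L2 h1) (in_HDelta_L2 k1) wp xp).
- exact: (weak_lap_comb oM' (fM G) c (in_HDelta_L2 h2) (in_HDelta_L2 k2) wm xm).
- by apply: aeS2 gp yp => x a b Px; rewrite (a Px) (b Px) mulrN opprD.
- by apply: aeS2 gm ym => x a b Px; rewrite (a Px) (b Px) mulrDr mulrCA.
Qed.

Lemma A_L2 u f : A_op G mu s u f -> inL2 lam (bulk G) u.
Proof.
move=> [[h1 h2] _ _ _ _]; apply/(inL2_setU lam (mP G) (mM G) (@disjPM _ _ G)).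
by split; [exact: in_HDelta_L2 h1|exact: in_HDelta_L2 h2].
Qed.

Lemma njump0 phi : in_Hb Sig (3 / 2 - s) phi -> njump G mu s (fun=> 0) phi = 0.
Proof.
move=> hphi; have h1 := in_HDelta0 s (@oP _ _ G) (fP G); have h2 := in_HDelta0 s (@oM _ _ G) (fM G).
have := njump_comb mu htr hs (-1) h1 h2 h1 h2 hphi.
rewrite (_ : (fun x : E => _) = fun=> 0 : R[i]); last by apply/funext => x; rewrite mulr0 addr0.
by rewrite mulN1r subrr.
Qed.

(** By (a) a difference of two solutions is P_z psi with psi in the kernel of Theta - M_z. Then psi
    is null, and the Poisson problem with null datum has the zero solution. *)
Lemma op_shift_A_injective z : ~ spec_B G mu z -> ThetaM_injective G mu s z ->
  op_injective lam (bulk G) (op_shift lam (bulk G) (A_op G mu s) z).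
Proof.
move=> hz inj u1 u2 f [g1 A1 e1] [g2 A2 e2].
have Ad := A_comb (-1) A1 A2; have Ld := A_L2 Ad.
pose d : F := fun x => u1 x + -1 * u2 x.
have sh : op_shift lam (bulk G) (A_op G mu s) z d (fun=> 0).
  exists (fun x => g1 x + -1 * g2 x); first exact: Ad.
  apply: aeS2 e1 e2 => x a b Bx; have := etrans (esym (a Bx)) (b Bx).
  move=> /eqP; rewrite -subr_eq0 => /eqP <-; rewrite /d; ring.
have [psi [hpsi Tpsi dpsi]] := (kernel_A mu0 htr hpoi hs hz Ld).1 sh.
have h0 : in_Hb Sig (s - 1 / 2) (fun=> 0) := in_Hb0 (regular_Sig G) (s - 1 / 2).
have z0 : eq_Sig G (fun=> 0) (fun=> 0) by apply: aeW.
have L0 : inL2 lam (bulk G) (fun=> 0) by exact: L2_0.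
have psi0 : eq_Sig G psi (fun=> 0).
  apply: (inj _ _ hpsi h0) => phi hphi.
  rewrite (Tpsi phi hphi) (ThetaM_njump mu0 htr hpoi hs phi hz h0).
  have [s0p s0m] := solves_0 mu htr z (hs_half hs) z0.
  have [pp pm uniq] := poisson_spec hpoi hz (hs_half hs) h0.
  rewrite -(njump_ae mu hs L0 _ (uniq _ s0p s0m)); first by rewrite (njump0 hphi).
  apply: (@inL2_mfn _ _ lam); apply/(inL2_setU lam (mP G) (mM G) (@disjPM _ _ G)).
  by split; [exact: solves_p_L2 pp|exact: solves_m_L2 pm].
have [s0p s0m] := solves_0 mu htr z (hs_half hs) psi0.
have [_ _ uniq] := poisson_spec hpoi hz (hs_half hs) hpsi.
apply: aeS2 dpsi (uniq _ s0p s0m) => x a b Bx.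
have := etrans (a Bx) (esym (b Bx)); rewrite /d mulN1r => /eqP.
by rewrite subr_eq0 => /eqP.
Qed.

(** The Poisson term adds nothing to the equation and equal traces from both sides of Sigma; its
    jump, the pairing with g, cancels that of [ub] found in [njump_adjoint]. *)
Lemma krein_solution z f g psi ub : ~ spec_B G mu z -> inL2 lam (bulk G) f ->
  is_poisson_adjoint G mu (z^*)%C f g -> in_Hb Sig (s - 1 / 2) psi ->
  dual_eq Sig (3 / 2 - s) (ThetaM G mu s z psi) (surf_pair Sig g) ->
  op_shift lam (bulk G) (B_op G mu) z ub f ->
  op_shift lam (bulk G) (A_op G mu s) z (fun x => ub x + poisson_op G mu z psi x) f.
Proof.
move=> hz Lf adj hpsi Tpsi [gb [gm [Tp Tm] gbm] fb].
have /ae_setU[fp fm0] := fb.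
have fm : ae_eq_on lam (Omm G) f (fun x => (mu%:C)%C * gm x - z * ub x).
  by apply: aeS2 fm0 gbm => x a b Mx; rewrite (a Mx) (b Mx).
have J := njump_adjoint hz Tp Tm Lf fp fm adj.
have [sp sm _] := poisson_spec hpoi hz (hs_half hs) hpsi.
set p := poisson_op G mu z psi in sp sm *.
have /dirichlet_pE[up [ubd uSp] [lup wup gpe]] := Tp.
have /dirichlet_mE[um uSm [lum wum gme]] := Tm.
have [h1 [lp wp hp] h3 h4] := sp; have [k1 [lm wm hm] k3] := sm.
have hh := hs_half hs; have h32 := half_three R.
have oP' := @oP _ _ G; have oM' := @oM _ _ G.
have up' := in_HDelta_level oP' (@Omp_bounded _ _ G) hs up.
have um' := in_HDelta_level oM' (@Omm_bounded _ _ G) hs um.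
have tr0 (S : surface R n) a b : ae_eq_on (area S) setT a b ->
    ae_eq_on (area S) setT b (fun=> 0) -> ae_eq_on (area S) setT a (fun=> 0).
  by move=> ab b0; apply: aeS2 ab b0 => x q t Tx; exact: etrans (q Tx) (t Tx).
have t1 := tr0 _ _ _ (gammaD_level oP' (@Omp_bounded _ _ G) (regular_dOm G) hs (dtb_bd htr h32) (dtb_bd htr hh) up) ubd.
have t2 := tr0 _ _ _ (gammaD_level oP' (@Omp_bounded _ _ G) (regular_Sig G) hs (dtb_p htr h32) (dtb_p htr hh) up) uSp.
have t3 := tr0 _ _ _ (gammaD_level oM' (@Omm_bounded _ _ G) (regular_Sig G) hs (dtb_m htr h32) (dtb_m htr hh) um) uSm.
have -> : (fun x => ub x + p x) = fun x => ub x + 1 * p x.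
  by apply/funext => x; rewrite mul1r.
exists (fun x => gb x + z * p x); last first.
  by apply: aeS fb => x a Bx; rewrite (a Bx) mul1r; ring.
split.
- split; first exact: (in_HDelta_comb oP' (fP G) 1 up' h1).
  exact: (in_HDelta_comb oM' (fM G) 1 um' k1).
- apply: (@zero_comb _ _ _ _ 1).
  exact: (trace_eq_comb oP' (fP G) (regular_dOm G) (dtb_bd htr hh) 1 up' h1 t1 h4).
- have a1 := trace_eq_comb oP' (fP G) (regular_Sig G) (dtb_p htr hh) 1 up' h1 t2 h3.
  have a2 := trace_eq_comb oM' (fM G) (regular_Sig G) (dtb_m htr hh) 1 um' k1 t3 k3.
  by apply: aeS2 a1 a2 => x a b Tx; exact: etrans (b Tx) (esym (a Tx)).
- move=> phi hphi; have e := njump_comb mu htr hs 1 up' um' h1 k1 hphi.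
  have e5 := Tpsi phi hphi; rewrite (ThetaM_njump mu0 htr hpoi hs phi hz hpsi) in e5.
  by rewrite (J phi hphi) e5 mul1r addNr in e; exact: e.
exists (fun x => lup x + 1 * lp x), (fun x => lum x + 1 * lm x); split.
- exact: (weak_lap_comb oP' (fP G) 1 (in_HDelta_L2 up') (in_HDelta_L2 h1) wup wp).
- exact: (weak_lap_comb oM' (fM G) 1 (in_HDelta_L2 um') (in_HDelta_L2 k1) wum wm).
- apply: aeS2 gpe hp => x a b Px; rewrite (a Px) -(b Px) mulN1C mul1r opprD//.
- have gm' : ae_eq_on lam (Omm G) gb (fun x => (mu%:C)%C * - lum x).
    by apply: aeS2 gbm gme => x a b Mx; rewrite (a Mx) (b Mx).
  by apply: aeS2 gm' hm => x a b Px; rewrite (a Px) -(b Px) mul1r !mulNr mulrN mulrDr opprD.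
Qed.

End ResolventFormula.

Local Transparent sqHDelta sqHb sqH sqL2 sqSlob cintegral pderiv lapl ndiff dirichlet_trace neumann_trace.

Theorem theorem13 (R : realType) (n : nat) (G : transmission R n) (mu s : R)
    (hmu0 : mu != 0) (hmu1 : mu != 1) (hs : 1 <= s <= 3 / 2)
    (htr : traces_bounded G)
    (hsa : dirichlet_laplacians_self_adjoint G)
    (hsym : op_symmetric (lebn G) (bulk G) (A_op G mu s))
    (hpoi : poisson_well_posed G mu) :
  [/\
    forall z, ~ spec_B G mu z ->
      forall u : fn R n, (sqL2 (lebn G) (bulk G) u < +oo)%E ->
        op_shift (lebn G) (bulk G) (A_op G mu s) z u (fun=> 0) <->
        exists psi, [/\ in_Hb (Sig G) (s - 1 / 2) psi,
          dual_eq (Sig G) (3 / 2 - s) (ThetaM G mu s z psi) (fun=> 0)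
          & ae_eq_on (lebn G) (bulk G) u (poisson_op G mu z psi)],
    forall z : R[i], complex.Im z != 0 -> ThetaM_injective G mu s z
  & forall z, ~ spec_B G mu z -> ThetaM_injective G mu s z ->
      forall f g : fn R n, (sqL2 (lebn G) (bulk G) f < +oo)%E ->
        is_poisson_adjoint G mu (z^*)%C f g ->
        (exists psi, in_Hb (Sig G) (s - 1 / 2) psi /\
           dual_eq (Sig G) (3 / 2 - s) (ThetaM G mu s z psi) (surf_pair (Sig G) g)) ->
        [/\ op_injective (lebn G) (bulk G) (op_shift (lebn G) (bulk G) (A_op G mu s) z),
            exists u, op_shift (lebn G) (bulk G) (A_op G mu s) z u f
          & ae_eq_on (lebn G) (bulk G)
              (op_inv (op_shift (lebn G) (bulk G) (A_op G mu s) z) f)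
              (fun x => op_inv (op_shift (lebn G) (bulk G) (B_op G mu) z) f x +
                 poisson_op G mu z (ThetaM_inv G mu s z (surf_pair (Sig G) g)) x)]].
Proof.
split.
- by move=> z hz u Lu; exact: (kernel_A hmu0 htr hpoi hs hz Lu).
- by move=> z z0; exact: (nonreal_injective hmu0 htr hsa hpoi hs hsym z0).
move=> z hz inj f g Lf adj hpsi.
have injA := op_shift_A_injective hmu0 htr hpoi hs hz inj.
pose SA := op_shift (lebn G) (bulk G) (A_op G mu s) z.
pose SB := op_shift (lebn G) (bulk G) (B_op G mu) z.
have hB : SB (op_inv SB f) f.
  (* [spec_B] negates the resolvent set, so [hz] is a double negation; surjectivity of B - z
     provides the solution picked by [op_inv]. *)
  have [h _] := contrapT hz.
  exact: (xgetPex (P := [set u | SB u f]) (fun=> 0) (h f Lf)).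
pose X := [set psi | in_Hb (Sig G) (s - 1 / 2) psi /\
  dual_eq (Sig G) (3 / 2 - s) (ThetaM G mu s z psi) (surf_pair (Sig G) g)].
have [h1 h2] : X (ThetaM_inv G mu s z (surf_pair (Sig G) g)) by exact: (xgetPex (P := X) (fun=> 0) hpsi).
have hA := krein_solution hmu0 htr hsa hpoi hs hz Lf adj h1 h2 hB.
have hA' : exists u, SA u f by eexists; exact: hA.
split => //.
(* Both sides solve (A - z) u = f, one by choice and the other by construction; injectivity
   identifies them. *)
exact: injA (xgetPex (P := [set u | SA u f]) (fun=> 0) hA') hA.
Qed.
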